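(* Let $\mathcal{S}$ be a submodule of $H^2(\mathbb{D}^n)$ and let $i\in\{1,\ldots,n\}$. Then $\mathcal{S}=\theta(z_i)H^2(\mathbb{D}^n)$ for an inner function $\theta(z_i)$ depending only on the $z_i$-variable if and only if $$(I_{\mathcal{S}}-E_{z_j}E_{z_j}^* )(I_{\mathcal{S}}-R_{z_j}R_{z_j}^* )=0\quad\text{for all } j\in\{1,\ldots,n\}\setminus\{i\}.$$
   Context: Throughout $n\ge 2$. $H^2(\mathbb{D}^n)$ is the Hardy space of analytic functions $f$ on the unit polydisc $\mathbb{D}^n$ with $\|f\|=\sup_{0\le r<1}\big(\int_{\mathbb{T}^n}|f(r\boldsymbol z)|^2\,d\mu\big)^{1/2}<\infty$, where $\mu$ is normalized Lebesgue measure on the $n$-torus $\mathbb{T}^n$; $M_{z_j}$ is multiplication by the coordinate function $z_j$. A submodule is a closed subspace $\mathcal{S}\subseteq H^2(\mathbb{D}^n)$ with $M_{z_j}\mathcal{S}\subseteq\mathcal{S}$ for all $j\in\{1,\ldots,n\}$. $P_{\mathcal{S}}$ is the orthogonal projection onto $\mathcal{S}$ and $I_{\mathcal{S}}$ is the identity on $\mathcal{S}$. $R_{z_j}:=M_{z_j}|_{\mathcal{S}}:\mathcal{S}\to\mathcal{S}$, with adjoint taken on $\mathcal{S}$. $E_{z_j}:=P_{\mathcal{S}}\circ ev_{z_j}:H^2(\mathbb{D}^n)\to\mathcal{S}$, where $(ev_{z_j}f)(z_1,\ldots,z_n)=f(z_1,\ldots,z_{j-1},0,z_{j+1},\ldots,z_n)$,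 so that $E_{z_j}E_{z_j}^*$ is an operator on $\mathcal{S}$. An inner function on $\mathbb{D}^n$ is a bounded analytic function on $\mathbb{D}^n$ whose boundary values have modulus $1$ almost everywhere on $\mathbb{T}^n$.
   Formalization: The submodule S is assumed nonzero: for S = {0} the operator identity holds trivially, but {0} is not of the form θ(z_i)H²(D^n) with θ inner. *)

(* Defs.v *)
From HB Require Import structures.
From mathcomp Require Import all_boot all_order all_algebra.
From mathcomp Require Import complex.
From mathcomp Require Import all_classical all_reals all_analysis.
From mathcomp.analysis.showcase Require Import summability.
Set Implicit Arguments.
Unset Strict Implicit.
Unset Printing Implicit Defensive.
Import Order.TTheory GRing.Theory Num.Theory.
Import numFieldNormedType.Exports.
Local Open Scope classical_set_scope.
Local Open Scope ring_scope.

(* The copy R[i]^o is the one that carries the topology induced by the modulus. *)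
Notation Cplx R := ((complex R)^o).

Definition modulus (R : realType) (z : Cplx R) : R := Normc.normc z.

Section ProductProbability.
Context (R : realType) d (T : measurableType d) (P : probability T R).

Definition tcons n (x : T * n.-tuple T) : n.+1.-tuple T :=
  [tuple of x.1 :: x.2].

Lemma measurable_tcons n : measurable_fun [set: T * n.-tuple T] (@tcons n).
Proof. exact: measurable_cons. Qed.

HB.instance Definition _ n :=
  isMeasurableFun.Build _ _ (T * n.-tuple T)%type (n.+1.-tuple T) (@tcons n)
    (@measurable_tcons n).

(* The n-fold product P \x ... \x P. *)
Fixpoint power_prob n : probability (n.-tuple T) R :=
  match n with
  | 0 => \d_ [tuple]
  | m.+1 => distribution (P \x power_prob m)%E (@tcons m)
  end.

End ProductProbability.

Section Torus.
Context (R : realType).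

Lemma twopi_gt0 : 0 < 2 * pi :> R.
Proof. by rewrite mulr_gt0 ?pi_gt0. Qed.

(* Normalized Lebesgue measure on the n-torus, carried by the angles
   t \in [0, 2 pi]^n. *)
Definition torus_measure n := power_prob (uniform_prob twopi_gt0) n.

(* The point r . zeta, where zeta = (exp(i t_1), ..., exp(i t_n)). *)
Definition circle_pt n (r : R) (t : n.-tuple R) : 'rV[Cplx R]_n :=
  \row_j Complex (r * cos (tnth t j)) (r * sin (tnth t j)).

End Torus.

Section Hardy.
Context (R : realType) (n : nat).
Local Notation C := (Cplx R).

Definition in_polydisc : pred 'rV[C]_n :=
  fun z => [forall j, modulus (z 0 j) < 1].

Definition polydisc : Type := {z : 'rV[C]_n | in_polydisc z}.

Definition coord (j : 'I_n) (z : polydisc) : C := (val z) 0 j.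

(* Extension by 0; only ever evaluated inside the polydisc below. *)
Definition ext0 (f : polydisc -> C) (w : 'rV[C]_n) : C :=
  if insub w is Some z then f z else 0.

(* Analytic: near each point a of the polydisc, f is the sum of an
   (unconditionally convergent) power series in z - a. *)
Definition analytic (f : polydisc -> C) : Prop :=
  forall a : polydisc, exists2 rho : R, 0 < rho &
    exists c : {ffun 'I_n -> nat} -> C,
    forall z : polydisc,
      (forall j, modulus (coord j z - coord j a) < rho) ->
      partial_sum (fun k : {ffun 'I_n -> nat} =>
        c k * \prod_j (coord j z - coord j a) ^+ k j) A
        @[A --> totally] --> f z.

Definition hardy_norm (f : polydisc -> C) : \bar R :=
  ereal_sup
    [set ('N[torus_measure R n]_(2%:E)
           [ (fun t => (modulus (ext0 f (circle_pt r t)))%:E) ])%E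
    | r in `[0, 1[%classic ].

Definition hardy : set (polydisc -> C) :=
  [set f | analytic f /\ (hardy_norm f < +oo)%E].

Definition hnorm (f : polydisc -> C) : R := fine (hardy_norm f).

(* The inner product inducing the norm of the Hardy space (polarization);
   linear in the first variable. *)
Definition inner (f g : polydisc -> C) : C :=
  4^-1 * \sum_(k < 4)
    (Complex 0 1) ^+ k * Complex (hnorm (f + (Complex 0 1) ^+ k *: g) ^+ 2) 0.

Definition closed_in_hardy (S : set (polydisc -> C)) : Prop :=
  forall f, hardy f ->
    (forall e : R, 0 < e -> exists2 g, S g & hnorm (f - g) < e) -> S f.

(* Multiplication by the coordinate function z_j. *)
Definition mulz (j : 'I_n) (f : polydisc -> C) : polydisc -> C :=
  fun z => coord j z * f z.

Record submodule (S : set (polydisc -> C)) : Prop := Submodule {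
  submodule_hardy : S `<=` hardy;
  submodule0 : S 0;
  submodule_lin : forall (a : C) f g, S f -> S g -> S (a *: f + g);
  submodule_closed : closed_in_hardy S;
  submodule_mulz : forall j f, S f -> S (mulz j f)
}.

(* The unique element of S whose difference with f is orthogonal to S. *)
Definition orth_proj (S : set (polydisc -> C)) (f : polydisc -> C) :
    polydisc -> C :=
  xget 0 [set p | S p /\ forall s, S s -> inner (f - p) s = 0].

(* Adjoint of an operator T : H -> K between closed subspaces of the Hardy
   space, applied to h in K: the g in H such that <T f, h> = <f, g> on H.  It
   depends on K only through the choice of h. *)
Definition adjoint (H : set (polydisc -> C))
    (T : (polydisc -> C) -> (polydisc -> C)) (h : polydisc -> C) :
    polydisc -> C :=
  xget 0 [set g | H g /\ forall f, H f -> inner (T f) h = inner f g].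

Definition zero_coord_row (j : 'I_n) (w : 'rV[C]_n) : 'rV[C]_n :=
  \row_k (if k == j then 0 else w 0 k).

Lemma zero_coord_subproof (j : 'I_n) (z : polydisc) :
  in_polydisc (zero_coord_row j (val z)).
Proof.
apply/forallP => k; rewrite mxE; case: eqP => _.
  by rewrite /modulus Normc.normc0.
exact: (forallP (valP z)).
Qed.

Definition zero_coord (j : 'I_n) (z : polydisc) : polydisc :=
  exist in_polydisc _ (zero_coord_subproof j z).

Definition ev (j : 'I_n) (f : polydisc -> C) : polydisc -> C :=
  fun z => f (zero_coord j z).

(* R_{z_j} is mulz j restricted to S; its adjoint is taken on S. *)
Definition Radj (S : set (polydisc -> C)) (j : 'I_n) := adjoint S (mulz j).

Definition opE (S : set (polydisc -> C)) (j : 'I_n) (f : polydisc -> C) :=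
  orth_proj S (ev j f).

Definition Eadj (S : set (polydisc -> C)) (j : 'I_n) := adjoint hardy (opE S j).

(* I_S - R_{z_j} R_{z_j}^* and I_S - E_{z_j} E_{z_j}^*, to be applied on S. *)
Definition defectR (S : set (polydisc -> C)) (j : 'I_n) (f : polydisc -> C) :=
  f - mulz j (Radj S j f).

Definition defectE (S : set (polydisc -> C)) (j : 'I_n) (f : polydisc -> C) :=
  f - opE S j (Eadj S j f).

(* Boundary values are radial limits. *)
Definition inner_function (theta : polydisc -> C) : Prop :=
  [/\ analytic theta,
      exists M : R, forall z, modulus (theta z) <= M &
      {ae torus_measure R n, forall t, exists2 l : C,
         ext0 theta (circle_pt r t) @[r --> (1 : R)^'-] --> l &
         modulus l = 1}].

Definition depends_only_on (i : 'I_n) (theta : polydisc -> C) : Prop :=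
  forall z w, coord i z = coord i w -> theta z = theta w.

End Hardy.

(* Main.v *)
(* Work with the Taylor coefficients at 0: the Hardy norm is their l2 norm.  If
   S = theta H^2 with theta an inner function of z_i, multiplication by theta is an
   isometry commuting with evaluation at z_j = 0 for j <> i; so R_{z_j}^* theta g is
   theta times the backward shift of g, and both defect operators can be computed.

   Conversely, let j <> i and f in S, and put h = f - z_j R_{z_j}^* f.  The
   hypothesis says that h is the projection on S of h(z_j = 0), which is no longer
   than h; hence h = h(z_j = 0), and S is stable under evaluation at z_j = 0 and
   under the backward shift in z_j.  Let m be minimal such that the coefficient of
   z_i^m does not vanish on S, and theta the unit vector of S along the projection
   of z_i^m.  Then theta depends only on z_i, and the z^a theta are orthonormal by
   minimality of m.  Hence multiplication by theta is an isometry, so |theta| <= 1,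
   and the elements of S orthogonal to all the z^a theta vanish: S = theta H^2.
   Radial limits of theta exist almost everywhere by the Hardy-Littlewood maximal
   inequality, which dominates the Poisson integrals of the tails of the Taylor
   series; they have modulus at most 1 and mean square norm 1. *)
From HB Require Import structures.
From mathcomp Require Import all_boot all_order all_algebra.
From mathcomp Require Import complex finmap ring lra.
From mathcomp Require Import all_classical all_reals all_analysis.
From mathcomp Require Import measurable_realfun.
From mathcomp.analysis.showcase Require Import summability.
Require Import Defs.
Set Implicit Arguments.
Unset Strict Implicit.
Unset Printing Implicit Defensive.
Import Order.TTheory GRing.Theory Num.Theory.
Import numFieldNormedType.Exports.
Local Open Scope classical_set_scope.
Local Open Scope ring_scope.

(** * Unordered sums of complex numbers *)

(** The form of the definitions shapes the work. [analytic] only gives a power series near each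
    point, so a Taylor series valid on the whole polydisc has to be produced before a norm can be
    read off from coefficients; Parseval on the torus stands in for Cauchy's formula. [inner] is a
    polarization of norms: its additivity has to come from the coefficients, while a norm-preserving
    multiplier preserves it at once. [inner_function] asks for radial limits almost everywhere on
    the n-torus. In the direct implication they are given and serve only inside dominated
    convergence; in the converse they have to be proved, but for a function of one variable, so that
    everything reduces to a single angle through a marginal of the torus measure. The maximal
    inequality lives on the real line rather than on the circle, hence the angles are kept at a
    distance [eta] from 0 and 2 pi; the Poisson kernel is truncated so that only trigonometric
    polynomials are integrated. *)

Section Modulus.
Context {R : realType}.
Implicit Types x y z : Cplx R.

Lemma modulus_ge0 z : 0 <= modulus z.
Proof. by case: z => a b; exact: sqrtr_ge0. Qed.

Lemma modulus0 : modulus (0 : Cplx R) = 0. Proof. exact: Normc.normc0. Qed.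

Lemma modulus1 : modulus (1 : Cplx R) = 1. Proof. exact: Normc.normc1. Qed.

Lemma modulusM x y : modulus (x * y) = modulus x * modulus y.
Proof. exact: Normc.normcM. Qed.

Lemma modulusD x y : modulus (x + y) <= modulus x + modulus y.
Proof. exact: le_normcD. Qed.

Lemma modulusN x : modulus (- x) = modulus x.
Proof. exact: normcN. Qed.

Lemma modulusB x y : modulus (x - y) = modulus (y - x).
Proof. by rewrite -modulusN opprB. Qed.

Lemma modulus_eq0 x : (modulus x == 0) = (x == 0).
Proof.
by apply/eqP/eqP => [|->]; [exact: Normc.eq0_normc | exact: modulus0].
Qed.

Lemma modulus_gt0 x : (0 < modulus x) = (x != 0).
Proof. by rewrite lt_def modulus_eq0 modulus_ge0 andbT. Qed.

Lemma modulusX x n : modulus (x ^+ n) = modulus x ^+ n.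
Proof. by elim: n => [|n IH]; rewrite ?expr0 ?modulus1// !exprS modulusM IH. Qed.

Lemma modulusV x : modulus x^-1 = (modulus x)^-1.
Proof. exact: Normc.normcV. Qed.

Lemma modulus_prod I (r : seq I) (P : pred I) (F : I -> Cplx R) :
  modulus (\prod_(i <- r | P i) F i) = \prod_(i <- r | P i) modulus (F i).
Proof.
by elim/big_rec2 : _ => [|i a b _ <-]; rewrite ?modulus1// modulusM.
Qed.

Lemma modulus_sum I (r : seq I) (P : pred I) (F : I -> Cplx R) :
  modulus (\sum_(i <- r | P i) F i) <= \sum_(i <- r | P i) modulus (F i).
Proof.
elim/big_ind2 : _ => //; first by rewrite modulus0.
by move=> a b c d ab cd; exact: le_trans (modulusD _ _) (lerD ab cd).
Qed.

Lemma sqr_modulus z : modulus z ^+ 2 = complex.Re z ^+ 2 + complex.Im z ^+ 2.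
Proof. by case: z => a b; rewrite sqr_sqrtr// addr_ge0 ?sqr_ge0. Qed.

Lemma modulus_real (r : R) : modulus (Complex r 0) = `|r|.
Proof. by rewrite /modulus /= expr0n addr0 sqrtr_sqr. Qed.

Lemma modulus_nat m : modulus (m%:R : Cplx R) = m%:R.
Proof. by rewrite -[m%:R](rmorph_nat (real_complex R)) modulus_real normr_nat. Qed.

Lemma modulus_conj z : modulus (conjc z) = modulus z.
Proof. by case: z => a b; rewrite /modulus /= sqrrN. Qed.

Lemma Re_le_modulus z : `|complex.Re z| <= modulus z.
Proof.
rewrite -ler_sqr ?nnegrE ?modulus_ge0// sqr_modulus real_normK ?num_real//.
by rewrite lerDl sqr_ge0.
Qed.

Lemma Im_le_modulus z : `|complex.Im z| <= modulus z.
Proof.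
rewrite -ler_sqr ?nnegrE ?modulus_ge0// sqr_modulus real_normK ?num_real//.
by rewrite lerDr sqr_ge0.
Qed.

Lemma modulus_le_ReIm z : modulus z <= `|complex.Re z| + `|complex.Im z|.
Proof.
rewrite -ler_sqr ?nnegrE ?modulus_ge0 ?addr_ge0// sqr_modulus.
have -> : complex.Re z ^+ 2 = `|complex.Re z| ^+ 2 by rewrite real_normK ?num_real.
have -> : complex.Im z ^+ 2 = `|complex.Im z| ^+ 2 by rewrite real_normK ?num_real.
by have := mulr_ge0 (normr_ge0 (complex.Re z)) (normr_ge0 (complex.Im z)); nra.
Qed.

Lemma mulr_conj z : z * conjc z = Complex (modulus z ^+ 2) 0.
Proof.
rewrite sqr_modulus; case: z => a b; rewrite /GRing.mul /=.
by congr Complex; ring.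
Qed.

Lemma normr_modulus z : `|z| = Complex (modulus z) 0.
Proof. by []. Qed.

Lemma complex_gt0 (e : Cplx R) : 0 < e -> exists2 r : R, 0 < r & e = Complex r 0.
Proof. by case: e => a b; rewrite ltcE/= => /andP[/eqP -> a0]; exists a. Qed.

Lemma ReD x y : complex.Re (x + y) = complex.Re x + complex.Re y.
Proof. by case: x y => [? ?] []. Qed.
Lemma ImD x y : complex.Im (x + y) = complex.Im x + complex.Im y.
Proof. by case: x y => [? ?] []. Qed.
Lemma ReB x y : complex.Re (x - y) = complex.Re x - complex.Re y.
Proof. by case: x y => [? ?] []. Qed.
Lemma ImB x y : complex.Im (x - y) = complex.Im x - complex.Im y.
Proof. by case: x y => [? ?] []. Qed.

Lemma ReM x y : complex.Re (x * y) =
  complex.Re x * complex.Re y - complex.Im x * complex.Im y.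
Proof. by case: x y => [? ?] []. Qed.
Lemma ImM x y : complex.Im (x * y) =
  complex.Re x * complex.Im y + complex.Im x * complex.Re y.
Proof. by case: x y => [? ?] []. Qed.

Lemma Re_conj x : complex.Re (conjc x) = complex.Re x.
Proof. by case: x. Qed.
Lemma Im_conj x : complex.Im (conjc x) = - complex.Im x.
Proof. by case: x. Qed.

Lemma conjc_mul x y : conjc (x * y) = conjc x * conjc y.
Proof. exact: (rmorphM (@conjc R)). Qed.
Lemma conjc_add x y : conjc (x + y) = conjc x + conjc y.
Proof. exact: (rmorphD (@conjc R)). Qed.
Lemma conjc_opp x : conjc (- x) = - conjc x.
Proof. exact: (rmorphN (@conjc R)). Qed.

Lemma complex_eq x y : complex.Re x = complex.Re y -> complex.Im x = complex.Im y -> x = y.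
Proof. by case: x y => [? ?] [? ?] /= -> ->. Qed.

Lemma Re_sum I (r : seq I) (P : pred I) (F : I -> Cplx R) :
  complex.Re (\sum_(i <- r | P i) F i) = \sum_(i <- r | P i) complex.Re (F i).
Proof. exact: (big_morph (@complex.Re R) ReD erefl). Qed.

Lemma Im_sum I (r : seq I) (P : pred I) (F : I -> Cplx R) :
  complex.Im (\sum_(i <- r | P i) F i) = \sum_(i <- r | P i) complex.Im (F i).
Proof. exact: (big_morph (@complex.Im R) ImD erefl). Qed.

Lemma real_complex_sum I (r : seq I) (P : pred I) (F : I -> R) :
  \sum_(i <- r | P i) (Complex (F i) 0 : Cplx R) =
  Complex (\sum_(i <- r | P i) F i) 0.
Proof. by rewrite -[RHS]/(real_complex R _) rmorph_sum. Qed.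

End Modulus.

Section FsetSums.

Lemma big_fsetD_sub (V : zmodType) (I : choiceType) (A B : {fset I}) (F : I -> V) :
  (A `<=` B)%fset ->
  \sum_(i <- B) F i = \sum_(i <- A) F i + \sum_(i <- (B `\` A)%fset) F i.
Proof.
move=> AB; rewrite (big_fsetID _ (fun x => x \in A)) /=; congr (_ + _).
  apply: eq_fbigl => x; rewrite !inE /=.
  by have [/(fsubsetP AB) ->|] := boolP (x \in A); rewrite ?andbF.
by apply: eq_fbigl => x; rewrite !inE /= andbC.
Qed.

Lemma ler_sum_fset (V : numDomainType) (I : choiceType) (A B : {fset I}) (F : I -> V) :
  (forall i, 0 <= F i) -> (A `<=` B)%fset -> \sum_(i <- A) F i <= \sum_(i <- B) F i.
Proof. by move=> F0 AB; rewrite (big_fsetD_sub _ AB) lerDl sumr_ge0. Qed.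

End FsetSums.

Section HasSum.
#[local] Existing Instance totally_filter.
Context {R : realType}.
Local Notation C := (Cplx R).

(** Same notion as convergence of [partial_sum] along [totally], see [hassumP]; the real [e] and
    [modulus] avoid the partial order on complex numbers. *)
Definition hassum (I : choiceType) (F : I -> C) (s : C) : Prop :=
  forall e : R, 0 < e -> exists A0 : {fset I}, forall A : {fset I}, (A0 `<=` A)%fset ->
    modulus (\sum_(i <- A) F i - s) < e.

(** Absolute summability with the bound kept explicit: uniform estimates need the number [B], not
    mere finiteness. *)
Definition abssum (I : choiceType) (F : I -> C) (B : R) : Prop :=
  forall A : {fset I}, \sum_(i <- A) modulus (F i) <= B.

Lemma partial_sumE (I : choiceType) (F : I -> C) (A : {fset I}) :
  partial_sum F A = \sum_(i <- A) F i.
Proof. by rewrite /partial_sum -(big_seq_fsetE _ A xpredT F). Qed.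

Lemma hassumP (I : choiceType) (F : I -> C) (s : C) :
  hassum F s <-> partial_sum F A @[A --> totally] --> s.
Proof.
split=> [Fs|/cvgrPdist_lt Fs].
  apply/cvgrPdist_lt => e /complex_gt0[r r0 ->].
  have [A0 hA0] := Fs r r0; exists A0 => // A /= /hA0.
  by rewrite distrC normr_modulus partial_sumE ltcR.
move=> e e0; have [|A0 _ hA0] := Fs (Complex e 0); first by rewrite ltcR.
by exists A0 => A /hA0 /=; rewrite distrC normr_modulus partial_sumE ltcR.
Qed.

Section Basics.
Context {I : choiceType}.
Implicit Types (F G : I -> C) (s t : C).

Lemma hassum_unique F s t : hassum F s -> hassum F t -> s = t.
Proof.
move=> Fs Ft; apply/eqP; rewrite -subr_eq0 -modulus_eq0; apply/eqP.
apply/le_anti; rewrite modulus_ge0 andbT; apply/ler_addgt0Pl => e e0.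
rewrite addr0; have e2 : 0 < e / 2 by rewrite divr_gt0.
have [A0 h0] := Fs _ e2; have [A1 h1] := Ft _ e2.
have /h0 l0 : (A0 `<=` A0 `|` A1)%fset by exact: fsubsetUl.
have /h1 l1 : (A1 `<=` A0 `|` A1)%fset by exact: fsubsetUr.
set X := \sum_(i <- _) _ in l0 l1.
have -> : s - t = (X - t) - (X - s) by ring.
by apply: (le_trans (modulusD _ _)); rewrite modulusN; lra.
Qed.

Lemma eq_hassum F G s : F =1 G -> hassum F s -> hassum G s.
Proof. by move=> /funext ->. Qed.

Lemma hassumD F G s t : hassum F s -> hassum G t ->
  hassum (fun i => F i + G i) (s + t).
Proof.
move=> Fs Gt e e0; have e2 : 0 < e / 2 by rewrite divr_gt0.
have [A0 h0] := Fs _ e2; have [A1 h1] := Gt _ e2.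
exists (A0 `|` A1)%fset => A; rewrite fsubUset => /andP[/h0 l0 /h1 l1].
rewrite big_split/= opprD addrACA.
by apply: (le_lt_trans (modulusD _ _)); lra.
Qed.

Lemma hassumZ F s (a : C) : hassum F s -> hassum (fun i => a * F i) (a * s).
Proof.
move=> Fs e e0; have a0 := modulus_ge0 a.
have [|A0 h0] := Fs (e / (modulus a + 1)); first by rewrite divr_gt0// ltr_wpDl.
exists A0 => A /h0 l0; rewrite -mulr_sumr -mulrBr modulusM.
have a1 : 0 < modulus a + 1 by rewrite ltr_wpDl.
rewrite ltr_pdivlMr// in l0.
have := modulus_ge0 (\sum_(i <- A) F i - s); nra.
Qed.

Lemma hassumZr F s (a : C) : hassum F s -> hassum (fun i => F i * a) (s * a).
Proof.
move=> Fs; rewrite mulrC; apply: eq_hassum (hassumZ a Fs) => i.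
by rewrite mulrC.
Qed.

Lemma hassumN F s : hassum F s -> hassum (fun i => - F i) (- s).
Proof. by move=> /(hassumZ (-1)); rewrite mulN1r; apply: eq_hassum => i; rewrite mulN1r. Qed.

Lemma hassumB F G s t : hassum F s -> hassum G t ->
  hassum (fun i => F i - G i) (s - t).
Proof. by move=> Fs /hassumN; exact: hassumD. Qed.

Lemma hassum_conj F s : hassum F s -> hassum (fun i => conjc (F i)) (conjc s).
Proof.
move=> Fs e /Fs[A0 h0]; exists A0 => A /h0.
by rewrite -rmorph_sum -rmorphB modulus_conj.
Qed.

Lemma hassum_supp (A : {fset I}) F : (forall i, i \notin A -> F i = 0) ->
  hassum F (\sum_(i <- A) F i).
Proof.
move=> F0 e e0; exists A => B AB.
rewrite (big_fset_incl _ AB) ?subrr ?modulus0// => i _ /F0 //.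
Qed.

Lemma hassum0 : hassum (fun _ : I => 0) 0.
Proof. by have := @hassum_supp fset0%fset (fun=> 0) (fun _ _ => erefl); rewrite big_nil. Qed.

Lemma hassum_sum (J : Type) (r : seq J) (G : J -> I -> C) (s : J -> C) :
  (forall j, hassum (G j) (s j)) ->
  hassum (fun i => \sum_(j <- r) G j i) (\sum_(j <- r) s j).
Proof.
move=> Gs; elim: r => [|j r IH].
  by rewrite big_nil; apply: eq_hassum hassum0 => i; rewrite big_nil.
rewrite big_cons; apply: eq_hassum (hassumD (Gs j) IH) => i.
by rewrite big_cons.
Qed.

Lemma abssum_ge0 F B : abssum F B -> 0 <= B.
Proof. by move=> /(_ fset0%fset); rewrite big_nil. Qed.

Lemma abssum_term F B i : abssum F B -> modulus (F i) <= B.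
Proof. by move=> /(_ [fset i]%fset); rewrite big_seq_fset1. Qed.

Lemma le_abssum F G B : (forall i, modulus (F i) <= modulus (G i)) -> abssum G B ->
  abssum F B.
Proof. by move=> FG GB A; apply: le_trans (GB A); apply: ler_sum => i _. Qed.

Lemma abssumZ F B a : abssum F B -> abssum (fun i => a * F i) (modulus a * B).
Proof.
move=> FB A; under eq_bigr do rewrite modulusM.
by rewrite -mulr_sumr ler_wpM2l ?modulus_ge0.
Qed.

Lemma hassum_modulus_le F s B : hassum F s -> abssum F B -> modulus s <= B.
Proof.
move=> Fs FB; apply/ler_addgt0Pr => e e0; have [A0 h0] := Fs _ e0.
have {}h0 := h0 _ (fsubset_refl _); have hB := FB A0.
have := modulus_sum A0 xpredT F => hs.
have -> : s = \sum_(i <- A0) F i - (\sum_(i <- A0) F i - s) by ring.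
by apply: (le_trans (modulusD _ _)); rewrite modulusN; lra.
Qed.

(** The sum is the supremum of the finite sums, which yields both inequalities along with
    convergence. *)
Lemma hassum_ge0 (f : I -> R) (B : R) : (forall i, 0 <= f i) ->
  (forall A : {fset I}, \sum_(i <- A) f i <= B) ->
  exists s : R, [/\ hassum (fun i => Complex (f i) 0) (Complex s 0),
    s <= B & forall A : {fset I}, \sum_(i <- A) f i <= s].
Proof.
move=> f0 fB; pose E := [set \sum_(i <- A) f i | A in [set: {fset I}]].
have Eub : ubound E B by move=> _ [A _ <-].
have supE : has_sup E by split; [exists 0; exists fset0%fset => //; rewrite big_nil|exists B].
have fs (A : {fset I}) : \sum_(i <- A) f i <= sup E by apply: sup_upper_bound => //; exists (A : {fset I}).
exists (sup E); split => //.
  move=> e e0; have [_ [A0 _ <-] hA0] := sup_adherent e0 supE.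
  exists A0 => A /(ler_sum_fset f0) lA.
  rewrite real_complex_sum -[X in modulus X]/(Complex (_ - _) (0 - 0)) subr0.
  by rewrite modulus_real ltr_norml; have := fs A; lra.
by apply: ge_sup => //; exists 0, fset0%fset => //; rewrite big_nil.
Qed.

Lemma hassum_real_le (f : I -> R) (s : R) (A : {fset I}) : (forall i, 0 <= f i) ->
  hassum (fun i => Complex (f i) 0) (Complex s 0) -> \sum_(i <- A) f i <= s.
Proof.
move=> f0 fs; apply/ler_addgt0Pr => e e0; have [A0 h0] := fs e e0.
have := h0 (A0 `|` A)%fset (fsubsetUl _ _).
rewrite real_complex_sum -[X in modulus X]/(Complex (_ - _) (0 - 0)) subr0.
rewrite modulus_real ltr_norml.
have := ler_sum_fset f0 (fsubsetUr A0 A); lra.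
Qed.

(** A real family [f] is the difference of [|f|] and [|f| - f], both nonnegative with bounded finite
    sums; this is applied to the real and imaginary parts. *)
Lemma abssum_hassum F B : abssum F B -> exists s, hassum F s.
Proof.
move=> FB.
have key (f : I -> R) : (forall i, `|f i| <= modulus (F i)) ->
    exists s : R, hassum (fun i => Complex (f i) 0) (Complex s 0).
  move=> fF.
  have [| |s1 [h1 _ _]] := @hassum_ge0 (fun i => `|f i|) B => //.
    by move=> A; apply: le_trans (FB A); apply: ler_sum => i _.
  have [| |s2 [h2 _ _]] := @hassum_ge0 (fun i => `|f i| - f i) (B + B).
  - by move=> i; rewrite subr_ge0 ler_norm.
  - move=> A; apply: (@le_trans _ _ (\sum_(i <- A) (`|f i| + `|f i|))).
      by apply: ler_sum => i _; rewrite lerD2l; have := ler_norm (- f i); rewrite normrN.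
    rewrite big_split; apply: lerD; apply: le_trans (FB A);
    by apply: ler_sum => i _.
  exists (s1 - s2); have := hassumB h1 h2.
  rewrite -[Complex s1 0 - _]/(Complex (_ - _) (0 - 0)) subr0.
  apply: eq_hassum => i.
  rewrite -[LHS]/(Complex (_ - _) (0 - 0)) subr0.
  by congr Complex; ring.
have [s1 h1] := key _ (fun i => Re_le_modulus (F i)).
have [s2 h2] := key _ (fun i => Im_le_modulus (F i)).
exists (Complex s1 0 + Complex 0 1 * Complex s2 0).
apply: eq_hassum (hassumD h1 (hassumZ (Complex 0 1) h2)) => i.
by rewrite -complexE.
Qed.

(** Finite sums disjoint from [A0] have modulus at most 2. Splitting the indices by the sign of the
    real part, and separately by that of the imaginary part, bounds each sum of absolute values by
    4; hence the 8. *)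
Lemma hassum_abssum F s : hassum F s -> exists B, abssum F B.
Proof.
move=> Fs; have [A0 h0] := Fs 1 ltr01.
have small (A : {fset I}) : [disjoint A & A0]%fset -> modulus (\sum_(i <- A) F i) <= 2.
  move=> dA; have := h0 (A0 `|` A)%fset (fsubsetUl _ _).
  rewrite (big_fsetD_sub _ (fsubsetUl A0 A)).
  have -> : (((A0 `|` A)%fset) `\` A0 = A)%fset.
    by rewrite fsetDUl fsetDv fset0U; exact/fsetDidPl.
  have := h0 A0 (fsubset_refl _); set X := \sum_(i <- A0) _; set Y := \sum_(i <- A) _.
  move=> l1 l2; have -> : Y = (X + Y - s) - (X - s) by ring.
  by apply: (le_trans (modulusD _ _)); rewrite modulusN; lra.
have smallr (f : C -> R) (A : {fset I}) : [disjoint A & A0]%fset ->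
    (forall z, `|f z| <= modulus z) ->
    (forall B : {fset I}, f (\sum_(i <- B) F i) = \sum_(i <- B) f (F i)) ->
    \sum_(i <- A) `|f (F i)| <= 4.
  move=> dA fm fsum.
  have part (P : pred I) : `|\sum_(i <- [fset x in A | P x]%fset) f (F i)| <= 2.
    rewrite -fsum; apply: le_trans (fm _) _; apply: small.
    by apply: fdisjointWl dA; exact: fset_sub.
  rewrite (big_fsetID _ (fun i => 0 <= f (F i))) /=.
  have -> : \sum_(i <- [fset x in A | 0 <= f (F x)]%fset) `|f (F i)| =
            \sum_(i <- [fset x in A | 0 <= f (F x)]%fset) f (F i).
    by rewrite !big_seq; apply: eq_bigr => i; rewrite !inE => /andP[_ /ger0_norm].
  have -> : \sum_(i <- [fset x in A | ~~ (0 <= f (F x))]%fset) `|f (F i)| =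
            - \sum_(i <- [fset x in A | ~~ (0 <= f (F x))]%fset) f (F i).
    rewrite -sumrN !big_seq; apply: eq_bigr => i; rewrite !inE -ltNge => /andP[_ /ltW].
    by move=> /ler0_norm.
  have := part (fun x => 0 <= f (F x)); have := part (fun x => ~~ (0 <= f (F x))).
  by rewrite !ler_norml; lra.
exists (\sum_(i <- A0) modulus (F i) + 8) => A.
apply: (@le_trans _ _ (\sum_(i <- (A0 `|` A)%fset) modulus (F i))).
  by apply: ler_sum_fset (fsubsetUr _ _) => i; exact: modulus_ge0.
rewrite (big_fsetD_sub _ (fsubsetUl A0 A)) lerD2l.
set D := (_ `\` _)%fset.
have dD : [disjoint D & A0]%fset.
  by apply/fdisjointP => x; rewrite in_fsetD => /andP[].
apply: (@le_trans _ _ (\sum_(i <- D) (`|complex.Re (F i)| + `|complex.Im (F i)|))).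
  by apply: ler_sum => i _; exact: modulus_le_ReIm.
rewrite big_split/=.
have := smallr _ _ dD Re_le_modulus (fun B => Re_sum _ _ _).
have := smallr _ _ dD Im_le_modulus (fun B => Im_sum _ _ _); lra.
Qed.

End Basics.


(** The rectangle is built in two stages: [A] is arbitrary above the first projections of [A0], then
    [B] is taken so large that the inner sums over [A] are, taken together, close to their
    limits. *)
Lemma hassum_pair (I J : choiceType) (G : I * J -> C) (s : I -> C) (S : C) :
  hassum G S -> (forall i, hassum (fun j => G (i, j)) (s i)) -> hassum s S.
Proof.
move=> GS Gs e e0; have e2 : 0 < e / 2 by rewrite divr_gt0.
have [A0 h0] := GS _ e2; exists [fset x.1 | x in A0]%fset => A AA0.
have [B0 h1] := hassum_sum A Gs e2.
pose B := (B0 `|` [fset x.2 | x in A0])%fset.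
have /h1 : (B0 `<=` B)%fset by exact: fsubsetUl.
have /h0 : (A0 `<=` A `*` B)%fset.
  apply/fsubsetP => -[a b] ab; rewrite in_fsetM /=; apply/andP; split.
    by apply: (fsubsetP AA0); apply/imfsetP; exists (a, b).
  by rewrite in_fsetU; apply/orP; right; apply/imfsetP; exists (a, b).
have -> : \sum_(x <- (A `*` B)%fset) G x = \sum_(j <- B) \sum_(i <- A) G (i, j).
  by rewrite exchange_big big_imfset2 //= => -[? ?] [? ?] _ _ /= [-> ->].
set X := \sum_(j <- B) _; set Y := \sum_(i <- A) s i => l0 l1.
have -> : Y - S = (X - S) - (X - Y) by ring.
by apply: (le_lt_trans (modulusD _ _)); rewrite modulusN; lra.
Qed.

Lemma abssum_pair (I J : choiceType) (G : I * J -> C) (b : I -> R) (B : R) :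
  (forall i, abssum (fun j => G (i, j)) (b i)) ->
  (forall A : {fset I}, \sum_(i <- A) b i <= B) -> abssum G B.
Proof.
move=> Gb bB A; pose A1 := [fset x.1 | x in A]%fset; pose A2 := [fset x.2 | x in A]%fset.
have sub : (A `<=` A1 `*` A2)%fset.
  apply/fsubsetP => -[a b'] ab; rewrite in_fsetM /=; apply/andP.
  by split; apply/imfsetP; exists (a, b').
apply: le_trans (ler_sum_fset _ sub) _ => [x|]; first exact: modulus_ge0.
apply: le_trans (bB A1).
rewrite big_imfset2 /=; last by move=> [? ?] [? ?] _ _ /= [-> ->].
by apply: ler_sum => i _; exact: Gb.
Qed.

Lemma hassum_bij (I J : choiceType) (h : I -> J) (h' : J -> I) (F : J -> C) s :
  cancel h h' -> cancel h' h -> hassum (F \o h) s -> hassum F s.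
Proof.
move=> hK h'K Fs e e0; have [A0 h0] := Fs e e0.
exists [fset h x | x in A0]%fset => A AA0.
have := h0 [fset h' x | x in A]%fset; rewrite big_imfset /=; last first.
  by move=> x y _ _; exact: (can_inj h'K).
under eq_bigr do rewrite h'K.
apply; apply/fsubsetP => x xA; apply/imfsetP; exists (h x) => /=; rewrite ?hK//.
by apply: (fsubsetP AA0); apply/imfsetP; exists x.
Qed.

Lemma hassum_pair_swap (I J : choiceType) (G : I * J -> C) S :
  hassum G S -> hassum (fun x : J * I => G (x.2, x.1)) S.
Proof.
move=> GS; apply: (@hassum_bij _ _ (fun x : I * J => (x.2, x.1)) (fun x : J * I => (x.2, x.1))).
- by case.
- by case.
- by apply: eq_hassum GS; case.
Qed.

(** Fubini: joint absolute summability makes both iterated sums equal to the sum of [G] over pairs.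
    Rearrangements of power series rely on it. *)
Lemma hassum_exchange (I J : choiceType) (G : I * J -> C) B (s : I -> C) S :
  abssum G B -> (forall i, hassum (fun j => G (i, j)) (s i)) -> hassum s S ->
  exists t : J -> C, (forall j, hassum (fun i => G (i, j)) (t j)) /\ hassum t S.
Proof.
move=> GB Gs sS; have [S' GS'] := abssum_hassum GB.
have SS' : S = S' by exact: hassum_unique sS (hassum_pair GS' Gs).
have ex j : {t | hassum (fun i => G (i, j)) t}.
  apply/cid; apply: (@abssum_hassum _ _ B) => A.
  have := GB [fset (i, j) | i in A]%fset.
  by rewrite big_imfset //= => ? ? _ _ [].
exists (fun j => sval (ex j)); split=> [j|]; first exact: (svalP (ex j)).
rewrite SS'; apply: hassum_pair (hassum_pair_swap GS') _ => j.
exact: (svalP (ex j)).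
Qed.

(** [F] is spread along the graph of [h] and the double sum is exchanged; with [h] the degree, this
    groups a power series into homogeneous parts. *)
Lemma hassum_fibre (I K : choiceType) (h : I -> K) (F : I -> C) S : hassum F S ->
  exists t : K -> C,
    (forall k, hassum (fun i => if h i == k then F i else 0) (t k)) /\ hassum t S.
Proof.
move=> FS; have [B FB] := hassum_abssum FS.
pose G (x : I * K) := if h x.1 == x.2 then F x.1 else 0.
have G0 i k : k \notin [fset h i]%fset -> G (i, k) = 0.
  by rewrite /G /= in_fset1 eq_sym; case: eqP.
have s1 i : \sum_(k <- [fset h i]%fset) G (i, k) = F i.
  by rewrite big_seq_fset1 /G /= eqxx.
apply: (@hassum_exchange _ _ G B F) => //.
  apply: (@abssum_pair _ _ _ (fun i => modulus (F i))) => [i A|//].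
  have sub : (A `<=` A `|` [fset h i])%fset by exact: fsubsetUl.
  apply: le_trans (ler_sum_fset _ sub) _ => [x|]; first exact: modulus_ge0.
  rewrite -(big_fset_incl _ (fsubsetUr A [fset h i]%fset)) ?big_seq_fset1 /=.
    by rewrite /G /= eqxx.
  by move=> k _ /G0 ->; rewrite modulus0.
move=> i; rewrite -[F i]s1; apply: hassum_supp => k; exact: G0.
Qed.

End HasSum.

(** * Boxes of multi-indices *)

Section Box.
Context {R : realType} {n : nat}.
Local Notation C := (Cplx R).
Local Notation mi := {ffun 'I_n -> nat}.

Definition mi_of N (f : {ffun 'I_n -> 'I_N}) : mi := [ffun j => val (f j)].

(** Boxes are cofinal among the finite sets and are products, so that sums of products over them
    factor into one-variable sums. *)
Definition box (N : nat) : {fset mi} :=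
  [fset mi_of f | f in {: {ffun 'I_n -> 'I_N}}]%fset.

Lemma in_box N (k : mi) : (k \in box N) = [forall j, (k j < N)%N].
Proof.
apply/imfsetP/forallP => [[f _ ->] j|kN].
  by rewrite ffunE ltn_ord.
exists [ffun j => Ordinal (kN j)] => //.
by apply/ffunP => j; rewrite !ffunE.
Qed.

Lemma box_mono N N' : (N <= N')%N -> (box N `<=` box N')%fset.
Proof.
move=> NN'; apply/fsubsetP => k; rewrite !in_box => /forallP kN.
by apply/forallP => j; exact: leq_trans (kN j) NN'.
Qed.

Lemma sub_box (A : {fset mi}) : exists N, (A `<=` box N)%fset.
Proof.
exists (\max_(k <- A) \max_j k j).+1; apply/fsubsetP => k kA.
rewrite in_box; apply/forallP => j; rewrite ltnS.
apply: leq_trans (leq_bigmax_seq k kA isT).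
exact: (leq_bigmax j).
Qed.

Lemma sum_box_prod (V : comNzRingType) N (G : 'I_n -> nat -> V) :
  \sum_(k <- box N) \prod_j G j (k j) = \prod_j \sum_(l < N) G j l.
Proof.
rewrite bigA_distr_bigA /= big_imfset /=.
  by rewrite big_enum; apply: eq_bigr => f _; apply: eq_bigr => j _; rewrite ffunE.
move=> f g _ _ /ffunP fg; apply/ffunP => j; apply/val_inj.
by have := fg j; rewrite !ffunE.
Qed.

Lemma hassum_box (F : mi -> C) s e : hassum F s -> 0 < e ->
  exists N0, forall N, (N0 <= N)%N -> modulus (\sum_(k <- box N) F k - s) < e.
Proof.
move=> Fs /Fs[A0 h0]; have [N0 sub] := sub_box A0; exists N0 => N /box_mono NN.
by apply: h0; exact: fsubset_trans sub NN.
Qed.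

End Box.

(** * Fourier analysis on the torus *)

(** [power_prob] is the pushforward of a product by [tcons], so Tonelli peels off the first
    coordinate. *)
Lemma ge0_integral_power_prob (R : realType) d (T : measurableType d)
    (P : probability T R) n (f : n.+1.-tuple T -> \bar R) :
  measurable_fun setT f -> (forall t, (0 <= f t)%E) ->
  (\int[power_prob P n.+1]_t f t =
   \int[power_prob P n]_y \int[P]_x f (tcons (x, y)))%E.
Proof.
move=> mf f0; rewrite /= ge0_integral_distribution// fubini_tonelli2//; last by move=> x; exact: f0.
by apply: (measurableT_comp mf); exact: measurable_tcons.
Qed.

Section TorusIntegrals.
Context {R : realType}.
Local Notation P := (uniform_prob (@twopi_gt0 R)).
Local Notation TR n := (n.-tuple (measurableTypeR R)).

Lemma torus_setT n : torus_measure R n setT = 1%E.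
Proof. exact: probability_setT. Qed.

Lemma uniform_setT : P setT = 1%E.
Proof. exact: probability_setT. Qed.

Lemma integral_uniform_cst (r : R) : (\int[P]_t r%:E = r%:E)%E.
Proof.
rewrite integral_cst//; transitivity (r%:E * 1)%E; last by rewrite mule1.
by congr (_ * _)%E; exact: uniform_setT.
Qed.

Lemma integral_torus_cst n (r : R) : (\int[torus_measure R n]_t r%:E = r%:E)%E.
Proof.
rewrite integral_cst//; transitivity (r%:E * 1)%E; last by rewrite mule1.
by congr (_ * _)%E; exact: torus_setT.
Qed.

Lemma torus_fin n : (torus_measure R n setT < +oo)%E.
Proof.
suff : (torus_measure R n setT < +oo)%E by [].
by rewrite torus_setT ltry.
Qed.

Lemma ae_torusS n (A B : n.-tuple R -> Prop) : (forall t, A t -> B t) ->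
  {ae torus_measure R n, forall t, A t} -> {ae torus_measure R n, forall t, B t}.
Proof.
by move=> AB; apply: (@filterS _ _ (ae_filter_ringOfSetsType (torus_measure R n))).
Qed.

Lemma measurable_cos : measurable_fun setT (@cos R).
Proof. by apply: continuous_measurable_fun; exact: continuous_cos. Qed.

Lemma periodic_int (f : R -> R) (T x : R) (m : int) : periodic f T ->
  f (x + m%:~R * T) = f x.
Proof.
move=> fT; case: m => m.
  by rewrite -pmulrn mulr_natl periodicn.
have := @periodicn _ _ f T fT m.+1 (x - m.+1%:R * T).
rewrite NegzE mulrNz -pmulrn mulNr mulr_natl => <-.
by rewrite subrK.
Qed.

(** The constant 1 makes the integrand nonnegative, so that [integral_uniform] and Tonelli apply; it
    is subtracted again in [Rintegral_torus_cos]. *)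
Lemma integral_uniform_cos (m : int) (b : R) :
  (\int[P]_t (1 + cos (m%:~R * t + b))%:E = (1 + (m == 0)%:R * cos b)%:E)%E.
Proof.
have mf : measurable_fun setT (fun t : R => 1 + cos (m%:~R * t + b)).
  apply: measurable_funD => //; apply: measurableT_comp; first exact: measurable_cos.
  by apply: measurable_funD => //; exact: measurable_funM.
have [->|m0] := eqVneq m 0.
  under eq_integral do rewrite mul0r add0r.
  by rewrite integral_uniform_cst mul1r.
rewrite integral_uniform; last 2 first.
- exact/measurable_EFinP.
- by move=> t; rewrite lee_fin; have := cos_geN1 (m%:~R * t + b); lra.
rewrite mul0r addr0 subr0.
have m0' : m%:~R != 0 :> R by rewrite intr_eq0.
pose F t : R := t + (m%:~R)^-1 * sin (m%:~R * t + b).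
have dF (x : R) : is_derive x 1 F (1 + cos (m%:~R * x + b)).
  rewrite /F; apply: is_derive_eq.
  by rewrite addr0 /GRing.scale /= mulr1; field.
have cF : continuous F.
  by move=> x; apply: differentiable_continuous; apply/derivable1_diffP; case: (dF x).
rewrite (@continuous_FTC2 _ _ F).
- rewrite -EFinB -EFinM /F mulr0 add0r.
  have -> : m%:~R * (2 * pi) + b = b + m%:~R * (pi *+ 2) :> R by rewrite -(mulr_natl pi); ring.
  rewrite (periodic_int _ _ (@sinD2pi R)).
  rewrite [0 + b]add0r; congr EFin; have := pi_gt0 R; move: (@pi R) => q q0; field.
  by rewrite m0' gt_eqF.
- exact: twopi_gt0.
- apply: continuous_subspaceT => x; apply: cvgD; first exact: cvg_cst.
  have cl : continuous (fun x : R => m%:~R * x + b).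
    by move=> y; apply: cvgD; [apply: cvgM; [exact: cvg_cst|exact: cvg_id]|exact: cvg_cst].
  exact: (continuous_comp (cl x) (@continuous_cos _ _)).
- split.
  + by move=> x _; case: (dF x).
  + exact/cvg_at_right_filter/cF.
  + exact/cvg_at_left_filter/cF.
- by move=> x _; rewrite derive1E; case: (dF x).
Qed.

Section Phase.
Context {n : nat}.
Local Notation mu := (torus_measure R n).

Definition phase (m : 'I_n -> int) (t : n.-tuple R) : R :=
  \sum_j (m j)%:~R * tnth t j.

Lemma measurable_phase m : measurable_fun [set: TR n] (phase m).
Proof.
apply: measurable_sum => j; apply: measurable_funM => //.
exact: measurable_tnth.
Qed.

End Phase.

Lemma integral_torus_cos n (m : 'I_n -> int) (b : R) :
  (\int[torus_measure R n]_t (1 + cos (phase m t + b))%:E =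
   (1 + [forall j, m j == 0]%:R * cos b)%:E)%E.
Proof.
elim: n m b => [m b|n IH m b].
  have e0 : [forall j, m j == 0] by apply/forallP => -[].
  rewrite e0 mul1r; under eq_integral do rewrite /phase big_ord0 add0r.
  by rewrite integral_torus_cst.
have mf : measurable_fun [set: TR n.+1] (fun t : n.+1.-tuple R => 1 + cos (phase m t + b)).
  apply: measurable_funD => //.
  apply: measurableT_comp; first exact: measurable_cos.
  by apply: measurable_funD => //; exact: measurable_phase.
have f0 b' : (0%:E <= (1 + cos b')%:E :> \bar R)%E.
  by rewrite lee_fin; have := cos_geN1 b'; lra.
rewrite /torus_measure ge0_integral_power_prob; last 2 first.
- exact/measurable_EFinP.
- by move=> x; exact: f0.
have inner (y : n.-tuple R) :
    (\int[P]_x (1 + cos (phase m (tcons (x, y)) + b))%:E = (1 + (m ord0 == 0)%:R *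
      cos (phase (fun j => m (lift ord0 j)) y + b))%:E)%E.
  rewrite -integral_uniform_cos; apply: eq_integral => x _.
  rewrite /= /phase big_ord_recl /= tnth0 -addrA.
  by under eq_bigr do rewrite tnthS.
under eq_integral do rewrite inner.
have [m0|m0] := eqVneq (m ord0) 0.
  under eq_integral do rewrite mul1r.
  rewrite (IH (fun j => m (lift ord0 j)) b); congr (EFin (1 + _%:R * _)).
  congr (nat_of_bool _); apply/forallP/forallP => h j //.
  by case: (unliftP ord0 j) => [k|] ->; rewrite ?m0//; exact: h.
under eq_integral do rewrite mul0r addr0.
rewrite integral_torus_cst.
have -> : [forall j, m j == 0] = false by apply/negP => /forallP /(_ ord0); rewrite (negbTE m0).
by rewrite mul0r addr0.
Qed.

Section TrigSums.
Context {n : nat}.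
Local Notation mu := (torus_measure R n).
Local Notation C := (Cplx R).
Local Notation mi := {ffun 'I_n -> nat}.

Lemma integrable_torus_bounded (f : n.-tuple R -> R) (B : R) :
  measurable_fun [set: TR n] f -> (forall t, `|f t| <= B) ->
  mu.-integrable setT (EFin \o f).
Proof.
move=> mf fB; apply: measurable_bounded_integrable => //.
  exact: torus_fin.
by exists B; split; [exact: num_real|move=> x Bx t _; exact: le_trans (fB t) (ltW Bx)].
Qed.

Lemma measurable_cos_phase m (b : R) : measurable_fun [set: TR n] (fun t => cos (@phase n m t + b)).
Proof.
apply: measurableT_comp; first exact: measurable_cos.
by apply: measurable_funD => //; exact: measurable_phase.
Qed.

Lemma integrable_cos_phase m (b : R) :
  mu.-integrable setT (EFin \o (fun t => cos (phase m t + b))).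
Proof.
apply: (@integrable_torus_bounded _ 1); first exact: measurable_cos_phase.
by move=> t; rewrite ler_norml cos_geN1 cos_le1.
Qed.

Lemma Rintegral_torus_cos m (b : R) :
  \int[mu]_t cos (phase m t + b) = [forall j, m j == 0]%:R * cos b.
Proof.
have := integral_torus_cos m b.
under eq_integral do rewrite EFinD.
rewrite integralD//; last 2 first.
- by apply: (@integrable_torus_bounded (fun=> 1) 1) => // t; rewrite normr1.
- exact: integrable_cos_phase.
rewrite integral_torus_cst /Rintegral.
have : mu.-integrable setT (fun t => (cos (phase m t + b))%:E) by exact: integrable_cos_phase.
move=> /(integrable_fin_num measurableT); case: (integral _ _ _) => //= r _.
by rewrite -EFinD => -[]; lra.
Qed.

Definition cis (x : R) : C := Complex (cos x) (sin x).

Lemma cisD x y : cis (x + y) = cis x * cis y.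
Proof.
by apply: complex_eq; rewrite ?ReM ?ImM /= ?cosD ?sinD; ring.
Qed.

Lemma cis_conj x : conjc (cis x) = cis (- x).
Proof. by rewrite /cis cosN sinN. Qed.

Lemma modulus_cis x : modulus (cis x) = 1.
Proof. by rewrite /modulus /= cos2Dsin2 sqrtr1. Qed.

Lemma cis0 : cis 0 = 1.
Proof. by rewrite /cis cos0 sin0. Qed.

Lemma cisX x k : cis x ^+ k = cis (k%:R * x).
Proof.
elim: k => [|k IH]; first by rewrite mul0r cis0.
by rewrite exprS IH -cisD -natr1 mulrDl mul1r addrC.
Qed.

Definition char (k : mi) (t : n.-tuple R) : C := \prod_j cis (tnth t j) ^+ k j.

Lemma charE k t : char k t = cis (phase (fun j => (k j)%:Z) t).
Proof.
rewrite /char /phase; elim/big_rec2 : _ => [|j a b _ ->]; first by rewrite cis0.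
by rewrite cisX -cisD -pmulrn.
Qed.

Lemma char_conj k l t :
  char k t * conjc (char l t) = cis (phase (fun j => (k j)%:Z - (l j)%:Z) t).
Proof.
rewrite !charE cis_conj -cisD; congr cis; rewrite /phase -sumrB.
by apply: eq_bigr => j _; rewrite -mulrBl intrB.
Qed.

Lemma modulus_char k t : modulus (char k t) = 1.
Proof. by rewrite charE modulus_cis. Qed.

(** The sine is written as a shifted cosine, so that cosine integrals with a phase [b] cover both
    parts of a complex coefficient. *)
Lemma Re_mul_cis (a : C) x :
  complex.Re (a * cis x) = complex.Re a * cos x + complex.Im a * cos (x + pi / 2).
Proof. by rewrite cosDpihalf ReM /=; ring. Qed.

Lemma Rintegral_Re_char (a : C) k l :
  mu.-integrable setT (EFin \o (fun t => complex.Re (a * (char k t * conjc (char l t))))) /\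
  \int[mu]_t complex.Re (a * (char k t * conjc (char l t))) =
  (k == l)%:R * complex.Re a.
Proof.
set m := fun j => (k j)%:Z - (l j)%:Z.
have E t : complex.Re (a * (char k t * conjc (char l t))) =
   complex.Re a * cos (phase m t + 0) + complex.Im a * cos (phase m t + pi / 2).
  by rewrite char_conj Re_mul_cis addr0.
have i1 b c : mu.-integrable setT (EFin \o (fun t => c * cos (phase m t + b))).
  exact: (integrableZl measurableT c (integrable_cos_phase m b)).
have -> : (fun t => complex.Re (a * (char k t * conjc (char l t)))) =
   (fun t => complex.Re a * cos (phase m t + 0) + complex.Im a * cos (phase m t + pi / 2)).
  exact/funext.
split.
  exact: (integrableD measurableT (i1 _ _) (i1 _ _)).
rewrite RintegralD// !RintegralZl//; try exact: integrable_cos_phase.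
rewrite !Rintegral_torus_cos cos0 cos_pihalf !mulr0 addr0 mulr1 mulrC.
congr (_%:R * _); congr nat_of_bool; apply/forallP/eqP => [h|kl j]; last by rewrite /m kl subrr.
by apply/ffunP => j; have := h j; rewrite subr_eq0 => /eqP [].
Qed.

Definition trig (A : {fset mi}) (a : mi -> C) (t : n.-tuple R) : C :=
  \sum_(k <- A) a k * char k t.

Lemma sqr_modulus_trig A a t : modulus (trig A a t) ^+ 2 =
  \sum_(k <- A) \sum_(l <- A) complex.Re (a k * conjc (a l) * (char k t * conjc (char l t))).
Proof.
have -> : modulus (trig A a t) ^+ 2 = complex.Re (trig A a t * conjc (trig A a t)).
  by rewrite mulr_conj.
rewrite /trig rmorph_sum mulr_suml Re_sum; apply: eq_bigr => k _.
rewrite mulr_sumr Re_sum; apply: eq_bigr => l _.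
by rewrite rmorphM; congr complex.Re; ring.
Qed.

Lemma Rintegral_sum (I : Type) (r : seq I) (f : I -> n.-tuple R -> R) :
  (forall i, mu.-integrable setT (EFin \o f i)) ->
  mu.-integrable setT (EFin \o (fun t => \sum_(i <- r) f i t)) /\
  \int[mu]_t (\sum_(i <- r) f i t) = \sum_(i <- r) \int[mu]_t f i t.
Proof.
move=> fi; elim: r => [|i r [IH1 IH2]].
  rewrite big_nil; under [X in EFin \o X]funext do rewrite big_nil.
  under eq_Rintegral do rewrite big_nil.
  split; last by rewrite Rintegral_cst// mul0r.
  by apply: (@integrable_torus_bounded (fun=> 0) 0) => // t; rewrite normr0.
rewrite big_cons -IH2 -RintegralD//; split.
  under [X in EFin \o X]funext do rewrite big_cons.
  exact: (integrableD measurableT (fi i) IH1).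
by apply: eq_Rintegral => t _; rewrite big_cons.
Qed.

Lemma Rintegral_trig A a :
  \int[mu]_t (modulus (trig A a t) ^+ 2) = \sum_(k <- A) modulus (a k) ^+ 2.
Proof.
under eq_Rintegral do rewrite sqr_modulus_trig.
have i1 k : mu.-integrable setT (EFin \o (fun t => \sum_(l <- A) complex.Re
   (a k * conjc (a l) * (char k t * conjc (char l t))))).
  by apply: (Rintegral_sum A _).1 => l; exact: (Rintegral_Re_char _ _ _).1.
rewrite (Rintegral_sum A i1).2 big_seq [RHS]big_seq; apply: eq_bigr => k kA.
rewrite (Rintegral_sum A _).2; last by move=> l; exact: (Rintegral_Re_char _ _ _).1.
under eq_bigr do rewrite (Rintegral_Re_char _ _ _).2.
rewrite (big_fsetD1 k)//= eqxx mul1r mulr_conj big_seq big1 ?addr0// => l.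
by rewrite in_fsetD1 eq_sym => /andP[/negbTE -> _]; rewrite mul0r.
Qed.

Lemma measurable_modulus_trig A a : measurable_fun [set: TR n] (fun t => modulus (trig A a t)).
Proof.
have mRe (b : C) k : measurable_fun [set: TR n] (fun t => complex.Re (b * char k t)).
  apply: (@eq_measurable_fun _ _ _ _ _ (fun t => complex.Re b * cos (phase (fun j => (k j)%:Z) t + 0) +
      complex.Im b * cos (phase (fun j => (k j)%:Z) t + pi / 2))).
    by move=> t _; rewrite charE Re_mul_cis addr0.
  by apply: measurable_funD; apply: measurable_funM => //;
    exact: measurable_cos_phase.
have mIm (b : C) k : measurable_fun [set: TR n] (fun t => complex.Im (b * char k t)).
  apply: (@eq_measurable_fun _ _ _ _ _ (fun t => complex.Re (- Complex 0 1 * b * char k t))) => //.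
  by move=> t _; rewrite !(ReM, ImM) /=; ring.
  exact: mRe.
have -> : (fun t => modulus (trig A a t)) = (fun t => Num.sqrt
    ((\sum_(k <- A) complex.Re (a k * char k t)) ^+ 2 + (\sum_(k <- A) complex.Im (a k * char k t)) ^+ 2)).
  apply/funext => t; rewrite -Re_sum -Im_sum -sqr_modulus sqrtr_sqr ger0_norm//.
  exact: modulus_ge0.
apply: measurableT_comp.
  by apply: continuous_measurable_fun; exact: sqrt_continuous.
by apply: measurable_funD; apply: measurable_funX;
  exact: measurable_sum.
Qed.

Lemma torus_dominated_convergence (f_ : nat -> n.-tuple R -> R) (f : n.-tuple R -> R) (B : R) :
  (forall N, measurable_fun [set: TR n] (f_ N)) -> measurable_fun [set: TR n] f ->
  {ae mu, forall t, f_ N t @[N --> \oo] --> f t} ->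
  (forall N t, `|f_ N t| <= B) ->
  \int[mu]_t f_ N t @[N --> \oo] --> \int[mu]_t f t.
Proof.
move=> mf_ mf f_f f_B.
have [||||| fi _ h] := @dominated_convergence _ _ _ mu setT measurableT
  (fun N => EFin \o f_ N) (EFin \o f) (fun=> B%:E).
- by move=> N; exact/measurable_EFinP.
- exact/measurable_EFinP.
- by apply: ae_torusS f_f => t ft _; apply: cvg_EFin => //; exact: nearW.
- by apply: (@integrable_torus_bounded (fun=> B) `|B|).
- by apply: aeW => t N _; rewrite lee_fin.
apply: fine_cvg.
rewrite fineK; first exact: h.
exact: (integrable_fin_num measurableT fi).
Qed.

(** Partial sums over boxes are bounded by [B], so dominated convergence carries the identity for
    trigonometric polynomials to the limit. *)
Lemma parseval (a : mi -> C) B (F : n.-tuple R -> C) :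
  abssum a B -> (forall t, hassum (fun k => a k * char k t) (F t)) ->
  [/\ measurable_fun [set: TR n] (fun t => modulus (F t)),
      forall t, modulus (F t) <= B &
      hassum (fun k => Complex (modulus (a k) ^+ 2) 0)
        (Complex (\int[mu]_t (modulus (F t) ^+ 2)) 0)].
Proof.
move=> aB aF.
have aB' t : abssum (fun k => a k * char k t) B.
  by apply: le_abssum aB => k; rewrite modulusM modulus_char mulr1.
have FB t : modulus (F t) <= B by exact: hassum_modulus_le (aF t) (aB' t).
have TB N t : modulus (trig (box N) a t) <= B.
  by apply: le_trans (aB' t (box N)); exact: modulus_sum.
have cvgT t : modulus (trig (box N) a t) @[N --> \oo] --> modulus (F t).
  apply/cvgrPdist_lt => e e0; have [N0 h] := hassum_box (aF t) e0.
  exists N0 => // N /= /h; apply: le_lt_trans.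
  rewrite ler_norml; apply/andP; split.
    rewrite lerNl opprB lerBlDr.
    by apply: le_trans (modulusD _ _); rewrite subrK.
  rewrite lerBlDr -(modulusN (_ - _)) opprB.
  by apply: le_trans (modulusD _ _); rewrite subrK.
have mF : measurable_fun [set: TR n] (fun t => modulus (F t)).
  apply: (@measurable_fun_cvg _ _ _ _ (fun N t => modulus (trig (box N) a t))) => //.
    by move=> N; exact: measurable_modulus_trig.
split => //.
have B0 := abssum_ge0 aB.
have cvgI : \int[mu]_t (modulus (trig (box N) a t) ^+ 2) @[N --> \oo] -->
    \int[mu]_t (modulus (F t) ^+ 2).
  apply: (@torus_dominated_convergence _ _ (B ^+ 2)).
  - by move=> N; apply: measurable_funX; exact: measurable_modulus_trig.
  - exact: measurable_funX.
  - by apply: aeW => t; apply: cvgM; exact: cvgT.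
  - by move=> N t; rewrite ger0_norm ?sqr_ge0// ler_sqr ?nnegrE ?modulus_ge0.
have [| |s [hs _ _]] := @hassum_ge0 _ _ (fun k => modulus (a k) ^+ 2) (B * B).
- by move=> k; exact: sqr_ge0.
- move=> A; apply: (@le_trans _ _ (\sum_(k <- A) B * modulus (a k))).
    by apply: ler_sum => k _; rewrite expr2 ler_wpM2r ?modulus_ge0//; exact: abssum_term aB.
  by rewrite -mulr_sumr ler_wpM2l.
suff -> : \int[mu]_t (modulus (F t) ^+ 2) = s by [].
apply: (cvg_unique _ cvgI) => //.
apply/cvgrPdist_lt => e e0; have [N0 h] := hassum_box hs e0.
exists N0 => // N /= /h; rewrite Rintegral_trig.
rewrite real_complex_sum -[X in modulus X]/(Complex (_ - _) (0 - 0)) subr0.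
by rewrite modulus_real distrC.
Qed.

End TrigSums.
End TorusIntegrals.

(** * Power series on the polydisc *)

Section MoreSums.
Context {R : realType}.
Local Notation C := (Cplx R).

Lemma abssum_modulus_hassum (I : choiceType) (F : I -> C) B : abssum F B ->
  exists m : R, [/\ hassum (fun i => Complex (modulus (F i)) 0) (Complex m 0), m <= B &
    forall s, hassum F s -> modulus s <= m].
Proof.
move=> FB; have [| |m [hm mB Fm]] := @hassum_ge0 _ _ (fun i => modulus (F i)) B => //.
  by move=> i; exact: modulus_ge0.
by exists m; split => // s Fs; apply: hassum_modulus_le Fs _.
Qed.

(** Each [modulus (t j)] is at most the sum [m j] of the moduli over [i]; a finite sum of the [m j]
    is a limit of sums over rectangles, which [B] bounds. *)
Lemma abssum_marginal (I J : choiceType) (G : I * J -> C) B (t : J -> C) :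
  abssum G B -> (forall j, hassum (fun i => G (i, j)) (t j)) -> abssum t B.
Proof.
move=> GB Gt A.
have GBj j : abssum (fun i => G (i, j)) B.
  move=> A'; have := GB [fset (i, j) | i in A']%fset.
  by rewrite big_imfset //= => ? ? _ _ [].
have /all_sig[m hm] (j : J) : {m : R | hassum (fun i => Complex (modulus (G (i, j))) 0) (Complex m 0)
    /\ modulus (t j) <= m}.
  apply: cid; have [m [h1 _ h2]] := abssum_modulus_hassum (GBj j).
  by exists m; split => //; exact: h2.
apply: (@le_trans _ _ (\sum_(j <- A) m j)); first by apply: ler_sum => j _; case: (hm j).
have := hassum_sum A (fun j => (hm j).1); rewrite real_complex_sum => hs.
have m0 : 0 <= \sum_(j <- A) m j.
  by apply: sumr_ge0 => j _; apply: le_trans (modulus_ge0 _) (hm j).2.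
suff : modulus (Complex (\sum_(j <- A) m j) 0 : C) <= B by rewrite modulus_real ger0_norm.
apply: hassum_modulus_le hs _ => A'.
have := GB (A' `*` A)%fset.
rewrite big_imfset2 //=; last by move=> [? ?] [? ?] _ _ /= [-> ->].
apply: le_trans; apply: ler_sum => i _.
by rewrite real_complex_sum modulus_real ger0_norm ?sumr_ge0// => j _; exact: modulus_ge0.
Qed.

Lemma sum_ord_widen (V : zmodType) (F : nat -> V) m N : (m <= N)%N ->
  (forall l, (m <= l)%N -> F l = 0) -> \sum_(l < N) F l = \sum_(l < m) F l.
Proof.
move=> mN F0; rewrite (big_ord_widen N F mN) [RHS]big_mkcond.
by apply: eq_bigr => i _; case: ltnP => // /F0.
Qed.

Lemma ler_sum_ord (F : nat -> R) m N : (m <= N)%N ->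
  (forall l, 0 <= F l) -> \sum_(l < m) F l <= \sum_(l < N) F l.
Proof.
move=> mN F0; rewrite (big_ord_widen N F mN) big_mkcond.
by apply: ler_sum => i _; case: ltnP.
Qed.

Lemma geometric_le (q : R) N : 0 <= q < 1 -> \sum_(l < N) q ^+ l <= (1 - q)^-1.
Proof.
move=> /andP[q0 q1]; have q1' : 0 < 1 - q by rewrite subr_gt0.
rewrite -(ler_pM2l q1') mulfV ?gt_eqF//.
have -> : (1 - q) * \sum_(l < N) q ^+ l = 1 - q ^+ N.
  by rewrite -[RHS]opprB subrX1 -mulNr opprB.
by rewrite lerBlDr lerDl exprn_ge0.
Qed.

End MoreSums.

Section Monomials.
Context {R : realType} {n : nat}.
Local Notation C := (Cplx R).
Local Notation mi := {ffun 'I_n -> nat}.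

Definition mdeg (k : mi) : nat := (\sum_j k j)%N.

Definition mon (w : 'I_n -> C) (k : mi) : C := \prod_j w j ^+ k j.

Lemma prod_expr_mdeg (V : comNzRingType) (x : V) (k : mi) : \prod_j x ^+ k j = x ^+ mdeg k.
Proof. by rewrite /mdeg expr_sum. Qed.

Lemma monM (w v : 'I_n -> C) k : mon (fun j => w j * v j) k = mon w k * mon v k.
Proof. by rewrite /mon -big_split; apply: eq_bigr => j _; rewrite exprMn. Qed.

Lemma monZ (x : C) (w : 'I_n -> C) k : mon (fun j => x * w j) k = x ^+ mdeg k * mon w k.
Proof. by rewrite monM /mon prod_expr_mdeg. Qed.

Lemma modulus_mon w k : modulus (mon w k) = \prod_j modulus (w j) ^+ k j.
Proof. by rewrite /mon modulus_prod; apply: eq_bigr => j _; rewrite modulusX. Qed.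

Lemma modulus_mon_le w (s : R) k : (forall j, modulus (w j) <= s) ->
  modulus (mon w k) <= s ^+ mdeg k.
Proof.
move=> ws; rewrite modulus_mon -prod_expr_mdeg; apply: ler_prod => j _.
by rewrite exprn_ge0 ?modulus_ge0//= lerXn2r ?nnegrE ?modulus_ge0// (le_trans _ (ws j)) ?modulus_ge0.
Qed.

Lemma char_mon t k : char k t = mon (fun j => cis (tnth t j)) k :> C.
Proof. by []. Qed.

Lemma abssum_geometric (q : R) : 0 <= q < 1 ->
  abssum (fun k : mi => Complex (q ^+ mdeg k) 0 : C) ((1 - q)^-1 ^+ n).
Proof.
move=> q01 A; have [N sub] := sub_box A.
apply: le_trans (ler_sum_fset _ sub) _ => [k|]; first exact: modulus_ge0.
under eq_bigr => k _.
  rewrite modulus_real ger0_norm ?exprn_ge0//; last by case/andP: q01.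
  rewrite -prod_expr_mdeg; over.
rewrite (sum_box_prod N (fun _ l => q ^+ l)) prodr_const card_ord.
rewrite lerXn2r ?nnegrE ?geometric_le//.
  by apply: sumr_ge0 => l _; rewrite exprn_ge0//; case/andP: q01.
by rewrite invr_ge0 subr_ge0; case/andP: q01 => _ /ltW.
Qed.

(** Substitute for Cauchy's integral formula: one term of the Parseval sum is at most the mean
    square of [F], hence at most [M ^+ 2]. *)
Lemma cauchy_estimate (a : mi -> C) B M (F : n.-tuple R -> C) k :
  abssum a B -> (forall t, hassum (fun k => a k * char k t) (F t)) ->
  (forall t, modulus (F t) <= M) -> modulus (a k) <= M.
Proof.
move=> aB aF FM; have [mF FB hs] := parseval aB aF.
have M0 : 0 <= M by exact: le_trans (modulus_ge0 _) (FM [tuple of nseq n 0]).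
have := hassum_real_le [fset k]%fset _ hs; rewrite big_seq_fset1.
move=> /(_ (fun k => sqr_ge0 _)) le1.
rewrite -ler_sqr ?nnegrE ?modulus_ge0//; apply: le_trans le1 _.
have cM : \int[torus_measure R n]_t (M ^+ 2) = M ^+ 2.
  by rewrite /Rintegral integral_torus_cst.
rewrite -cM; apply: le_Rintegral => //.
- apply: (@integrable_torus_bounded _ _ _ (B ^+ 2)); first exact: measurable_funX.
  move=> t; rewrite ger0_norm ?sqr_ge0// ler_sqr ?nnegrE ?modulus_ge0//.
  exact: abssum_ge0 aB.
- by apply: (@integrable_torus_bounded _ _ (fun=> M ^+ 2) `|M ^+ 2|).
- by move=> t _; rewrite ler_sqr ?nnegrE ?modulus_ge0.
Qed.

Lemma torus_coef_unique (a : mi -> C) :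
  (forall t : n.-tuple R, hassum (fun k => a k * char k t) 0) -> forall k, a k = 0.
Proof.
move=> a0 k; have t0 : n.-tuple R := [tuple of nseq n 0].
have [B aB] := hassum_abssum (a0 t0).
apply/eqP; rewrite -modulus_eq0; apply/eqP/le_anti; rewrite modulus_ge0 andbT.
apply: (@cauchy_estimate a B 0 (fun=> 0)) => // [|t]; last by rewrite modulus0.
by apply: le_abssum aB => l; rewrite modulusM modulus_char mulr1.
Qed.

End Monomials.

(** * Uniqueness and recentring of power series *)

Section PowerSeries.
Context {R : realType}.
Local Notation C := (Cplx R).

(** On the circle of radius [e / 2] the difference of the two series is a Fourier series on the
    torus of dimension 1 with sum zero. *)
Lemma power_series_unique (b b' : nat -> C) (S : C -> C) (e : R) : 0 < e ->
  (forall h, modulus h < e -> hassum (fun q => b q * h ^+ q) (S h)) ->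
  (forall h, modulus h < e -> hassum (fun q => b' q * h ^+ q) (S h)) -> b =1 b'.
Proof.
move=> e0 bS b'S q; pose r : R := e / 2.
have r0 : 0 < r by rewrite divr_gt0.
pose g (k : {ffun 'I_1 -> nat}) := (b (k ord0) - b' (k ord0)) * (Complex r 0) ^+ k ord0.
suff /(_ [ffun=> q]) : forall k, g k = 0.
  move=> /eqP; rewrite /g ffunE mulf_eq0 expf_eq0 subr_eq0 => /orP[/eqP //|/andP[_]].
  by rewrite eq_complex /= gt_eqF.
apply: torus_coef_unique => t.
apply: (@hassum_bij _ _ _ (fun q : nat => [ffun=> q]) (fun k : {ffun 'I_1 -> nat} => k ord0)).
- by move=> l; rewrite ffunE.
- by move=> k; apply/ffunP => j; rewrite ffunE (ord1 j).
have lt : modulus (Complex r 0 * cis (tnth t ord0)) < e.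
  by rewrite modulusM modulus_real modulus_cis mulr1 gtr0_norm// /r ltr_pdivrMr// ltr_pMr// ltr1n.
have := hassumB (bS _ lt) (b'S _ lt); rewrite subrr; apply: eq_hassum => l.
rewrite /g /char /= big_ord1 ffunE exprMn; ring.
Qed.

Lemma hassum_binomial (x y : C) m : hassum (fun l => 'C(m, l)%:R * x ^+ (m - l) * y ^+ l) ((x + y) ^+ m).
Proof.
have -> : (x + y) ^+ m = \sum_(l <- [fset val i | i in 'I_m.+1]%fset) 'C(m, l)%:R * x ^+ (m - l) * y ^+ l.
  rewrite exprDn big_imfset /=; last by move=> i j _ _; exact: val_inj.
  rewrite big_enum; apply: eq_bigr => i _.
  by rewrite -mulr_natl mulrA.
apply: hassum_supp => l lm.
rewrite bin_small ?mul0r// ltnNge; apply: contra lm => lm.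
by apply/imfsetP; exists (Ordinal (lm : l < m.+1)%N).
Qed.

Lemma sum_binomial_le (x y : R) m N : 0 <= x -> 0 <= y ->
  \sum_(l < N) 'C(m, l)%:R * x ^+ (m - l) * y ^+ l <= (x + y) ^+ m.
Proof.
move=> x0 y0; pose G l := 'C(m, l)%:R * x ^+ (m - l) * y ^+ l.
have G0 l : 0 <= G l by rewrite /G !mulr_ge0 ?exprn_ge0.
have -> : (x + y) ^+ m = \sum_(l < m.+1) G l.
  by rewrite exprDn; apply: eq_bigr => i _; rewrite -mulr_natl mulrA.
apply: (@le_trans _ _ (\sum_(l < maxn N m.+1) G l)).
  by apply: ler_sum_ord; first exact: leq_maxl.
rewrite (sum_ord_widen (leq_maxr N m.+1)) // => l ml.
by rewrite /G bin_small ?mul0r.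
Qed.

Section Recenter.
Context {n : nat}.
Local Notation mi := {ffun 'I_n -> nat}.

(** The term of index [l] in the binomial expansion of the monomial [(x + y)^k] in several
    variables; it vanishes unless [l <= k] in every coordinate. *)
Definition mbin (x y : 'I_n -> C) (k l : mi) : C :=
  \prod_j ('C(k j, l j)%:R * x j ^+ (k j - l j) * y j ^+ l j).

Lemma hassum_mbin x y k : hassum (mbin x y k) (mon (fun j => x j + y j) k).
Proof.
have [N Nk] : exists N, forall j, (k j < N)%N.
  have [N] := sub_box [fset k]%fset; rewrite fsub1set in_box => /forallP kN.
  by exists N.
have -> : mon (fun j => x j + y j) k = \sum_(l <- box N) mbin x y k l.
  rewrite /mbin (sum_box_prod N (fun j l => 'C(k j, l)%:R * x j ^+ (k j - l) * y j ^+ l)).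
  apply: eq_bigr => j _; rewrite exprDn.
  pose G l := 'C(k j, l)%:R * x j ^+ (k j - l) * y j ^+ l.
  rewrite (@sum_ord_widen _ G (k j).+1) //.
    by apply: eq_bigr => i _; rewrite -mulr_natl mulrA.
  by move=> l ml; rewrite /G bin_small ?mul0r.
apply: hassum_supp => l; rewrite in_box => /forallPn[j]; rewrite -leqNgt => Nl.
apply/eqP; rewrite /mbin prodf_seq_eq0; apply/hasP; exists j; first exact: mem_index_enum.
by rewrite bin_small ?mul0r ?eqxx //=; exact: leq_trans (Nk j) Nl.
Qed.

Lemma abssum_mbin x y k : abssum (mbin x y k) (\prod_j (modulus (x j) + modulus (y j)) ^+ k j).
Proof.
move=> A; have [N sub] := sub_box A.
apply: le_trans (ler_sum_fset _ sub) _ => [l|]; first exact: modulus_ge0.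
pose G j l := 'C(k j, l)%:R * modulus (x j) ^+ (k j - l) * modulus (y j) ^+ l.
have E l : modulus (mbin x y k l) = \prod_j G j (l j).
  rewrite /mbin modulus_prod; apply: eq_bigr => j _.
  by rewrite !modulusM !modulusX modulus_nat.
rewrite (eq_bigr _ (fun l _ => E l)) (sum_box_prod N G); apply: ler_prod => j _; apply/andP; split.
  by apply: sumr_ge0 => l _; rewrite /G !mulr_ge0 ?exprn_ge0 ?modulus_ge0.
by rewrite sum_binomial_le ?modulus_ge0.
Qed.

(** Since [|u j| + sg <= s], the doubly indexed family of the binomial expansion is absolutely
    summable with the very bound [D] of the old series; exchanging the summations gives the new
    coefficients. *)
Lemma recenter (d : mi -> C) (u : 'I_n -> C) (s sg D : R) : 0 < sg ->
  (forall j, modulus (u j) + sg <= s) ->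
  abssum (fun k => d k * (Complex s 0) ^+ mdeg k) D ->
  exists d' : mi -> C, abssum (fun l => d' l * (Complex sg 0) ^+ mdeg l) D /\
    forall h : 'I_n -> C, (forall j, modulus (h j) <= sg) ->
    forall S, hassum (fun k => d k * mon (fun j => u j + h j) k) S ->
      hassum (fun l => d' l * mon h l) S.
Proof.
move=> sg0 us dD.
pose G (h : 'I_n -> C) (x : mi * mi) := d x.1 * mbin u h x.1 x.2.
have GD h : (forall j, modulus (h j) <= sg) -> abssum (G h) D.
  move=> hsg; apply: (@abssum_pair _ _ _ _ (fun k => modulus (d k) * \prod_j (modulus (u j) + modulus (h j)) ^+ k j)).
    by move=> k; exact: (abssumZ (d k) (abssum_mbin u h k)).
  move=> A; apply: le_trans (dD A); apply: ler_sum => k _.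
  rewrite modulusM ler_wpM2l ?modulus_ge0// modulusX -prod_expr_mdeg modulus_real.
  apply: ler_prod => j _; rewrite exprn_ge0 ?addr_ge0 ?modulus_ge0//=.
  have le1 : modulus (u j) + modulus (h j) <= `|s|.
    by apply: le_trans (ler_norm s); apply: le_trans (us j); rewrite lerD2l.
  by rewrite lerXn2r ?nnegrE ?addr_ge0 ?modulus_ge0.
(* [mbin u h k l] is a factor independent of [h] times the monomial of [h]. Summing over [k] at the
   diagonal point [(sg, ..., sg)] and dividing by its monomial therefore gives coefficients valid
   for all [h]. *)
pose h0 (j : 'I_n) : C := Complex sg 0.
have h0sg j : modulus (h0 j) <= sg by rewrite modulus_real gtr0_norm.
have Gk h k : hassum (fun l => G h (k, l)) (d k * mon (fun j => u j + h j) k).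
  exact: (hassumZ (d k) (hassum_mbin u h k)).
have [S0 hS0] : exists S, hassum (fun k => d k * mon (fun j => u j + h0 j) k) S.
  apply: (@abssum_hassum _ _ _ D); apply: le_abssum dD => k.
  rewrite !modulusM ler_wpM2l ?modulus_ge0// modulusX modulus_real.
  apply: modulus_mon_le => j; apply: le_trans (ler_norm s); apply: le_trans (us j).
  by apply: le_trans (modulusD _ _) _; rewrite lerD2l.
have [t [Gt _]] := hassum_exchange (GD _ h0sg) (Gk h0) hS0.
have sgC : Complex sg 0 != 0 :> C by rewrite eq_complex /= gt_eqF.
pose d' l := t l / (Complex sg 0) ^+ mdeg l.
have d't l : d' l * (Complex sg 0) ^+ mdeg l = t l by rewrite /d' mulfVK// expf_neq0.
exists d'; split.
  apply: (@le_abssum _ _ _ t) => [l|]; first by rewrite d't.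
  exact: (abssum_marginal (GD _ h0sg)).
move=> h hsg S hS; have [t' [Gt' t'S]] := hassum_exchange (GD _ hsg) (Gk h) hS.
apply: eq_hassum t'S => l; apply: hassum_unique (Gt' l) _.
have -> : d' l * mon h l = (mon h l / (Complex sg 0) ^+ mdeg l) * t l by rewrite /d'; ring.
apply: eq_hassum (hassumZ _ (Gt l)) => k.
pose T := \prod_j ('C(k j, l j)%:R * u j ^+ (k j - l j)) : C.
have mbE y : mbin u y k l = T * mon y l by rewrite /mbin big_split.
have h0E : mon h0 l = (Complex sg 0) ^+ mdeg l by rewrite -prod_expr_mdeg.
by rewrite /G /= !mbE h0E; field; rewrite expf_neq0.
Qed.

End Recenter.
End PowerSeries.

(** * From local expansions to a Taylor series on the whole polydisc *)

Section Polydisc.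
Context {R : realType} {n : nat}.
Local Notation C := (Cplx R).
Local Notation mi := {ffun 'I_n -> nat}.
Implicit Types (f : polydisc R n -> C) (c : mi -> C).

Lemma coord_lt1 (z : polydisc R n) j : modulus (coord j z) < 1.
Proof. exact: (forallP (valP z) j). Qed.

Lemma in_polydisc_row (w : 'I_n -> C) : (forall j, modulus (w j) < 1) ->
  in_polydisc (\row_j w j).
Proof. by move=> w1; apply/forallP => j; rewrite mxE. Qed.

Definition pd (w : 'I_n -> C) (w1 : forall j, modulus (w j) < 1) : polydisc R n :=
  @exist _ (fun w : 'rV[C]_n => in_polydisc w) _ (in_polydisc_row w1).

Lemma coord_pd w w1 j : coord j (@pd w w1) = w j.
Proof. by rewrite /coord /= mxE. Qed.

Lemma polydisc_eq (z z' : polydisc R n) : (forall j, coord j z = coord j z') -> z = z'.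
Proof.
move=> zz'; apply: val_inj; apply/rowP => j; exact: zz'.
Qed.

Lemma max_coord (z : polydisc R n) : exists q : R, [/\ 0 <= q, q < 1 &
  forall j, modulus (coord j z) <= q].
Proof.
exists (\big[Order.max/0]_j modulus (coord j z)); split.
- by apply: bigmax_ge_id.
- by apply/bigmax_ltP; split => // j _; exact: coord_lt1.
- by move=> j; exact: le_bigmax.
Qed.

Definition series f c := forall z : polydisc R n,
  hassum (fun k => c k * mon (fun j => coord j z) k) (f z).

Lemma eq_mon (w w' : 'I_n -> C) k : w =1 w' -> mon w k = mon w' k.
Proof. by move=> /funext ->. Qed.

Lemma series_pd f c w (w1 : forall j, modulus (w j) < 1) : series f c -> hassum (fun k => c k * mon w k) (f (@pd w w1)).
Proof.
move=> fc; apply: eq_hassum (fc (pd w1)) => k; congr (_ * _).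
by apply: eq_mon => j; rewrite coord_pd.
Qed.

Lemma series_abssum f c (r : R) : 0 <= r < 1 -> series f c ->
  exists B, abssum (fun k => c k * Complex r 0 ^+ mdeg k) B.
Proof.
move=> /andP[r0 r1] fc.
have w1 (j : 'I_n) : modulus (Complex r 0 : C) < 1 by rewrite modulus_real ger0_norm.
have [B h] := hassum_abssum (series_pd w1 fc); exists B.
by apply: le_abssum h => k; rewrite -prod_expr_mdeg.
Qed.

Lemma series_unique f c c' : series f c -> series f c' -> c =1 c'.
Proof.
move=> fc fc' k; pose r : R := 2^-1.
have r0 : Complex r 0 != 0 :> C by rewrite eq_complex /= gt_eqF// invr_gt0.
suff /eqP : (c k - c' k) * Complex r 0 ^+ mdeg k = 0.
  by rewrite mulf_eq0 (negbTE (expf_neq0 _ r0)) orbF subr_eq0 => /eqP.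
apply: (@torus_coef_unique R n (fun k => (c k - c' k) * Complex r 0 ^+ mdeg k)) => t.
have w1 (j : 'I_n) : modulus (Complex r 0 * cis (tnth t j) : C) < 1.
  rewrite modulusM modulus_real modulus_cis mulr1 ger0_norm ?invr_ge0//.
  by rewrite invf_lt1 // ltr1n.
have := hassumB (series_pd w1 fc) (series_pd w1 fc').
by rewrite subrr; apply: eq_hassum => l; rewrite monZ -char_mon; ring.
Qed.

Lemma series_analytic f c : series f c -> analytic f.
Proof.
move=> fc p; have [q [q0 q1 pq]] := max_coord p.
pose sg := (1 - q) / 2; pose s := q + sg.
have sg0 : 0 < sg by rewrite divr_gt0// subr_gt0.
have s01 : 0 <= s < 1 by rewrite /s /sg; apply/andP; split; lra.
have [B cB] := series_abssum s01 fc.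
have us j : modulus (coord j p) + sg <= s by rewrite lerD2r.
have [d [_ hd]] := recenter sg0 us cB.
exists sg => //; exists d => z zp; apply/hassumP.
apply: (hd (fun j => coord j z - coord j p)) => [j|]; first exact/ltW/zp.
apply: eq_hassum (fc z) => k; congr (_ * _); apply: eq_mon => j.
by rewrite addrC subrK.
Qed.


(* One-variable Taylor expansions of [h |-> f (a (1 + h))], with bounds that are
   uniform for [a] in a compact polydisc. *)
Definition dilation_series f (dl : R) (a : 'I_n -> C) :=
  exists b : nat -> C, (forall q, modulus (b q) * dl ^+ q <= dl^-1) /\
    forall h (w1 : forall j, modulus (a j * (1 + h)) < 1), modulus h <= dl ->
    hassum (fun q => b q * h ^+ q) (f (pd w1)).

(** Using [dl] both as radius and, through [dl^-1], as bound makes the property weaker as [dl]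
    decreases, so that the compactness argument has a single parameter. *)
Lemma dilation_series_mono f (dl dl' : R) a : 0 < dl -> dl <= dl' ->
  dilation_series f dl' a -> dilation_series f dl a.
Proof.
move=> dl0 dd [b [bb hb]]; exists b; split=> [q|h w1 hd].
  have dl'0 : 0 < dl' by exact: lt_le_trans dd.
  apply: (@le_trans _ _ (modulus (b q) * dl' ^+ q)).
    by rewrite ler_wpM2l ?modulus_ge0// lerXn2r ?nnegrE ?(ltW dl0) ?(ltW dl'0).
  by apply: le_trans (bb q) _; rewrite lef_pV2 ?posrE.
by apply: hb; exact: le_trans dd.
Qed.

(** With the series recentred near [p], the increments at [a] are [a j * h]; collecting the terms of
    equal degree leaves a power series in the single variable [h]. *)
Lemma dilation_series_local f (p : 'I_n -> C) : analytic f -> (forall j, modulus (p j) < 1) ->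
  exists2 dl : R, 0 < dl & forall a : 'I_n -> C, (forall j, modulus (a j) < 1) ->
    (forall j, modulus (a j - p j) < dl) -> dilation_series f dl a.
Proof.
move=> fan p1; have [rho rho0 [d fd]] := fan (pd p1).
have [q [q0 q1 pq]] := max_coord (pd p1).
pose s := Order.min (rho / 2) ((1 - q) / 2).
have s0 : 0 < s by rewrite lt_min !divr_gt0// subr_gt0.
have srho : s < rho.
  by apply: (@le_lt_trans _ _ (rho / 2)); rewrite ?ge_min ?lexx// ltr_pdivrMr// ltr_pMr// ltr1n.
have sq : q + s < 1.
  have : s <= (1 - q) / 2 by rewrite ge_min lexx orbT.
  lra.
have w1 j : modulus (p j + Complex s 0) < 1.
  apply: le_lt_trans sq; apply: le_trans (modulusD _ _) _.
  by rewrite modulus_real gtr0_norm// lerD2r; have := pq j; rewrite coord_pd.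
have fd' (w : 'I_n -> C) (w2 : forall j, modulus (w j) < 1) :
    (forall j, modulus (w j - p j) < rho) ->
    hassum (fun k => d k * mon (fun j => w j - p j) k) (f (pd w2)).
  move=> wp; have := fd (pd w2); rewrite -hassumP => h.
  have {}h : hassum (fun k => d k * \prod_j (coord j (pd w2) - coord j (pd p1)) ^+ k j) (f (pd w2)).
    by apply: h => j; rewrite !coord_pd.
  apply: eq_hassum h => k; congr (_ * _); apply: eq_bigr => j _.
  by rewrite !coord_pd.
have [D dD] : exists D, abssum (fun k => d k * Complex s 0 ^+ mdeg k) D.
  have [|D h] := hassum_abssum (fd' _ w1 _).
    by move=> j; rewrite addrAC subrr add0r modulus_real gtr0_norm.
  exists D; apply: le_abssum h => k; rewrite -prod_expr_mdeg /mon.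
  by under [X in _ <= modulus (_ * X)]eq_bigr do rewrite addrAC subrr add0r.
have D0 := abssum_ge0 dD.
pose sg := s / 2; have sg0 : 0 < sg by rewrite divr_gt0.
(* The bound by [sg] keeps [a] near [p] and [a j * h] inside the new radius; the bound by
   [(D + 1)^-1] turns the coefficient bound [D] into [dl^-1]. *)
pose dl := Order.min sg (Order.min 1 (D + 1)^-1).
have dl0 : 0 < dl by rewrite !lt_min sg0 ltr01 invr_gt0 ltr_wpDl.
have dlsg : dl <= sg by rewrite ge_min lexx.
have dlD : D <= dl^-1.
  apply: (@le_trans _ _ (D + 1)); first by rewrite lerDl.
  by rewrite -[D + 1]invrK lef_pV2 ?posrE ?invr_gt0 ?ltr_wpDl// !ge_min lexx !orbT.
exists dl => // a a1 ap.
have us j : modulus (a j - p j) + sg <= s.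
  by have := ltW (lt_le_trans (ap j) dlsg); rewrite /sg; lra.
have [d' [d'D hd']] := recenter sg0 us dD.
have exb q' : exists b, hassum (fun k => if mdeg k == q' then d' k * mon a k else 0) b /\
    modulus b * dl ^+ q' <= dl^-1.
  have ab1 : abssum (fun k => if mdeg k == q' then d' k * mon a k * Complex dl 0 ^+ q' else 0) D.
    apply: le_abssum d'D => k; case: eqP => [<-|_]; last by rewrite modulus0 modulus_ge0.
    rewrite !modulusM -mulrA ler_wpM2l ?modulus_ge0// !modulusX !modulus_real !gtr0_norm//.
    rewrite -[leRHS]mul1r ler_pM ?modulus_ge0 ?exprn_ge0 ?(ltW dl0)//.
      rewrite -(expr1n _ (mdeg k)); apply: modulus_mon_le => j; exact/ltW.
    by rewrite lerXn2r ?nnegrE ?(ltW dl0) ?(ltW sg0).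
  have [b hb] := abssum_hassum ab1.
  have dlC : Complex dl 0 ^+ q' != 0 :> C by rewrite expf_neq0// eq_complex /= gt_eqF.
  exists (b / Complex dl 0 ^+ q'); split.
    apply: eq_hassum (hassumZr (Complex dl 0 ^+ q')^-1 hb) => k; case: eqP => _.
      by rewrite mulfK.
    by rewrite mul0r.
  rewrite modulusM modulusV modulusX modulus_real gtr0_norm// mulfVK ?expf_neq0 ?gt_eqF//.
  exact: le_trans (hassum_modulus_le hb ab1) dlD.
have /all_sig[b hb] q' := cid (exb q').
exists b; split=> [q'|h w2 hdl]; first by case: (hb q').
have hsg j : modulus (a j * h) <= sg.
  rewrite modulusM -[sg]mul1r ler_pM ?modulus_ge0//; first exact/ltW.
  exact: le_trans dlsg.
have hS : hassum (fun l => d' l * mon (fun j => a j * h) l) (f (pd w2)).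
  apply: hd' => //.
  have E (k : mi) : mon (fun j => a j * (1 + h) - p j) k = mon (fun j => a j - p j + a j * h) k.
    by apply: eq_mon => j; ring.
  have wp j : modulus (a j * (1 + h) - p j) < rho.
    have -> : a j * (1 + h) - p j = (a j - p j) + a j * h by ring.
    apply: le_lt_trans srho; apply: le_trans (modulusD _ _) _.
    by apply: le_trans (us j); rewrite lerD2l.
  by apply: eq_hassum (fd' _ w2 wp) => k; rewrite E.
have [t [ht tS]] := hassum_fibre mdeg hS.
apply: eq_hassum tS => q'; apply: hassum_unique (ht q') _.
apply: eq_hassum (hassumZr (h ^+ q') (hb q').1) => k.
case: eqP => [<-|_]; last by rewrite mul0r.
have -> : mon (fun j => a j * h) k = h ^+ mdeg k * mon a k.
  by rewrite -monZ; apply: eq_mon => j; rewrite mulrC.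
by ring.
Qed.

(** Compactness, as a near covering, of the real cube [[-1, 1]^(2 n)] that carries real and
    imaginary parts, with [dl -> 0+] as parameter. Points outside the closed polydisc of radius [r]
    have a neighbourhood where the premise in [P] fails. *)
Lemma dilation_series_uniform f (r : R) : analytic f -> 0 < r < 1 ->
  exists2 dl : R, 0 < dl & forall a : 'I_n -> C, (forall j, modulus (a j) <= r) ->
    dilation_series f dl a.
Proof.
move=> fan /andP[r0 r1].
pose pt (v : 'rV[R]_(n + n)) (j : 'I_n) : C := Complex (v ord0 (lshift n j)) (v ord0 (rshift n j)).
have cA := @rV_compact R (n + n) (fun=> `[-1, 1]%classic) (fun=> @segment_compact R (-1) 1).
move/compact_near_coveringP : cA => cA.
pose P (dl : R) (v : 'rV[R]_(n + n)) := (forall j, modulus (pt v j) <= r) -> dilation_series f dl (pt v).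
have [|e /= e0 he] := cA R (0^'+) P _ _.
- move=> v Av.
  have [pr|/existsNP[j /negP]] := pselect (forall j, modulus (pt v j) <= r).
    have p1 j : modulus (pt v j) < 1 by exact: le_lt_trans r1.
    have [dl dl0 hdl] := dilation_series_local fan p1.
    exists (ball v (dl / 2), [set x : R | 0 < x < dl]).
      split; first by apply: nbhsx_ballx; rewrite divr_gt0.
      by exists dl => //= x /=; rewrite sub0r normrN => xd x0; rewrite x0 (le_lt_trans (ler_norm x)).
    move=> [w x] /= [vw /andP[x0 xdl]] wr.
    apply: (dilation_series_mono x0 (ltW xdl)); apply: hdl => j.
      exact: le_lt_trans r1.
    have vw' : forall i j, ball (v i j) (dl / 2) (w i j) by case: vw.
    have b1 := vw' ord0 (lshift n j); have b2 := vw' ord0 (rshift n j).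
    apply: le_lt_trans (modulus_le_ReIm _) _; rewrite ReB ImB /=.
    move: b1 b2; rewrite /ball /= => b1 b2.
    by rewrite distrC (distrC (w ord0 (rshift n j))); lra.
  rewrite -ltNge => rv.
  pose g := (modulus (pt v j) - r) / 2.
  have g0 : 0 < g by rewrite divr_gt0// subr_gt0.
  exists (ball v (g / 2), setT).
    by split; [apply: nbhsx_ballx; rewrite divr_gt0|exact: filterT].
  move=> [w x] /= [vw _] /(_ j) wr; exfalso.
  have vw' : forall i j, ball (v i j) (g / 2) (w i j) by case: vw.
    have b1 := vw' ord0 (lshift n j); have b2 := vw' ord0 (rshift n j); move: b1 b2; rewrite /ball /= => b1 b2.
  have : modulus (pt v j - pt w j) <= g.
    by apply: le_trans (modulus_le_ReIm _) _; rewrite ReB ImB /=; lra.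
  have := modulusD (pt v j - pt w j) (pt w j); rewrite subrK /g; lra.
exists (e / 2); first by rewrite divr_gt0.
move=> a ar.
have := he (e / 2); rewrite /= sub0r normrN ger0_norm ?divr_ge0 ?ltW// ltr_pdivrMr// ltr_pMr// ltr1n.
move=> /(_ isT); rewrite divr_gt0// => /(_ isT).
pose v : 'rV[R]_(n + n) := \row_j (match fintype.split j with inl i => complex.Re (a i) | inr i => complex.Im (a i) end).
have ptv : pt v = a.
  apply/funext => j; rewrite /pt !mxE.
  by rewrite -[lshift n j]/(unsplit (inl j)) -[rshift n j]/(unsplit (inr j)) !unsplitK; case: (a j).
move=> /(_ v); rewrite /P ptv; apply => // j; rewrite /= mxE /=.
have a1 i : modulus (a i) <= 1 by exact: le_trans (ar i) (ltW r1).
rewrite in_itv /= -ler_norml; case: fintype.split => i; apply: le_trans (a1 i).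
  exact: Re_le_modulus.
exact: Im_le_modulus.
Qed.

Lemma hassum_dilate c (a : 'I_n -> C) (h : C) S B :
  abssum (fun k => c k * mon a k * Complex (1 + modulus h) 0 ^+ mdeg k) B ->
  hassum (fun k => c k * mon a k * (1 + h) ^+ mdeg k) S ->
  exists t, (forall q, hassum (fun k => c k * mon a k * 'C(mdeg k, q)%:R * h ^+ q) (t q)) /\
    hassum t S.
Proof.
move=> cB cS.
pose G (x : mi * nat) := c x.1 * mon a x.1 * 'C(mdeg x.1, x.2)%:R * h ^+ x.2.
have Gb k : hassum (fun q => G (k, q)) (c k * mon a k * (1 + h) ^+ mdeg k).
  apply: eq_hassum (hassumZ (c k * mon a k) (hassum_binomial 1 h (mdeg k))) => q.
  by rewrite /G /= expr1n mulr1 mulrA.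
apply: (@hassum_exchange _ _ _ G B) cS => //.
apply: (@abssum_pair _ _ _ _ (fun k => modulus (c k * mon a k) * (1 + modulus h) ^+ mdeg k)) => [k A|A].
  have [N AN] : exists N, forall q, q \in A -> (q < N)%N.
    by exists (\max_(q <- A) q).+1 => q qA; rewrite ltnS; exact: (leq_bigmax_seq q qA isT).
  pose F q : R := 'C(mdeg k, q)%:R * 1 ^+ (mdeg k - q) * modulus h ^+ q.
  have F0 q : 0 <= F q by rewrite /F expr1n mulr1 mulr_ge0 ?exprn_ge0 ?modulus_ge0.
  have E q : modulus (G (k, q)) = modulus (c k * mon a k) * F q.
    rewrite /G /F /= expr1n mulr1 -mulrA modulusM; congr (_ * _); rewrite modulusM modulusX.
    by rewrite modulus_nat.
  rewrite (eq_bigr _ (fun q _ => E q)) -mulr_sumr ler_wpM2l ?modulus_ge0//.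
  have sub : (A `<=` [fset val i | i in 'I_N])%fset.
    by apply/fsubsetP => q /AN qN; apply/imfsetP; exists (Ordinal qN).
  apply: le_trans (ler_sum_fset F0 sub) _.
  rewrite big_imfset /=; last by move=> i j _ _; exact: val_inj.
  by rewrite big_enum; apply: sum_binomial_le; rewrite ?modulus_ge0.
apply: le_trans (cB A); apply: ler_sum => k _; rewrite [leRHS]modulusM modulusX modulus_real.
by rewrite ger0_norm// addr_ge0 ?modulus_ge0.
Qed.

Definition local_series f c (r : R) := forall z : polydisc R n,
  (forall j, modulus (coord j z) < r) -> hassum (fun k => c k * mon (fun j => coord j z) k) (f z).

Lemma local_series_pd f c r w (w1 : forall j, modulus (w j) < 1) :
  local_series f c r -> (forall j, modulus (w j) < r) -> hassum (fun k => c k * mon w k) (f (pd w1)).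
Proof.
move=> fc wr; have wr' j : modulus (coord j (pd w1)) < r by rewrite coord_pd.
apply: eq_hassum (fc _ wr') => k; congr (_ * _).
by apply: eq_mon => j; rewrite coord_pd.
Qed.

(** Expanding [(1 + h) ^+ mdeg k] in the series at 0 gives a second power series in [h] with the
    same sum; uniqueness identifies the coefficients. *)
Lemma dilation_coef f c (rho r dl : R) (a : 'I_n -> C) (b : nat -> C) :
  0 < r < rho -> rho <= 1 -> 0 < dl -> local_series f c rho -> (forall j, modulus (a j) <= r) ->
  (forall h (w1 : forall j, modulus (a j * (1 + h)) < 1), modulus h <= dl ->
    hassum (fun q => b q * h ^+ q) (f (pd w1))) ->
  forall q, hassum (fun k => c k * mon a k * 'C(mdeg k, q)%:R) (b q).
Proof.
move=> /andP[r0 rrho] rho1 dl0 fc ar fb.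
(* Small enough for the given expansion in [h], and for [a j * (1 + h)] to stay where the series at
   0 is known. *)
pose eta := Order.min dl ((rho - r) / 2).
have eta0 : 0 < eta by rewrite lt_min dl0 divr_gt0// subr_gt0.
have reta : r * (1 + eta) < rho.
  have : eta <= (rho - r) / 2 by rewrite ge_min lexx orbT.
  nra.
have w_lt h : modulus h <= eta -> forall j, modulus (a j * (1 + h)) < rho.
  move=> he j; apply: le_lt_trans reta; rewrite modulusM ler_pM ?modulus_ge0//.
  by apply: le_trans (modulusD _ _) _; rewrite modulus1 lerD2l.
have w1 h : modulus h <= eta -> forall j, modulus (a j * (1 + h)) < 1.
  by move=> he j; exact: lt_le_trans (w_lt h he j) rho1.
have [B cB] : exists B, abssum (fun k => c k * Complex (r * (1 + eta)) 0 ^+ mdeg k) B.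
  have r1 (j : 'I_n) : modulus (Complex (r * (1 + eta)) 0 : C) < rho.
    by rewrite modulus_real ger0_norm// mulr_ge0 ?(ltW r0) ?addr_ge0 ?(ltW eta0).
  have r1' j := lt_le_trans (r1 j) rho1.
  have [B h] := hassum_abssum (local_series_pd r1' fc r1); exists B.
  by apply: le_abssum h => k; rewrite -prod_expr_mdeg.
have exp h (he : modulus h <= eta) : exists t,
    (forall q, hassum (fun k => c k * mon a k * 'C(mdeg k, q)%:R * h ^+ q) (t q)) /\
    hassum t (f (pd (w1 h he))).
  apply: (@hassum_dilate _ _ _ _ B); last first.
    apply: eq_hassum (local_series_pd (w1 h he) fc (w_lt h he)) => k.
    by rewrite -mulrA; congr (_ * _); rewrite mulrC -monZ; apply: eq_mon => j; rewrite mulrC.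
  apply: le_abssum cB => k; rewrite !modulusM !modulusX !modulus_real -mulrA ler_wpM2l ?modulus_ge0//.
  rewrite !ger0_norm ?addr_ge0 ?modulus_ge0 ?mulr_ge0 ?(ltW r0) ?addr_ge0 ?(ltW eta0)// exprMn.
  rewrite ler_pM ?exprn_ge0 ?addr_ge0 ?modulus_ge0 ?(ltW r0) //; first exact: modulus_mon_le.
  by rewrite lerXn2r ?nnegrE ?addr_ge0 ?modulus_ge0 ?(ltW eta0)// lerD2l.
have he0 : modulus (Complex eta 0 : C) <= eta by rewrite modulus_real gtr0_norm.
have [t0 [ht0 _]] := exp _ he0.
have etaC q : Complex eta 0 ^+ q != 0 :> C by rewrite expf_neq0// eq_complex /= gt_eqF.
pose b' q := t0 q / Complex eta 0 ^+ q.
have hb' q : hassum (fun k => c k * mon a k * 'C(mdeg k, q)%:R) (b' q).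
  by apply: eq_hassum (hassumZr (Complex eta 0 ^+ q)^-1 (ht0 q)) => k; rewrite mulfK.
pose S h := if pselect (forall j, modulus (a j * (1 + h)) < 1) is left w then f (pd w) else 0.
suff bb' : b =1 b' by move=> q; rewrite bb'; exact: hb'.
apply: (@power_series_unique _ _ _ S eta) => // h /ltW he; rewrite /S; case: pselect => [w2|/(_ (w1 h he))//].
  by apply: fb; apply: le_trans he _; rewrite ge_min lexx.
have [t [ht tf]] := exp h he.
have -> : pd w2 = pd (w1 h he) by apply: polydisc_eq => j; rewrite !coord_pd.
apply: eq_hassum tf => q; apply: hassum_unique (ht q) _.
exact: hassumZr.
Qed.

(** For fixed [q], the coefficient of [h ^+ q] is a function of [a] on the torus of radius [r], with
    Fourier coefficients [c k * 'C(mdeg k, q) * r ^+ mdeg k]; [cauchy_estimate] bounds them. Summing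
    over [q] against [(dl / 2) ^+ q] rebuilds [(1 + dl / 2) ^+ mdeg k], so the series at 0 converges
    beyond radius [rho]. *)
Lemma local_series_extend f c (rho : R) : analytic f -> 0 < rho < 1 -> local_series f c rho ->
  exists2 rho', rho < rho' & local_series f c rho'.
Proof.
move=> fan /andP[rho0 rho1] fc.
have rho01 : 0 < rho < 1 by rewrite rho0.
have [dl1 dl10 hdl1] := dilation_series_uniform fan rho01.
pose dl := Order.min dl1 1.
have dl0 : 0 < dl by rewrite lt_min dl10 ltr01.
have dle : dl <= 1 by rewrite ge_min lexx orbT.
have hdl a : (forall j, modulus (a j) <= rho) -> dilation_series f dl a.
  by move=> /hdl1; apply: dilation_series_mono => //; rewrite ge_min lexx.
(* [r = rho / x] lies inside the known radius while [s = r * (1 + dl / 2)] lies outside; the factor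
   [1 + dl / 16] below leaves room for a radius [y] with [rho < y < s] and [y / x < rho]. *)
pose x := 1 + dl / 8.
have x1 : 1 < x by rewrite /x ltrDl divr_gt0.
have x0 : 0 < x by exact: lt_trans x1.
pose r := rho / x.
have r0 : 0 < r by rewrite divr_gt0.
have rrho : r < rho by rewrite ltr_pdivrMr// ltr_pMr.
have bound k q : modulus (c k) * r ^+ mdeg k * 'C(mdeg k, q)%:R <= dl^-1 / dl ^+ q.
  have art (t : n.-tuple R) (j : 'I_n) : modulus (Complex r 0 * cis (tnth t j) : C) <= r.
    by rewrite modulusM modulus_real modulus_cis mulr1 gtr0_norm.
  have /all_sig[b hb] (t : n.-tuple R) := cid (hdl (fun j => Complex r 0 * cis (tnth t j))
    (fun j => le_trans (art t j) (ltW rrho))).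
  have r01 : 0 < r < rho by rewrite r0.
  have hsum t : hassum (fun k => c k * 'C(mdeg k, q)%:R * Complex r 0 ^+ mdeg k * char k t) (b t q).
    have h := dilation_coef r01 (ltW rho1) dl0 fc (art t) (hb t).2 q.
    by apply: eq_hassum h => k'; rewrite monZ -char_mon; ring.
  have [B aB] := hassum_abssum (hsum [tuple of nseq n 0]).
  have := @cauchy_estimate R n (fun k => c k * 'C(mdeg k, q)%:R * Complex r 0 ^+ mdeg k) B (dl^-1 / dl ^+ q)
    (fun t => b t q) k.
  rewrite !modulusM modulusX modulus_real gtr0_norm// modulus_nat mulrAC; apply => //.
    by apply: le_abssum aB => k'; rewrite [leRHS]modulusM modulus_char mulr1.
  by move=> t; rewrite ler_pdivlMr ?exprn_gt0//; exact: (hb t).1.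
pose s := r * (1 + dl / 2).
have s0 : 0 < s by rewrite mulr_gt0// addr_gt0// divr_gt0.
(* Only half of the radius [dl] is used, so the bounds [dl^-1 / dl ^+ q] contribute a geometric
   series of ratio 1/2, with sum at most [2 / dl]. *)
have cs k : modulus (c k) * s ^+ mdeg k <= 2 / dl.
  rewrite /s exprMn mulrA exprDn mulr_sumr.
  apply: (@le_trans _ _ (\sum_(q < (mdeg k).+1) dl^-1 * 2^-1 ^+ q)).
    apply: ler_sum => q _; rewrite expr1n mul1r [(dl / 2) ^+ q]exprMn -mulr_natr.
    have := bound k q; rewrite ler_pdivlMr ?exprn_gt0// => le1.
    have -> : modulus (c k) * r ^+ mdeg k * (dl ^+ q * 2^-1 ^+ q * 'C(mdeg k, q)%:R) =
      (modulus (c k) * r ^+ mdeg k * 'C(mdeg k, q)%:R * dl ^+ q) * 2^-1 ^+ q by ring.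
    by rewrite ler_wpM2r// exprn_ge0.
  rewrite -mulr_sumr mulrC ler_pM2r ?invr_gt0//.
  apply: le_trans (geometric_le _ _) _; first by rewrite invr_ge0 invf_lt1 ?ltr1n// andbT.
  by rewrite [X in _ <= X](_ : 2 = (1 - 2^-1)^-1 :> R)//; field.
pose y := rho * (1 + dl / 16).
have ys : y < s.
  by rewrite /y /s /r mulrAC ltr_pdivlMr// -mulrA ltr_pM2l// /x; nra.
have y0 : 0 < y by rewrite mulr_gt0// addr_gt0// divr_gt0.
exists y; first by rewrite /y ltr_pMr// ltrDl divr_gt0.
(* Any [z] of the larger polydisc is [a * (1 + h)] with this fixed [h] and [a] of radius below
   [rho], so the dilation series at [a] evaluates [f z]. *)
move=> z zy; pose h : C := Complex (dl / 8) 0.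
have xC : Complex x 0 = 1 + h by apply: complex_eq; rewrite ?ReD ?ImD /= ?addr0.
have xn0 : 1 + h != 0 by rewrite -xC eq_complex /= gt_eqF.
pose a j := coord j z / (1 + h).
have az j : a j * (1 + h) = coord j z by rewrite /a mulfVK.
pose r1 := y / x.
have r1rho : r1 < rho.
  rewrite /r1 /y ltr_pdivrMr// ltr_pM2l// /x; lra.
have r10 : 0 < r1 by rewrite divr_gt0.
have ar j : modulus (a j) <= r1.
  rewrite /a modulusM modulusV -xC modulus_real gtr0_norm// ler_pM2r ?invr_gt0//.
  exact/ltW/zy.
have [b [_ hb]] := hdl a (fun j => le_trans (ar j) (ltW r1rho)).
have r101 : 0 < r1 < rho by rewrite r10.
have hcb := dilation_coef r101 (ltW rho1) dl0 fc ar hb.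
have mz k : mon (fun j => coord j z) k = mon a k * (1 + h) ^+ mdeg k.
  by rewrite mulrC -monZ; apply: eq_mon => j; rewrite mulrC az.
have hh : modulus h = dl / 8 by rewrite modulus_real gtr0_norm// divr_gt0.
have ysg : 0 <= y / s < 1 by rewrite divr_ge0 ?ltW//= ltr_pdivrMr// mul1r.
have cB : abssum (fun k => c k * mon a k * Complex (1 + modulus h) 0 ^+ mdeg k) (2 / dl * (1 - y / s)^-1 ^+ n).
  have := abssumZ (Complex (2 / dl) 0) (@abssum_geometric R n _ ysg).
  rewrite modulus_real ger0_norm ?divr_ge0 ?ltW//; apply: le_abssum => k.
  rewrite hh -/x xC -mulrA -mz !modulusM !modulus_real !ger0_norm ?exprn_ge0 ?divr_ge0 ?(ltW dl0) ?(ltW y0) ?(ltW s0)//.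
  rewrite expr_div_n mulrA ler_pdivlMr ?exprn_gt0// mulrAC.
  apply: ler_pM; rewrite ?mulr_ge0 ?exprn_ge0 ?modulus_ge0 ?(ltW s0)//.
  by apply: modulus_mon_le => j; exact/ltW/zy.
have [S hS] : exists S, hassum (fun k => c k * mon (fun j => coord j z) k) S.
  apply: (@abssum_hassum _ _ _ (2 / dl * (1 - y / s)^-1 ^+ n)); apply: le_abssum cB => k.
  by rewrite mz hh -/x xC mulrA.
have [t [ht tS]] : exists t, (forall q, hassum (fun k => c k * mon a k * 'C(mdeg k, q)%:R * h ^+ q) (t q)) /\
    hassum t S.
  by apply: hassum_dilate cB _; apply: eq_hassum hS => k; rewrite mz mulrA.
suff -> : f z = S by [].
have w1 j : modulus (a j * (1 + h)) < 1 by rewrite az coord_lt1.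
have -> : z = pd w1 by apply: polydisc_eq => j; rewrite coord_pd az.
have hdl8 : modulus h <= dl by rewrite hh; lra.
apply: hassum_unique (hb h w1 hdl8) _.
apply: eq_hassum tS => q; apply: hassum_unique (ht q) _.
exact: hassumZr.
Qed.

(* Cauchy's theory replaced by a supremum argument on the radius of the series at [0]. *)
Theorem analytic_series f : analytic f -> exists c, series f c.
Proof.
move=> fan.
have w0 (j : 'I_n) : modulus (0 : C) < 1 by rewrite modulus0.
have [r0 r00 [c hc]] := fan (pd w0).
have loc0 : local_series f c r0.
  move=> z zr; have := hc z; rewrite -hassumP.
  have E j : coord j z - coord j (pd w0) = coord j z by rewrite coord_pd subr0.
  move=> h; have {}h := h (fun j => eq_ind_r (fun x => modulus x < r0) (zr j) (E j)).
  by apply: eq_hassum h => k; congr (_ * _); apply: eq_bigr => j _; rewrite E.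
exists c.
pose E := [set r : R | 0 < r <= 1 /\ local_series f c r].
have mono r r' : r' <= r -> local_series f c r -> local_series f c r'.
  by move=> rr' h z zr; apply: h => j; exact: lt_le_trans (zr j) rr'.
have Er0 : E (Order.min r0 1).
  by split; [rewrite lt_min r00 ltr01 ge_min lexx orbT|apply: mono loc0; rewrite ge_min lexx].
have supE : has_sup E by split; [exists (Order.min r0 1)|exists 1 => r [/andP[]]].
pose rho := sup E.
have rho0 : 0 < rho.
  apply: (@lt_le_trans _ _ (Order.min r0 1)); first by rewrite lt_min r00 ltr01.
  exact: sup_upper_bound.
have rho1 : rho <= 1 by apply: ge_sup; [exact: supE.1|move=> r [/andP[]]].
have locrho : local_series f c rho.
  move=> z zr.
  have [q zq qrho] : exists2 q, (forall j, modulus (coord j z) <= q) & q < rho.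
    exists (\big[Order.max/0]_j modulus (coord j z)); first by move=> j; exact: le_bigmax.
    by apply/bigmax_ltP; split => // j _; exact: zr.
  have rq0 : 0 < rho - q by rewrite subr_gt0.
  have [r [_ rl] qr] := sup_adherent rq0 supE.
  by apply: rl => j; apply: le_lt_trans (zq j) _; by move: qr; rewrite subKr.
have [rho_lt1|rho_ge1] := ltP rho 1; last first.
  by move=> z; apply: (mono _ _ rho_ge1 locrho) => j; exact: coord_lt1.
have [rho' rr' loc'] := local_series_extend fan (introT andP (conj rho0 rho_lt1)) locrho.
have : E (Order.min rho' 1).
  split; last by apply: mono loc'; rewrite ge_min lexx.
  by rewrite lt_min (lt_trans rho0 rr') ltr01 ge_min lexx orbT.
move=> /(sup_upper_bound supE); rewrite -/rho leNgt lt_min rr' rho_lt1 //.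
Qed.

End Polydisc.

(** * The Hardy norm and the Taylor coefficients *)

Section HardyNorm.
Context {R : realType} {n : nat}.
Local Notation C := (Cplx R).
Local Notation mi := {ffun 'I_n -> nat}.
Local Notation TR := (n.-tuple (measurableTypeR R)).
Local Notation mu := (torus_measure R n).
Implicit Types (f g : polydisc R n -> C) (c : mi -> C).

Definition cpt (r : R) (t : n.-tuple R) (j : 'I_n) : C := Complex r 0 * cis (tnth t j).

Lemma cpt_lt1 r t : 0 <= r < 1 -> forall j, modulus (cpt r t j) < 1.
Proof.
by move=> /andP[r0 r1] j; rewrite modulusM modulus_real modulus_cis mulr1 ger0_norm.
Qed.

Lemma ext0_pd f w (w1 : forall j, modulus (w j) < 1) : ext0 f (\row_j w j) = f (pd w1).
Proof.
rewrite /ext0; case: insubP => [z _ zE|/negP[]]; last exact: in_polydisc_row.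
by congr f; apply: val_inj; rewrite zE.
Qed.

Lemma ext0_circle f r t (r01 : 0 <= r < 1) : ext0 f (circle_pt r t) = f (pd (cpt_lt1 t r01)).
Proof.
rewrite -ext0_pd; congr ext0; apply/rowP => j; rewrite !mxE.
by apply: complex_eq; rewrite ?ReM ?ImM /=; ring.
Qed.

Definition meansq f (r : R) : R := \int[mu]_t (modulus (ext0 f (circle_pt r t)) ^+ 2).

Lemma series_meansq f c r : 0 <= r < 1 -> series f c ->
  [/\ measurable_fun [set: TR] (fun t => modulus (ext0 f (circle_pt r t))),
      exists B, forall t, modulus (ext0 f (circle_pt r t)) <= B &
      hassum (fun k => Complex (modulus (c k) ^+ 2 * r ^+ (2 * mdeg k)) 0) (Complex (meansq f r) 0)].
Proof.
move=> r01 fc; have [B cB] := series_abssum r01 fc.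
have fr t : hassum (fun k => c k * Complex r 0 ^+ mdeg k * char k t) (ext0 f (circle_pt r t)).
  rewrite (ext0_circle _ _ r01); apply: eq_hassum (series_pd (cpt_lt1 t r01) fc) => k.
  by rewrite monZ mulrA -char_mon.
have [mf fB hs] := parseval cB fr; split => //; first by exists B.
apply: eq_hassum hs => k; congr Complex.
by rewrite modulusM modulusX modulus_real ger0_norm ?(andP r01).1// exprMn -exprM mulnC.
Qed.

Lemma Lnorm2E f r : 0 <= r < 1 -> (exists c, series f c) ->
  ('N[mu]_(2%:E) [ (fun t => (modulus (ext0 f (circle_pt r t)))%:E) ])%E =
  (Num.sqrt (meansq f r))%:E.
Proof.
move=> r01 [c fc]; have [mf [B fB] _] := series_meansq r01 fc.
rewrite unlock /Lnorm.
have -> : (\int[mu]_t `|(modulus (ext0 f (circle_pt r t)))%:E| `^ 2 = (meansq f r)%:E)%E.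
  rewrite /meansq /Rintegral fineK.
    apply: eq_integral => t _.
    by rewrite abse_EFin poweR_EFin ger0_norm ?modulus_ge0// powR_mulrn ?modulus_ge0.
  apply: (integrable_fin_num measurableT).
  apply: (@integrable_torus_bounded _ _ _ (B ^+ 2)); first exact: measurable_funX.
  move=> t; rewrite ger0_norm ?sqr_ge0// ler_sqr ?nnegrE ?modulus_ge0//.
  exact: le_trans (modulus_ge0 _) (fB t).
rewrite poweR_EFin powR12_sqrt// /meansq; apply: Rintegral_ge0 => t _.
exact: sqr_ge0.
Qed.

Lemma meansq_ge0 f r : 0 <= meansq f r.
Proof. by apply: Rintegral_ge0 => t _; exact: sqr_ge0. Qed.

Definition sqsum_le c (B : R) := forall A : {fset mi}, \sum_(k <- A) modulus (c k) ^+ 2 <= B.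

Lemma cvg_radius m : (1 - N.+1%:R^-1 : R) ^+ m @[N --> \oo] --> (1 : R).
Proof.
have h : (1 - N.+1%:R^-1 : R) @[N --> \oo] --> (1 : R).
  rewrite -[X in _ --> X]subr0; apply: cvgB; first exact: cvg_cst.
  exact: cvg_harmonic.
elim: m => [|m IH]; first by under eq_cvg do rewrite expr0; exact: cvg_cst.
under eq_cvg do rewrite exprS.
by have := cvgM h IH; rewrite mulr1; exact.
Qed.

Lemma radius01 N : 0 <= (1 - N.+1%:R^-1 : R) < 1.
Proof.
rewrite subr_ge0 invf_le1 ?ler1n ?ltr0n//=.
Qed.

(** A finite sum is continuous at [r = 1]; the limit is taken along the radii [1 - 1 / (N + 1)]. *)
Lemma sum_radius_le (A : {fset mi}) (a : mi -> R) (e : mi -> nat) (M : R) :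
  (forall r, 0 <= r < 1 -> \sum_(k <- A) a k * r ^+ e k <= M) -> \sum_(k <- A) a k <= M.
Proof.
move=> h.
have cv : \sum_(k <- A) a k * (1 - N.+1%:R^-1) ^+ e k @[N --> \oo] --> \sum_(k <- A) a k.
  rewrite -[X in _ --> X](_ : \sum_(k <- A) a k * 1 = _); last by under eq_bigr do rewrite mulr1.
  elim: (A : seq _) => [|k r IH]; first by under eq_cvg do rewrite big_nil; rewrite big_nil; exact: cvg_cst.
  under eq_cvg do rewrite big_cons.
  rewrite big_cons; apply: cvgD => //.
  by apply: cvgM; [exact: cvg_cst|exact: cvg_radius].
rewrite -(cvg_lim _ cv)//; apply: limr_le; first by apply/cvg_ex; eexists; exact: cv.
by apply: nearW => N; apply: h; exact: radius01.
Qed.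

(** On the torus of radius [r], Parseval weights the coefficient at [k] by [r ^+ (2 * mdeg k)]:
    letting [r] tend to 1 in finite sums gives one direction, [r <= 1] the other. *)
Lemma hardy_norm_sqsum f c (B : R) : 0 <= B -> series f c ->
  (hardy_norm f <= (Num.sqrt B)%:E)%E <-> sqsum_le c B.
Proof.
move=> B0 fc; split=> [fB A|cB].
  apply: (@sum_radius_le A _ (fun k => (2 * mdeg k)%N)) => r r01.
  have [_ _ hs] := series_meansq r01 fc.
  have t0 k : 0 <= modulus (c k) ^+ 2 * r ^+ (2 * mdeg k).
    by rewrite mulr_ge0 ?sqr_ge0 ?exprn_ge0// (andP r01).1.
  apply: le_trans (hassum_real_le A t0 hs) _.
  have : ((Num.sqrt (meansq f r))%:E <= (Num.sqrt B)%:E)%E.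
    apply: le_trans fB; rewrite -Lnorm2E//; last by exists c.
    by apply: ereal_sup_ubound; exists r => //; rewrite /= in_itv.
  by rewrite lee_fin ler_sqrt.
apply: ge_ereal_sup => x [r /=]; rewrite in_itv /= => r01 <- {x}.
rewrite Lnorm2E//; last by exists c.
rewrite lee_fin ler_sqrt//.
have [_ _ hs] := series_meansq r01 fc.
suff : modulus (Complex (meansq f r) 0 : C) <= B by rewrite modulus_real ger0_norm ?meansq_ge0.
apply: hassum_modulus_le hs _ => A; apply: le_trans (cB A); apply: ler_sum => k _.
have r0 := (andP r01).1.
rewrite modulus_real ger0_norm; last by rewrite mulr_ge0 ?sqr_ge0 ?exprn_ge0.
by rewrite -[leRHS]mulr1 ler_wpM2l ?sqr_ge0// exprn_ile1// ltW// (andP r01).2.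
Qed.

Lemma hardy_norm_ge0 f : (0 <= hardy_norm f)%E.
Proof.
apply: (@le_trans _ _ ('N[mu]_(2%:E) [ (fun t => (modulus (ext0 f (circle_pt 0 t)))%:E) ])%E).
  exact: Lnorm_ge0.
by apply: ereal_sup_ubound; exists 0 => //; rewrite /= in_itv /= lexx ltr01.
Qed.

Lemma hnorm_ge0 f : 0 <= hnorm f.
Proof. by rewrite fine_ge0 ?hardy_norm_ge0. Qed.

(** Through this equivalence membership is checked on coefficients, without returning to local
    analyticity or to integrals. *)
Lemma hardyP f : hardy f <-> exists c B, series f c /\ sqsum_le c B.
Proof.
split=> [[/analytic_series[c fc] fB]|[c [B [fc cB]]]].
  have fn : hardy_norm f \is a fin_num by rewrite ge0_fin_numE// hardy_norm_ge0.
  exists c, (hnorm f ^+ 2); split => //; apply/(hardy_norm_sqsum _ fc); first exact: sqr_ge0.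
  by rewrite sqrtr_sqr ger0_norm ?hnorm_ge0// /hnorm fineK.
have B0 : 0 <= B by apply: le_trans (cB fset0); rewrite big_nil.
split; first exact: series_analytic fc.
by apply: le_lt_trans (ltry (Num.sqrt B)); apply/(hardy_norm_sqsum _ fc).
Qed.

Lemma hnorm_sqsum f c B : 0 <= B -> hardy f -> series f c -> hnorm f ^+ 2 <= B <-> sqsum_le c B.
Proof.
move=> B0 [_ fB] fc; rewrite -(hardy_norm_sqsum B0 fc).
have fn : hardy_norm f \is a fin_num by rewrite ge0_fin_numE// hardy_norm_ge0.
rewrite -[hardy_norm f]fineK// lee_fin -/(hnorm f).
rewrite -{2}(ger0_norm (hnorm_ge0 f)) -sqrtr_sqr ler_sqrt//.
Qed.

Lemma hassum_hnorm f c : hardy f -> series f c ->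
  hassum (fun k => Complex (modulus (c k) ^+ 2) 0) (Complex (hnorm f ^+ 2) 0).
Proof.
move=> fh fc.
have cB : sqsum_le c (hnorm f ^+ 2) by apply/(hnorm_sqsum _ fh fc); rewrite ?sqr_ge0.
have [| |s [hs sB As]] := @hassum_ge0 _ _ (fun k => modulus (c k) ^+ 2) (hnorm f ^+ 2) => //.
  by move=> k; exact: sqr_ge0.
have s0 : 0 <= s by apply: le_trans (As fset0); rewrite big_nil.
suff <- : s = hnorm f ^+ 2 by [].
by apply/le_anti; rewrite sB /=; apply/(hnorm_sqsum _ fh fc).
Qed.

(** Coefficients of the global series at 0; the default is reached only by functions without such a
    series. *)
Definition taylor f : mi -> C :=
  if pselect (exists c, series f c) is left h then sval (cid h) else fun=> 0.

Lemma taylor_series f c : series f c -> taylor f = c.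
Proof.
move=> fc; rewrite /taylor; case: pselect => [h|[]]; last by exists c.
by case: cid => c' fc'; apply/funext; exact: series_unique fc' fc.
Qed.

Lemma series_taylor f : hardy f -> series f (taylor f).
Proof. by move=> /hardyP[c [B [fc _]]]; rewrite (taylor_series fc). Qed.

Lemma hardy_taylor_eq f g : hardy f -> hardy g -> taylor f =1 taylor g -> f = g.
Proof.
move=> /series_taylor fc /series_taylor gc fg; apply/funext => z.
apply: hassum_unique (fc z) _; apply: eq_hassum (gc z) => k.
by rewrite fg.
Qed.

Lemma hassum_taylor_hnorm f : hardy f ->
  hassum (fun k => Complex (modulus (taylor f k) ^+ 2) 0) (Complex (hnorm f ^+ 2) 0).
Proof. by move=> fh; exact: hassum_hnorm (series_taylor fh). Qed.

(** The inequality [u v <= (u^2 + v^2) / 2] replaces Cauchy-Schwarz, which comes later; the bound is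
    therefore not homogeneous in [c]. *)
Lemma sqsum_abssum c B (q : R) : 0 <= q < 1 -> sqsum_le c B ->
  abssum (fun k => c k * Complex q 0 ^+ mdeg k) ((B + (1 - q ^+ 2)^-1 ^+ n) / 2).
Proof.
move=> /andP[q0 q1] cB A; have q201 : 0 <= q ^+ 2 < 1.
  by rewrite exprn_ge0// expr_lt1.
have := @abssum_geometric R n _ q201 A; have := cB A.
set x := \sum_(k <- A) _; set y := \sum_(k <- A) _ => xB yB.
apply: (@le_trans _ _ ((x + y) / 2)); last by rewrite ler_pM2r ?invr_gt0// lerD.
rewrite /x /y -big_split mulr_suml; apply: ler_sum => k _.
rewrite modulusM modulusX [modulus (Complex q 0)]modulus_real [modulus (Complex (_ ^+ _) 0)]modulus_real.
rewrite (ger0_norm q0) ger0_norm ?exprn_ge0// -exprM mulnC exprM.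
have := sqr_ge0 (modulus (c k) - q ^+ mdeg k).
set u := modulus (c k); set v := q ^+ mdeg k; rewrite -[X in _ <= X / _]/(u ^+ 2 + v ^+ 2); nra.
Qed.

Lemma sqsum_series c B : sqsum_le c B -> exists2 f, hardy f & series f c.
Proof.
move=> cB.
have ex (z : polydisc R n) : exists s, hassum (fun k => c k * mon (fun j => coord j z) k) s.
  have [q [q0 q1 zq]] := max_coord z.
  apply: (@abssum_hassum _ _ _ ((B + (1 - q ^+ 2)^-1 ^+ n) / 2)).
  have q01 : 0 <= q < 1 by rewrite q0.
  apply: le_abssum (sqsum_abssum q01 cB) => k.
  rewrite !modulusM ler_wpM2l ?modulus_ge0// modulusX modulus_real ger0_norm//.
  exact: modulus_mon_le.
have fc : series (fun z => sval (cid (ex z))) c by move=> z; exact: svalP.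
by exists (fun z => sval (cid (ex z))) => //; apply/hardyP; exists c, B.
Qed.

Lemma seriesD f g c d : series f c -> series g d -> series (f + g) (fun k => c k + d k).
Proof. by move=> fc gd z; apply: eq_hassum (hassumD (fc z) (gd z)) => k; rewrite mulrDl. Qed.

Lemma seriesZ a f c : series f c -> series (a *: f) (fun k => a * c k).
Proof. by move=> fc z; apply: eq_hassum (hassumZ a (fc z)) => k; rewrite mulrA. Qed.

Lemma series0 : series (0 : polydisc R n -> C) (fun=> 0).
Proof. by move=> z; apply: eq_hassum hassum0 => k; rewrite mul0r. Qed.

Lemma sqsum_leD c d B B' : sqsum_le c B -> sqsum_le d B' ->
  sqsum_le (fun k => c k + d k) (2 * (B + B')).
Proof.
move=> cB dB A.
apply: (@le_trans _ _ (\sum_(k <- A) (2 * (modulus (c k) ^+ 2 + modulus (d k) ^+ 2)))).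
  apply: ler_sum => k _; have := modulusD (c k) (d k); have := modulus_ge0 (c k + d k).
  have := sqr_ge0 (modulus (c k) - modulus (d k)); nra.
by rewrite -mulr_sumr big_split /= ler_pM2l// lerD.
Qed.

Lemma sqsum_leZ a c B : sqsum_le c B -> sqsum_le (fun k => a * c k) (modulus a ^+ 2 * B).
Proof.
move=> cB A; under eq_bigr do rewrite modulusM exprMn.
by rewrite -mulr_sumr ler_wpM2l ?sqr_ge0.
Qed.

Lemma hardyD f g : hardy f -> hardy g -> hardy (f + g).
Proof.
move=> /hardyP[c [B [fc cB]]] /hardyP[d [B' [gd dB]]]; apply/hardyP.
by exists (fun k => c k + d k), (2 * (B + B')); split; [exact: seriesD|exact: sqsum_leD].
Qed.

Lemma hardyZ a f : hardy f -> hardy (a *: f).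
Proof.
move=> /hardyP[c [B [fc cB]]]; apply/hardyP.
by exists (fun k => a * c k), (modulus a ^+ 2 * B); split; [exact: seriesZ|exact: sqsum_leZ].
Qed.

Lemma hardy0 : hardy (0 : polydisc R n -> C).
Proof.
apply/hardyP; exists (fun=> 0), 0; split; first exact: series0.
by move=> A; rewrite big1// => k _; rewrite modulus0 expr0n.
Qed.

Lemma hardyN f : hardy f -> hardy (- f).
Proof. by move=> fh; rewrite -scaleN1r; exact: hardyZ. Qed.

Lemma hardyB f g : hardy f -> hardy g -> hardy (f - g).
Proof. by move=> fh gh; apply: hardyD => //; exact: hardyN. Qed.

Lemma taylorD f g : hardy f -> hardy g -> taylor (f + g) = fun k => taylor f k + taylor g k.
Proof. by move=> fh gh; apply: taylor_series; apply: seriesD; exact: series_taylor. Qed.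

Lemma taylorZ a f : hardy f -> taylor (a *: f) = fun k => a * taylor f k.
Proof. by move=> fh; apply: taylor_series; apply: seriesZ; exact: series_taylor. Qed.

Lemma taylorB f g : hardy f -> hardy g -> taylor (f - g) = fun k => taylor f k - taylor g k.
Proof.
move=> fh gh; rewrite taylorD//; last exact: hardyN.
by apply/funext => k; rewrite -scaleN1r taylorZ// mulN1r.
Qed.

Lemma taylor0 : taylor (0 : polydisc R n -> C) = fun=> 0.
Proof. exact: taylor_series series0. Qed.

(** Polarization is an algebraic identity for each pair of coefficients, and is then summed. The
    sesquilinearity of [inner], invisible in its definition, is read off from this. *)
Lemma hassum_inner f g : hardy f -> hardy g ->
  hassum (fun k => taylor f k * conjc (taylor g k)) (inner f g).
Proof.
move=> fh gh; pose i : C := Complex 0 1.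
have ii : i * i = -1 by rewrite -expr2; exact: sqr_i.
have h (k : 'I_4) : hassum (fun l => i ^+ k * Complex (modulus (taylor f l + i ^+ k * taylor g l) ^+ 2) 0)
    (i ^+ k * Complex (hnorm (f + i ^+ k *: g) ^+ 2) 0).
  apply: hassumZ; have := hassum_taylor_hnorm (hardyD fh (hardyZ (i ^+ k) gh)).
  by rewrite taylorD ?taylorZ//; exact: hardyZ.
have := hassumZ (4^-1 : C) (hassum_sum (index_enum 'I_4) h).
apply: eq_hassum => l; set x := taylor f l; set y := taylor g l.
under eq_bigr do rewrite -mulr_conj.
rewrite !big_ord_recl big_ord0 /= !exprS expr0.
have ic : conjc i = - i by apply: complex_eq; rewrite /= ?oppr0.
rewrite !mulr1 !ii !mulrN1 !mul1r !mulN1r !mulNr !(conjc_add, conjc_opp, conjc_mul) ic.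
move: (conjc x) (conjc y) => X Y.
transitivity (4^-1 * (2 * (x * Y) + 2 * (y * X) + (i * i) * (2 * (y * X) - 2 * (x * Y)))); first by ring.
by rewrite ii; field.
Qed.

End HardyNorm.

(** * Hilbert space geometry and the coordinate operators *)

Section Reindex.
Context {R : realType}.
Local Notation C := (Cplx R).

(** The condition [h (h' j) <> j] singles out the indices off the image of [h], which contribute
    nothing; the shifts of multi-indices are of this form. *)
Lemma hassum_image (I J : choiceType) (h : I -> J) (h' : J -> I) (F : J -> C) s :
  cancel h h' -> (forall j, h (h' j) <> j -> F j = 0) ->
  hassum (F \o h) s -> hassum F s.
Proof.
move=> hK F0 Fs e e0; have [A0 h0] := Fs e e0.
exists [fset h x | x in A0]%fset => A AA0.
pose B := [fset h' y | y in [fset y in A | h (h' y) == y]]%fset.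
have -> : \sum_(i <- A) F i = \sum_(i <- B) (F \o h) i.
  rewrite big_imfset /=; last first.
    by move=> x y; rewrite !inE => /andP[_ /eqP xE] /andP[_ /eqP yE] E; rewrite -xE E yE.
  rewrite (big_fsetID _ (fun y => h (h' y) == y)) /=.
  have -> : \sum_(i <- [fset x in A | h (h' x) != x]%fset) F i = 0.
    by rewrite big_seq big1 // => y; rewrite !inE => /andP[_ /eqP /F0].
  by rewrite addr0 !big_seq; apply: eq_bigr => y; rewrite !inE => /andP[_ /eqP ->].
apply: h0; apply/fsubsetP => x xA0; apply/imfsetP; exists (h x); last by rewrite hK.
rewrite /= !inE hK eqxx andbT; apply: (fsubsetP AA0).
by apply/imfsetP; exists x.
Qed.

Lemma hassum_preimage (I J : choiceType) (h : I -> J) (h' : J -> I) (F : J -> C) s :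
  cancel h h' -> (forall j, h (h' j) <> j -> F j = 0) ->
  hassum F s -> hassum (F \o h) s.
Proof.
move=> hK F0 Fs; have [B FB] := hassum_abssum Fs.
have [s' hs'] : exists s', hassum (F \o h) s'.
  apply: (@abssum_hassum _ _ _ B) => A; have := FB [fset h x | x in A]%fset.
  by rewrite big_imfset //= => x y _ _; exact: (can_inj hK).
by rewrite (hassum_unique Fs (hassum_image hK F0 hs')).
Qed.

Lemma modulus_dist (x y : C) : `|modulus x - modulus y| <= modulus (x - y).
Proof.
rewrite ler_norml; apply/andP; split.
  rewrite lerNl opprB lerBlDr (modulusB x).
  by apply: le_trans (modulusD _ _); rewrite subrK.
by rewrite lerBlDr; apply: le_trans (modulusD _ _); rewrite subrK.
Qed.

Lemma complex_cauchy (u : nat -> C) :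
  (forall e, 0 < e -> exists N, forall m, (N <= m)%N -> modulus (u m - u N) <= e) ->
  exists l : C, forall e, 0 < e -> exists N, forall m, (N <= m)%N -> modulus (u m - l) <= e.
Proof.
move=> uC.
have key (f : C -> R) : (forall x y, `|f x - f y| <= modulus (x - y)) ->
    exists l : R, forall e, 0 < e -> exists N, forall m, (N <= m)%N -> `|f (u m) - l| <= e.
  move=> fl; have cv : cvgn (f \o u).
    apply: cauchy_cvg; apply/cauchy_exP => e e0.
    have [N hN] := uC (e / 2) (divr_gt0 e0 (ltr0Sn _ 1)).
    exists (f (u N)); exists N => // m /= /hN le.
    rewrite /ball /= distrC; apply: le_lt_trans (fl _ _) _; apply: le_lt_trans le _.
    by rewrite ltr_pdivrMr// ltr_pMr// ltr1n.
  exists (lim ((f \o u) @ \oo)) => e e0.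
  move/cvgrPdist_le : cv => /(_ e e0)[N _ hN]; exists N => m /hN.
  by rewrite distrC.
have [l1 h1] := key (@complex.Re R) (fun x y => eq_ind _ (fun z => `|z| <= _) (Re_le_modulus (x - y)) _ (ReB x y)).
have [l2 h2] := key (@complex.Im R) (fun x y => eq_ind _ (fun z => `|z| <= _) (Im_le_modulus (x - y)) _ (ImB x y)).
exists (Complex l1 l2) => e e0.
have [N1 hN1] := h1 (e / 2) (divr_gt0 e0 (ltr0Sn _ 1)).
have [N2 hN2] := h2 (e / 2) (divr_gt0 e0 (ltr0Sn _ 1)).
exists (maxn N1 N2) => m; rewrite geq_max => /andP[/hN1 a1 /hN2 a2].
apply: le_trans (modulus_le_ReIm _) _; rewrite ReB ImB /=; lra.
Qed.

End Reindex.

(** * Inner product, completeness and orthogonal projection *)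

Section Hilbert.
Context {R : realType} {n : nat}.
Local Notation C := (Cplx R).
Local Notation mi := {ffun 'I_n -> nat}.
Implicit Types (f g h : polydisc R n -> C) (c : mi -> C) (S : set (polydisc R n -> C)).

Lemma innerDl f g h : hardy f -> hardy g -> hardy h -> inner (f + g) h = inner f h + inner g h.
Proof.
move=> fh gh hh; apply: hassum_unique (hassum_inner (hardyD fh gh) hh) _.
apply: eq_hassum (hassumD (hassum_inner fh hh) (hassum_inner gh hh)) => k.
by rewrite taylorD// mulrDl.
Qed.

Lemma innerZl a f g : hardy f -> hardy g -> inner (a *: f) g = a * inner f g.
Proof.
move=> fh gh; apply: hassum_unique (hassum_inner (hardyZ a fh) gh) _.
apply: eq_hassum (hassumZ a (hassum_inner fh gh)) => k.
by rewrite taylorZ// mulrA.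
Qed.

Lemma inner_conj f g : hardy f -> hardy g -> inner g f = conjc (inner f g).
Proof.
move=> fh gh; apply: hassum_unique (hassum_inner gh fh) _.
apply: eq_hassum (hassum_conj (hassum_inner fh gh)) => k.
by rewrite conjc_mul conjcK mulrC.
Qed.

Lemma innerBl f g h : hardy f -> hardy g -> hardy h -> inner (f - g) h = inner f h - inner g h.
Proof.
by move=> fh gh hh; rewrite innerDl//; [rewrite -scaleN1r innerZl// mulN1r|exact: hardyN].
Qed.

Lemma innerDr f g h : hardy f -> hardy g -> hardy h -> inner f (g + h) = inner f g + inner f h.
Proof.
move=> fh gh hh; rewrite (inner_conj (hardyD gh hh) fh) innerDl//.
by rewrite conjc_add -!inner_conj.
Qed.

Lemma innerZr a f g : hardy f -> hardy g -> inner f (a *: g) = conjc a * inner f g.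
Proof.
move=> fh gh; rewrite (inner_conj (hardyZ a gh) fh) innerZl//.
by rewrite conjc_mul -inner_conj.
Qed.

Lemma innerBr f g h : hardy f -> hardy g -> hardy h -> inner f (g - h) = inner f g - inner f h.
Proof.
move=> fh gh hh; rewrite innerDr//; last exact: hardyN.
by rewrite -scaleN1r innerZr// conjc_opp conjc1 mulN1r.
Qed.

Lemma inner_self f : hardy f -> inner f f = Complex (hnorm f ^+ 2) 0.
Proof.
move=> fh; apply: hassum_unique (hassum_inner fh fh) _.
by apply: eq_hassum (hassum_taylor_hnorm fh) => k; rewrite mulr_conj.
Qed.

Lemma inner0l f : hardy f -> inner 0 f = 0.
Proof. by move=> fh; have := innerZl 0 fh fh; rewrite scale0r mul0r. Qed.

Lemma taylor_le_hnorm f k : hardy f -> modulus (taylor f k) <= hnorm f.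
Proof.
move=> fh; rewrite -ler_sqr ?nnegrE ?modulus_ge0 ?hnorm_ge0//.
have := hassum_real_le [fset k]%fset (fun k => sqr_ge0 _) (hassum_taylor_hnorm fh).
by rewrite big_seq_fset1.
Qed.

Lemma hnorm_eq0 f : hardy f -> hnorm f = 0 -> f = 0.
Proof.
move=> fh f0; apply: hardy_taylor_eq => //; first exact: hardy0.
move=> k; rewrite taylor0; apply/eqP; rewrite -modulus_eq0 eq_le modulus_ge0 andbT -f0.
exact: taylor_le_hnorm.
Qed.

Lemma hnormZ a f : hardy f -> hnorm (a *: f) = modulus a * hnorm f.
Proof.
move=> fh; apply/eqP; rewrite -(@eqrXn2 _ 2)// ?hnorm_ge0 ?mulr_ge0 ?modulus_ge0 ?hnorm_ge0//.
apply/eqP; have := inner_self (hardyZ a fh).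
rewrite innerZl ?innerZr ?inner_self//; last exact: hardyZ.
rewrite mulrA mulr_conj => /(congr1 (@complex.Re R)); rewrite ReM /= mul0r subr0 exprMn => <-.
by [].
Qed.

Lemma hnormB f g : hardy f -> hardy g -> hnorm (f - g) = hnorm (g - f).
Proof.
move=> fh gh; rewrite -opprB -scaleN1r hnormZ ?modulusN ?modulus1 ?mul1r//.
exact: hardyB.
Qed.

Lemma sqr_hnormD f g : hardy f -> hardy g ->
  hnorm (f + g) ^+ 2 = hnorm f ^+ 2 + hnorm g ^+ 2 + 2 * complex.Re (inner f g).
Proof.
move=> fh gh; have := inner_self (hardyD fh gh).
rewrite innerDl ?innerDr ?inner_self//; last exact: hardyD.
rewrite (inner_conj fh gh) => /(congr1 (@complex.Re R)).
by rewrite !ReD Re_conj /= => <-; ring.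
Qed.

Lemma sqr_hnormB f g : hardy f -> hardy g ->
  hnorm (f - g) ^+ 2 = hnorm f ^+ 2 + hnorm g ^+ 2 - 2 * complex.Re (inner f g).
Proof.
move=> fh gh; rewrite -scaleN1r sqr_hnormD ?innerZr ?hnormZ//; last exact: hardyZ.
by rewrite modulusN modulus1 mul1r conjc_opp conjc1 mulN1r; case: (inner f g) => a b /=; ring.
Qed.

Lemma inner_amgm f g : hardy f -> hardy g ->
  modulus (inner f g) <= (hnorm f ^+ 2 + hnorm g ^+ 2) / 2.
Proof.
move=> fh gh; apply: hassum_modulus_le (hassum_inner fh gh) _ => A.
have h1 := hassum_real_le A (fun k => sqr_ge0 _) (hassum_taylor_hnorm fh).
have h2 := hassum_real_le A (fun k => sqr_ge0 _) (hassum_taylor_hnorm gh).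
apply: (@le_trans _ _ (\sum_(k <- A) ((modulus (taylor f k) ^+ 2 + modulus (taylor g k) ^+ 2) / 2))).
  apply: ler_sum => k _; rewrite modulusM modulus_conj.
  have := sqr_ge0 (modulus (taylor f k) - modulus (taylor g k)); nra.
rewrite -mulr_suml big_split ler_pM2r ?invr_gt0//; exact: lerD.
Qed.

(** Both functions are normalised before [inner_amgm] is applied; a function of norm zero is
    zero. *)
Lemma cauchy_schwarz f g : hardy f -> hardy g -> modulus (inner f g) <= hnorm f * hnorm g.
Proof.
move=> fh gh.
have [f0|f0] := eqVneq (hnorm f) 0.
  by rewrite (hnorm_eq0 fh f0) inner0l// modulus0 mulr_ge0 ?hnorm_ge0.
have [g0|g0] := eqVneq (hnorm g) 0.
  by rewrite (hnorm_eq0 gh g0) (inner_conj hardy0 fh) modulus_conj inner0l// modulus0 mulr_ge0 ?hnorm_ge0.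
have fp : 0 < hnorm f by rewrite lt_def f0 hnorm_ge0.
have gp : 0 < hnorm g by rewrite lt_def g0 hnorm_ge0.
have := inner_amgm (hardyZ (Complex (hnorm f)^-1 0) fh) (hardyZ (Complex (hnorm g)^-1 0) gh).
rewrite !hnormZ// innerZl ?innerZr//; last exact: hardyZ.
rewrite !modulusM modulus_conj !modulus_real !ger0_norm ?invr_ge0 ?hnorm_ge0// !mulVf//.
rewrite mulrA -invfM ler_pdivrMl ?mulr_gt0// => /le_trans; apply.
by rewrite expr1n; have := mulr_gt0 fp gp; lra.
Qed.

Lemma hnormD_le f g : hardy f -> hardy g -> hnorm (f + g) <= hnorm f + hnorm g.
Proof.
move=> fh gh; rewrite -ler_sqr ?nnegrE ?addr_ge0 ?hnorm_ge0// sqr_hnormD//.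
have := cauchy_schwarz fh gh; have := Re_le_modulus (inner f g).
have := ler_norm (complex.Re (inner f g)); nra.
Qed.

(** The limit is built from the limits of the coefficients. The rate [e] is explicit because the
    same rate is returned for the distance to the limit. *)
Lemma hardy_complete (s : nat -> polydisc R n -> C) (e : nat -> R) :
  (forall N, hardy (s N)) -> (forall N, 0 <= e N) ->
  (forall d, 0 < d -> exists N, e N <= d) ->
  (forall N m, (N <= m)%N -> hnorm (s m - s N) <= e N) ->
  exists2 f, hardy f & forall N, hnorm (f - s N) <= e N.
Proof.
move=> sh e0 elim sC.
have /all_sig[c hc] k : {l : C | forall d, 0 < d -> exists N, forall m, (N <= m)%N ->
    modulus (taylor (s m) k - l) <= d}.
  apply: cid; apply: complex_cauchy => d /elim[N eN]; exists N => m /sC le.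
  apply: le_trans eN; apply: le_trans le.
  by have := taylor_le_hnorm k (hardyB (sh m) (sh N)); rewrite taylorB.
have cS N : sqsum_le (fun k => c k - taylor (s N) k) (e N ^+ 2).
  move=> A; apply/ler_addgt0Pr => d d0.
  (* On the finite set [A], an index [m] beyond [N] is found with an error [d / (#|A| + 1)] per
     coefficient, which sums to at most [d]. *)
  have [m [Nm hm]] : exists m, (N <= m)%N /\ forall k, k \in A ->
      modulus (c k - taylor (s N) k) ^+ 2 <=
      modulus (taylor (s m) k - taylor (s N) k) ^+ 2 + d / (#|` A|%:R + 1).
    have d1 : 0 < d / (#|` A|%:R + 1) by rewrite divr_gt0// ltr_wpDl.
    have ex k : exists M, forall m, (M <= m)%N -> modulus (c k - taylor (s N) k) ^+ 2 <=
        modulus (taylor (s m) k - taylor (s N) k) ^+ 2 + d / (#|` A|%:R + 1).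
      set x := modulus (c k - _); have x0 : 0 <= x by exact: modulus_ge0.
      (* Chosen so that [x - z <= y] implies [x ^+ 2 - z ^+ 2 <= y * (2 * x + 1)] when [z < x]; the
         other case is trivial. *)
      pose y := d / (#|` A|%:R + 1) / (2 * x + 1).
      have y0 : 0 < y by rewrite divr_gt0// ltr_wpDl// mulr_ge0.
      have [M hM] := hc k y y0; exists M => m /hM le.
      set z := modulus (taylor (s m) k - _).
      have xz : x - z <= y.
        apply: le_trans (ler_norm _) _; apply: le_trans (modulus_dist _ _) _.
        by rewrite opprB addrA subrK modulusB.
      have z0 : 0 <= z by exact: modulus_ge0.
      have : y * (2 * x + 1) = d / (#|` A|%:R + 1) by rewrite /y mulfVK// gt_eqF// ltr_wpDl// mulr_ge0.
      move=> yE; rewrite -yE; have [xz'|zx] := leP x z; last by nra.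
      by apply: (@le_trans _ _ (z ^+ 2)); [rewrite ler_sqr|rewrite lerDl mulr_ge0 ?(ltW y0)// addr_ge0// mulr_ge0].
    have /all_sig[M hM] k := cid (ex k).
    exists (maxn N (\max_(k <- A) M k)); split; first exact: leq_maxl.
    move=> k kA; apply: hM; apply: leq_trans (leq_maxr _ _).
    exact: (leq_bigmax_seq k kA isT).
  apply: (@le_trans _ _ (\sum_(k <- A) (modulus (taylor (s m) k - taylor (s N) k) ^+ 2 + d / (#|` A|%:R + 1)))).
    by rewrite !big_seq; apply: ler_sum => k /hm.
  rewrite big_split/= lerD//.
    apply: (@le_trans _ _ (hnorm (s m - s N) ^+ 2)); last first.
      by rewrite ler_sqr ?nnegrE ?hnorm_ge0// sC.
    have := hassum_real_le A (fun k => sqr_ge0 _) (hassum_taylor_hnorm (hardyB (sh m) (sh N))).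
    by rewrite taylorB.
  rewrite big_const_seq iter_addr addr0 count_predT -[leLHS]mulr_natr.
  have A0 : 0 < #|` A|%:R + 1 :> R by rewrite ltr_wpDl.
  by rewrite mulrAC ler_pdivrMr// ler_pM2l// lerDl.
(* What is known to be square summable is the difference [c - taylor (s N)], so the limit is taken
   as [s 0] plus the function with coefficients [c - taylor (s 0)]. *)
have [g gh gc] := sqsum_series (cS 0%N).
have fh : hardy (s 0%N + g) by exact: hardyD.
have fc : taylor (s 0%N + g) = c.
  by rewrite taylorD// (taylor_series gc); apply/funext => k; rewrite addrC subrK.
exists (s 0%N + g) => // N.
rewrite -ler_sqr ?nnegrE ?hnorm_ge0//.
apply/(hnorm_sqsum _ (hardyB fh (sh N)) (series_taylor (hardyB fh (sh N)))); first exact: sqr_ge0.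
by rewrite taylorB// fc.
Qed.

Section Projection.
Variables (S : set (polydisc R n -> C)) (hS : submodule S).

Lemma sub_hardy f : S f -> hardy f.
Proof. exact: submodule_hardy. Qed.

Lemma subD f g : S f -> S g -> S (f + g).
Proof. by move=> fS gS; rewrite -[f]scale1r; exact: submodule_lin. Qed.

Lemma subZ a f : S f -> S (a *: f).
Proof. by move=> fS; rewrite -[_ *: _]addr0; apply: submodule_lin => //; exact: submodule0. Qed.

Lemma subB f g : S f -> S g -> S (f - g).
Proof. by move=> fS gS; apply: subD => //; rewrite -scaleN1r; exact: subZ. Qed.

(** The parallelogram law makes a minimising sequence for the distance Cauchy, closedness keeps its
    limit in [S], and a variation in the direction of [u] gives orthogonality. *)
Lemma projection_exists f : hardy f ->
  exists p, S p /\ forall s, S s -> inner (f - p) s = 0.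
Proof.
move=> fh.
pose E := [set hnorm (f - s) ^+ 2 | s in S].
have E0 : lbound E 0 by move=> _ [s _ <-]; exact: sqr_ge0.
have infE : has_inf E.
  by split; [exists (hnorm (f - 0) ^+ 2); exists 0 => //; exact: submodule0|exists 0].
pose d := inf E.
have d0 : 0 <= d by apply: lb_le_inf => //; exact: infE.1.
have dle s : S s -> d <= hnorm (f - s) ^+ 2 by move=> sS; apply: ge_inf; [exact: infE.2|exists s].
(* Squared distances within [x N ^+ 2] of the infimum give the Cauchy rate [2 * x N]. *)
pose x N : R := N.+1%:R^-1.
have x0 N : 0 < x N by rewrite invr_gt0 ltr0n.
have ex N : exists s, S s /\ hnorm (f - s) ^+ 2 < d + x N ^+ 2.
  have xx : 0 < x N ^+ 2 by rewrite exprn_gt0.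
  by have [_ [s sS <-] lt] := inf_adherent xx infE; exists s.
have /all_sig[s hs] N := cid (ex N).
have sh N : hardy (s N) by apply: sub_hardy; case: (hs N).
have fsh N : hardy (f - s N) by exact: hardyB.
have par (u v : polydisc R n -> C) : hardy u -> hardy v ->
    hnorm (u - v) ^+ 2 = 2 * hnorm u ^+ 2 + 2 * hnorm v ^+ 2 - hnorm (u + v) ^+ 2.
  by move=> uh vh; rewrite sqr_hnormB// sqr_hnormD//; ring.
have sC N m : (N <= m)%N -> hnorm (s m - s N) <= 2 * x N.
  move=> Nm; rewrite -ler_sqr ?nnegrE ?hnorm_ge0 ?mulr_ge0 ?(ltW (x0 N))//.
  have -> : s m - s N = (f - s N) - (f - s m) by rewrite opprB [RHS]addrC addrA subrK.
  rewrite par//.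
  have -> : (f - s N) + (f - s m) = (Complex 2 0 : C) *: (f - (Complex 2^-1 0 : C) *: (s N + s m)).
    rewrite scalerBr scalerA.
    have -> : Complex 2 0 * Complex 2^-1 0 = 1 :> C.
      by apply: complex_eq; rewrite ?ReM ?ImM /=; field.
    have -> : Complex 2 0 = 1 + 1 :> C by apply: complex_eq; rewrite ?ReD ?ImD /=; ring.
    by rewrite scalerDl !scale1r opprD addrACA.
  have mS : S ((Complex 2^-1 0 : C) *: (s N + s m)).
    by apply: subZ; apply: subD; [case: (hs N)|case: (hs m)].
  rewrite hnormZ; last by apply: hardyB => //; exact: sub_hardy.
  rewrite modulus_real ger0_norm// !exprMn.
  have := dle _ mS; have := (hs N).2; have := (hs m).2.
  have : x m ^+ 2 <= x N ^+ 2.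
    by rewrite ler_sqr ?nnegrE ?(ltW (x0 _))// lef_pV2 ?posrE ?ltr0n// ler_nat.
  nra.
have small r : 0 < r -> exists N, x N <= r.
  move=> r0; have := @cvg_harmonic R; move/cvgrPdist_le => /(_ r r0)[N _ hN].
  by exists N; have := hN N (leqnn N); rewrite /= sub0r normrN ger0_norm// invr_ge0.
have [||p ph hp] := hardy_complete sh _ _ sC.
- by move=> N; rewrite mulr_ge0// ltW.
- by move=> r r0; have [N xN] := small _ (divr_gt0 r0 (ltr0Sn R 1)); exists N; rewrite -ler_pdivlMl// mulrC.
have pS : S p.
  apply: submodule_closed hS _ ph _ => r r0.
  have [N xN] := small (r / 3) (divr_gt0 r0 (ltr0Sn R 2)).
  exists (s N); first by case: (hs N).
  by apply: le_lt_trans (hp N) _; have := x0 N; lra.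
have pmin : hnorm (f - p) ^+ 2 <= d.
  have -> : d = Num.sqrt d ^+ 2 by rewrite sqr_sqrtr.
  rewrite ler_sqr ?nnegrE ?hnorm_ge0 ?sqrtr_ge0//.
  apply/ler_addgt0Pr => r r0; have [N xN] := small (r / 3) (divr_gt0 r0 (ltr0Sn R 2)).
  have -> : f - p = (f - s N) - (p - s N) by rewrite opprB addrA subrK.
  have -> : (f - s N) - (p - s N) = (f - s N) + (s N - p) by rewrite opprB.
  apply: le_trans (hnormD_le (fsh N) (hardyB (sh N) ph)) _.
  have : hnorm (s N - p) <= 2 * x N by rewrite hnormB//; exact: hp.
  have : hnorm (f - s N) <= Num.sqrt d + x N.
    rewrite -ler_sqr ?nnegrE ?hnorm_ge0 ?addr_ge0 ?sqrtr_ge0 ?(ltW (x0 N))//.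
    apply: le_trans (ltW (hs N).2) _; rewrite -{1}(sqr_sqrtr d0).
    have := sqrtr_ge0 d; have := x0 N; nra.
  lra.
exists p; split => // u uS; have uh := sub_hardy uS.
have gh : hardy (f - p) by exact: hardyB.
set w := inner (f - p) u.
apply/eqP; rewrite -modulus_eq0; apply/negPn/negP => w0.
have wp : 0 < modulus w by rewrite lt_def w0 modulus_ge0.
(* Moving [p] by [a *: u] with [a = e * w] changes the squared distance by [e |w|^2 (e |u|^2 - 2)],
   which is negative since [e |u|^2 < 1]. *)
pose e : R := (hnorm u ^+ 2 + 1)^-1.
have e0 : 0 < e by rewrite invr_gt0 ltr_wpDl ?sqr_ge0.
have eu : e * hnorm u ^+ 2 < 1.
  by rewrite mulrC ltr_pdivrMr ?mul1r ?ltrDl// ltr_wpDl ?sqr_ge0.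
pose a : C := Complex e 0 * w.
have := dle _ (subD pS (subZ a uS)).
have -> : f - (p + a *: u) = (f - p) - a *: u by rewrite opprD addrA.
rewrite sqr_hnormB//; last exact: hardyZ.
rewrite hnormZ// innerZr// -/w.
have -> : complex.Re (conjc a * w) = e * modulus w ^+ 2.
  rewrite /a conjc_mul -mulrA [conjc w * w]mulrC mulr_conj.
  by rewrite !ReM /=; ring.
rewrite /a modulusM modulus_real gtr0_norm// !exprMn.
have := pmin; have : 0 < e * modulus w ^+ 2 by rewrite mulr_gt0// exprn_gt0.
set ew := e * modulus w ^+ 2.
have -> : e ^+ 2 * modulus w ^+ 2 * hnorm u ^+ 2 = ew * (e * hnorm u ^+ 2) by rewrite /ew; ring.
nra.
Qed.

Lemma orth_projP f : hardy f ->
  S (orth_proj S f) /\ forall s, S s -> inner (f - orth_proj S f) s = 0.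
Proof. by move=> /projection_exists ex; exact: (xgetPex 0 ex). Qed.

Lemma inner_sub_eq g g' : S g -> S g' -> (forall s, S s -> inner s g = inner s g') -> g = g'.
Proof.
move=> gS g'S gg'; have gh := sub_hardy gS; have g'h := sub_hardy g'S.
have dS := subB gS g'S; have dh := hardyB gh g'h.
apply/eqP; rewrite -subr_eq0; apply/eqP; apply: hnorm_eq0 => //.
apply/eqP; rewrite -sqrf_eq0; apply/eqP.
have := inner_self dh; rewrite innerBr// gg'// subrr.
by case.
Qed.

Lemma orth_proj_inner f s : hardy f -> S s -> inner (orth_proj S f) s = inner f s.
Proof.
move=> fh sS; have [pS ps] := orth_projP fh; have := ps s sS.
by rewrite (innerBl fh (sub_hardy pS) (sub_hardy sS)) => /eqP; rewrite subr_eq0 => /eqP ->.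
Qed.

Lemma orth_proj_id f : S f -> orth_proj S f = f.
Proof.
move=> fS; have fh := sub_hardy fS; have [pS ps] := orth_projP fh.
apply: inner_sub_eq => // s sS; have sh := sub_hardy sS; have ph := sub_hardy pS.
by rewrite (inner_conj ph sh) (inner_conj fh sh) orth_proj_inner.
Qed.

End Projection.

(** [adjoint] chooses by [xget]; closure of [H] under differences makes the candidate unique,
    because the difference of two candidates is orthogonal to itself. *)
Lemma adjointE (H : set (polydisc R n -> C)) T h g :
  H `<=` @hardy R n -> (forall u v, H u -> H v -> H (u - v)) -> H g ->
  (forall f, H f -> inner (T f) h = inner f g) -> adjoint H T h = g.
Proof.
move=> Hh HB gH Tg; rewrite /adjoint; apply: xget_subset1; first by split.
move=> u v [uH Tu] [vH Tv]; apply/eqP; rewrite -subr_eq0; apply/eqP.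
have dH := HB _ _ uH vH; have dh := Hh _ dH; apply: hnorm_eq0 => //.
apply/eqP; rewrite -sqrf_eq0; apply/eqP.
have := inner_self dh; rewrite (innerBr dh (Hh _ uH) (Hh _ vH)) -(Tu _ dH) -(Tv _ dH) subrr.
by case.
Qed.

End Hilbert.

(** * Multiplication, evaluation and backward shift on coefficients *)

Section Operators.
Context {R : realType} {n : nat}.
Local Notation C := (Cplx R).
Local Notation mi := {ffun 'I_n -> nat}.
Implicit Types (f g : polydisc R n -> C) (c : mi -> C) (j : 'I_n) (k : mi).

Definition incr j k : mi := [ffun i => (k i + (i == j))%N].
Definition decr j k : mi := [ffun i => (k i - (i == j))%N].

Lemma incrK j : cancel (incr j) (decr j).
Proof. by move=> k; apply/ffunP => i; rewrite !ffunE addnK. Qed.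

Lemma decrK j k : k j != 0%N -> incr j (decr j k) = k.
Proof.
move=> k0; apply/ffunP => i; rewrite !ffunE; case: eqP => [->|_] /=.
  by rewrite subnK// lt0n.
by rewrite subn0 addn0.
Qed.

Lemma incr_neq0 j k : incr j k j != 0%N.
Proof. by rewrite ffunE eqxx addn1. Qed.

Lemma not_incr j k : incr j (decr j k) <> k -> k j = 0%N.
Proof. by move=> h; apply/eqP/negPn/negP => /decrK. Qed.

Lemma mon_incr (w : 'I_n -> C) j k : mon w (incr j k) = w j * mon w k.
Proof.
rewrite /mon (eq_bigr (fun i => w i ^+ k i * w i ^+ (i == j))) => [|i _]; last by rewrite ffunE exprD.
rewrite big_split mulrC; congr (_ * _).
rewrite (bigD1 j)//= eqxx expr1 big1 ?mulr1// => i /negbTE ->.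
by rewrite expr0.
Qed.

Definition shift_coef j c k : C := if k j == 0%N then 0 else c (decr j k).

Lemma series_mulz j f c : series f c -> series (mulz j f) (shift_coef j c).
Proof.
move=> fc z; apply: (@hassum_image _ _ _ (incr j) (decr j)) => [|k /not_incr k0|].
- exact: incrK.
- by rewrite /shift_coef k0 eqxx mul0r.
apply: eq_hassum (hassumZ (coord j z) (fc z)) => k.
by rewrite /= /shift_coef (negbTE (incr_neq0 j k)) incrK mon_incr mulrCA.
Qed.

Lemma sqsum_shift j c B : sqsum_le c B -> sqsum_le (shift_coef j c) B.
Proof.
move=> cB A; apply: le_trans (cB [fset decr j k | k in [fset k in A | k j != 0%N]]%fset).
rewrite big_imfset /=; last first.
  by move=> k l; rewrite !inE => /andP[_ /decrK kE] /andP[_ /decrK lE] E; rewrite -kE E lE.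
rewrite (big_fsetID _ (fun k : mi => k j != 0%N)) /=.
have -> : \sum_(k <- [fset k in A | ~~ (k j != 0)%N]%fset) modulus (shift_coef j c k) ^+ 2 = 0.
  rewrite big_seq big1// => k; rewrite !inE negbK => /andP[_ k0].
  by rewrite /shift_coef k0 modulus0 expr0n.
rewrite addr0 !big_seq; apply: ler_sum => k; rewrite !inE => /andP[_ k0].
by rewrite /shift_coef (negbTE k0).
Qed.

Lemma hardy_mulz j f : hardy f -> hardy (mulz j f).
Proof.
move=> /hardyP[c [B [fc cB]]]; apply/hardyP; exists (shift_coef j c), B.
by split; [exact: series_mulz|exact: sqsum_shift].
Qed.

Lemma taylor_mulz j f : hardy f -> taylor (mulz j f) = shift_coef j (taylor f).
Proof. by move=> fh; apply: taylor_series; apply: series_mulz; exact: series_taylor. Qed.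

Definition ev_coef j c k : C := if k j == 0%N then c k else 0.

Lemma series_ev j f c : series f c -> series (ev j f) (ev_coef j c).
Proof.
move=> fc z; apply: eq_hassum (fc (zero_coord j z)) => k; rewrite /ev_coef /mon.
have E i : coord i (zero_coord j z) = if i == j then 0 else coord i z.
  by rewrite /coord /= mxE.
under eq_bigr do rewrite E.
case: eqP => [k0|/eqP k0].
  by congr (_ * _); apply: eq_bigr => i _; case: eqP => // ->; rewrite k0 !expr0.
rewrite mul0r; apply/eqP; rewrite mulf_eq0; apply/orP; right.
rewrite prodf_seq_eq0; apply/hasP; exists j; first exact: mem_index_enum.
by rewrite eqxx expr0n (negbTE k0) /=.
Qed.

Lemma hardy_ev j f : hardy f -> hardy (ev j f).
Proof.
move=> /hardyP[c [B [fc cB]]]; apply/hardyP; exists (ev_coef j c), B.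
split; first exact: series_ev.
move=> A; apply: le_trans (cB A); apply: ler_sum => k _.
by rewrite /ev_coef; case: ifP => // _; rewrite modulus0 expr0n sqr_ge0.
Qed.

Lemma taylor_ev j f : hardy f -> taylor (ev j f) = ev_coef j (taylor f).
Proof. by move=> fh; apply: taylor_series; apply: series_ev; exact: series_taylor. Qed.

Lemma backshift_exists j f : hardy f ->
  exists g, hardy g /\ taylor g = (fun k => taylor f (incr j k)).
Proof.
move=> /hardyP[c [B [fc cB]]]; rewrite (taylor_series fc).
have [|g gh gc] := @sqsum_series R n (fun k => c (incr j k)) B.
  move=> A; have := cB [fset incr j k | k in A]%fset.
  by rewrite big_imfset //= => x y _ _; exact: (can_inj (@incrK j)).
by exists g; split => //; exact: taylor_series.
Qed.

(** Given by its coefficients, because the quotient [(f - ev j f) / z_j] says nothing at points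
    where [z_j = 0]. *)
Definition backshift j f : polydisc R n -> C :=
  xget 0 [set g | hardy g /\ taylor g = (fun k => taylor f (incr j k))].

Lemma hardy_backshift j f : hardy f -> hardy (backshift j f).
Proof. by move=> /(backshift_exists j) ex; have [] := xgetPex 0 ex. Qed.

Lemma taylor_backshift j f : hardy f -> taylor (backshift j f) = fun k => taylor f (incr j k).
Proof. by move=> /(backshift_exists j) ex; have [] := xgetPex 0 ex. Qed.

Lemma inner_mulz_backshift j f g : hardy f -> hardy g ->
  inner (mulz j f) g = inner f (backshift j g).
Proof.
move=> fh gh; apply: hassum_unique (hassum_inner (hardy_mulz j fh) gh) _.
apply: (@hassum_image _ _ _ (incr j) (decr j)) => [|k /not_incr k0|].
- exact: incrK.
- by rewrite taylor_mulz// /shift_coef k0 eqxx mul0r.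
apply: eq_hassum (hassum_inner fh (hardy_backshift j gh)) => k.
by rewrite /= taylor_mulz// taylor_backshift// /shift_coef (negbTE (incr_neq0 j k)) incrK.
Qed.

Lemma backshift_mulz j f : hardy f -> backshift j (mulz j f) = f.
Proof.
move=> fh; apply: hardy_taylor_eq => //; first by apply: hardy_backshift; exact: hardy_mulz.
move=> k; rewrite taylor_backshift; last exact: hardy_mulz.
by rewrite taylor_mulz// /shift_coef (negbTE (incr_neq0 j k)) incrK.
Qed.

Lemma inner_mulz j f g : hardy f -> hardy g -> inner (mulz j f) (mulz j g) = inner f g.
Proof.
by move=> fh gh; rewrite inner_mulz_backshift ?backshift_mulz//; exact: hardy_mulz.
Qed.

Lemma inner_ev j f g : hardy f -> hardy g -> inner (ev j f) g = inner f (ev j g).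
Proof.
move=> fh gh; apply: hassum_unique (hassum_inner (hardy_ev j fh) gh) _.
apply: eq_hassum (hassum_inner fh (hardy_ev j gh)) => k.
rewrite !taylor_ev// /ev_coef; case: eqP => // _.
by rewrite conjc0 mulr0 mul0r.
Qed.

Lemma ev_idem j f : ev j (ev j f) = ev j f.
Proof.
apply/funext => z; rewrite /ev; congr f; apply: polydisc_eq => i.
by rewrite /coord /= !mxE; case: eqP.
Qed.

Lemma ev_mulz j f : ev j (mulz j f) = 0.
Proof. by apply/funext => z; rewrite /ev /mulz /coord /= mxE eqxx mul0r. Qed.

Lemma evD j f g : ev j (f + g) = ev j f + ev j g. Proof. by []. Qed.

Lemma backshiftD j f g : hardy f -> hardy g ->
  backshift j (f + g) = backshift j f + backshift j g.
Proof.
move=> fh gh; have bf := hardy_backshift j fh; have bg := hardy_backshift j gh.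
apply: hardy_taylor_eq; [by apply: hardy_backshift; exact: hardyD|exact: hardyD|].
by move=> k; rewrite taylorD// !taylor_backshift ?taylorD//; exact: hardyD.
Qed.

Lemma backshift_ev j f : hardy f -> backshift j (ev j f) = 0.
Proof.
move=> fh; have eh := hardy_ev j fh.
apply: hardy_taylor_eq; [exact: hardy_backshift|exact: hardy0|move=> k].
by rewrite taylor_backshift// taylor_ev// taylor0 /ev_coef (negbTE (incr_neq0 j k)).
Qed.

Lemma ev_backshift j f : hardy f -> f = ev j f + mulz j (backshift j f).
Proof.
move=> fh; have eh := hardy_ev j fh; have bh := hardy_backshift j fh; have mh := hardy_mulz j bh.
apply: hardy_taylor_eq => // [|k]; first exact: hardyD.
rewrite taylorD// taylor_ev// taylor_mulz// taylor_backshift// /ev_coef /shift_coef.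
by case: eqP => [_|/eqP k0]; rewrite ?addr0// add0r decrK.
Qed.

(** [ev j] is a self-adjoint idempotent, hence an orthogonal projection: this is Pythagoras. *)
Lemma sqr_hnorm_ev j f : hardy f -> hnorm (f - ev j f) ^+ 2 = hnorm f ^+ 2 - hnorm (ev j f) ^+ 2.
Proof.
move=> fh; have eh := hardy_ev j fh; rewrite sqr_hnormB//.
have : inner f (ev j f) = Complex (hnorm (ev j f) ^+ 2) 0.
  by rewrite -[in LHS](ev_idem j f) -inner_ev// inner_self.
by move=> ->; rewrite /=; ring.
Qed.

End Operators.

(** * Multipliers *)

Section Polynomials.
Context {R : realType} {n : nat}.
Local Notation C := (Cplx R).
Local Notation mi := {ffun 'I_n -> nat}.
Implicit Types (f g : polydisc R n -> C) (c : mi -> C) (j : 'I_n) (k : mi).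

Lemma multi_index_ind (P : mi -> Prop) :
  P [ffun=> 0%N] -> (forall j k, P k -> P (incr j k)) -> forall k, P k.
Proof.
move=> P0 PS k; move: {2}(mdeg k) (leqnn (mdeg k)) => m; elim: m k => [|m IH] k km.
  suff -> : k = [ffun=> 0%N] by [].
  apply/ffunP => j; rewrite ffunE; apply/eqP; rewrite -leqn0.
  by apply: leq_trans km; rewrite /mdeg (bigD1 j)//= leq_addr.
have [[j kj]|/forallNP k0] := pselect (exists j, k j != 0%N).
  rewrite -(decrK kj); apply: PS; apply: IH; rewrite -ltnS; apply: leq_trans km.
  rewrite /mdeg (bigD1 j)//= [X in (_ < X)%N](bigD1 j)//= !ffunE eqxx.
  rewrite -addSn leq_add//; first by rewrite subn1 prednK// lt0n.
  by apply: leq_sum => i /negbTE ij; rewrite ffunE ij subn0.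
suff -> : k = [ffun=> 0%N] by [].
by apply/ffunP => j; rewrite ffunE; have := k0 j; case: eqP.
Qed.

Definition monf k : polydisc R n -> C := fun z => mon (fun j => coord j z) k.

Lemma monf0 : monf [ffun=> 0%N] = fun=> 1.
Proof. by apply/funext => z; rewrite /monf /mon big1// => j _; rewrite ffunE expr0. Qed.

Lemma monf_incr j k : monf (incr j k) = mulz j (monf k).
Proof. by apply/funext => z; rewrite /monf mon_incr. Qed.

Definition delta_coef k l : C := (l == k)%:R.

Lemma series_monf k : series (monf k) (delta_coef k).
Proof.
move=> z; pose F l : C := delta_coef k l * mon (fun j => coord j z) l.
have -> : monf k z = \sum_(l <- [fset k]%fset) F l.
  by rewrite big_seq_fset1 /F /delta_coef eqxx mul1r.
apply: hassum_supp => l; rewrite in_fset1 /F /delta_coef => /negbTE ->.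
by rewrite mul0r.
Qed.

Lemma hardy_monf k : hardy (monf k).
Proof.
apply/hardyP; exists (delta_coef k), 1; split; first exact: series_monf.
move=> A; apply: (@le_trans _ _ (\sum_(l <- [fset k]%fset) modulus (delta_coef k l) ^+ 2)).
  apply: le_trans (ler_sum_fset (fun l => sqr_ge0 _) (fsubsetUl A [fset k]%fset)) _.
  rewrite -(big_fset_incl _ (fsubsetUr A [fset k]%fset)) //= => l _.
  by rewrite in_fset1 /delta_coef => /negbTE ->; rewrite modulus0 expr0n.
by rewrite big_seq_fset1 /delta_coef eqxx modulus1 expr1n.
Qed.

Lemma taylor_monf k : taylor (monf k) = delta_coef k.
Proof. exact: taylor_series (series_monf k). Qed.

Lemma inner_monf f k : hardy f -> inner f (monf k) = taylor f k.
Proof.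
move=> fh; apply: hassum_unique (hassum_inner fh (hardy_monf k)) _.
pose F l : C := taylor f l * conjc (taylor (monf k) l).
have -> : taylor f k = \sum_(l <- [fset k]%fset) F l.
  by rewrite big_seq_fset1 /F taylor_monf /delta_coef eqxx conjc1 mulr1.
apply: hassum_supp => l; rewrite in_fset1 /F taylor_monf /delta_coef => /negbTE ->.
by rewrite conjc0 mulr0.
Qed.

Definition polyf (A : {fset mi}) c : polydisc R n -> C := \sum_(k <- A) c k *: monf k.

Lemma hardy_sum (I : Type) (r : seq I) (F : I -> polydisc R n -> C) :
  (forall i, hardy (F i)) -> hardy (\sum_(i <- r) F i).
Proof.
move=> Fh; elim: r => [|i r IH]; first by rewrite big_nil; exact: hardy0.
by rewrite big_cons; exact: hardyD.
Qed.

Lemma hardy_polyf A c : hardy (polyf A c).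
Proof. by apply: hardy_sum => k; apply: hardyZ; exact: hardy_monf. Qed.

Lemma taylor_sum (I : Type) (r : seq I) (F : I -> polydisc R n -> C) k :
  (forall i, hardy (F i)) -> taylor (\sum_(i <- r) F i) k = \sum_(i <- r) taylor (F i) k.
Proof.
move=> Fh; elim: r => [|i r IH]; first by rewrite !big_nil taylor0.
by rewrite !big_cons taylorD ?IH//; exact: hardy_sum.
Qed.

Lemma taylor_polyf A c k : taylor (polyf A c) k = if k \in A then c k else 0.
Proof.
rewrite taylor_sum; last by move=> l; apply: hardyZ; exact: hardy_monf.
have E l : taylor (c l *: monf l) k = c l * (k == l)%:R.
  by rewrite taylorZ ?taylor_monf//; exact: hardy_monf.
under eq_bigr do rewrite E.
case: ifPn => kA.
  rewrite (big_fsetD1 k)//= eqxx mulr1 big_seq big1 ?addr0// => l.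
  by rewrite in_fsetD1 eq_sym => /andP[/negbTE -> _]; rewrite mulr0.
rewrite big_seq big1// => l lA; case: eqP => [kl|_]; last by rewrite mulr0.
by rewrite kl lA in kA.
Qed.

Lemma sqr_hnorm_polyf A c : hnorm (polyf A c) ^+ 2 = \sum_(k <- A) modulus (c k) ^+ 2.
Proof.
suff : Complex (hnorm (polyf A c) ^+ 2) 0 = Complex (\sum_(k <- A) modulus (c k) ^+ 2) 0 :> C by case.
apply: hassum_unique (hassum_taylor_hnorm (hardy_polyf A c)) _.
rewrite -real_complex_sum.
pose F k : C := Complex (modulus (taylor (polyf A c) k) ^+ 2) 0.
have -> : \sum_(k <- A) (Complex (modulus (c k) ^+ 2) 0 : C) = \sum_(k <- A) F k.
  by rewrite !big_seq; apply: eq_bigr => k kA; rewrite /F taylor_polyf kA.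
apply: hassum_supp => k kA; rewrite /F taylor_polyf (negbTE kA).
by rewrite modulus0 expr0n.
Qed.

Definition trunc f N := polyf (box N) (taylor f).

Lemma taylor_tail f N k : hardy f ->
  taylor (f - trunc f N) k = if k \in box N then 0 else taylor f k.
Proof.
move=> fh; rewrite taylorB ?taylor_polyf//; last exact: hardy_polyf.
by case: ifP => _; rewrite ?subrr ?subr0.
Qed.

Lemma sqr_hnorm_tail f N : hardy f ->
  hnorm (f - trunc f N) ^+ 2 = hnorm f ^+ 2 - \sum_(k <- box N) modulus (taylor f k) ^+ 2.
Proof.
move=> fh; set X := \sum_(k <- _) _.
suff : Complex (hnorm (f - trunc f N) ^+ 2) 0 = Complex (hnorm f ^+ 2) 0 - Complex X 0 :> C.
  by rewrite -[RHS]/(Complex (_ - _) (0 - 0)) => -[].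
apply: hassum_unique (hassum_taylor_hnorm (hardyB fh (hardy_polyf _ _))) _.
pose F k : C := if k \in box N then Complex (modulus (taylor f k) ^+ 2) 0 else 0.
have -> : Complex X 0 = \sum_(k <- box N) F k :> C.
  by rewrite /X -real_complex_sum !big_seq; apply: eq_bigr => k kN; rewrite /F kN.
have hF : hassum F (\sum_(k <- box N) F k) by apply: hassum_supp => k /negbTE kN; rewrite /F kN.
apply: eq_hassum (hassumB (hassum_taylor_hnorm fh) hF) => k.
rewrite /F taylor_tail//; case: ifP => _; last by rewrite subr0.
by rewrite subrr modulus0 expr0n.
Qed.

Lemma tail_mono f N m : hardy f -> (N <= m)%N ->
  hnorm (f - trunc f m) <= hnorm (f - trunc f N).
Proof.
move=> fh Nm; rewrite -ler_sqr ?nnegrE ?hnorm_ge0// !sqr_hnorm_tail// lerD2l lerN2.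
by apply: ler_sum_fset; [move=> k; exact: sqr_ge0|exact: box_mono].
Qed.

Lemma tail_small f e : hardy f -> 0 < e -> exists N, hnorm (f - trunc f N) <= e.
Proof.
move=> fh e0; have e2 : 0 < e ^+ 2 by rewrite exprn_gt0.
have [N0 h] := hassum_box (hassum_taylor_hnorm fh) e2; exists N0.
rewrite -ler_sqr ?nnegrE ?hnorm_ge0 ?(ltW e0)// sqr_hnorm_tail//.
have := h N0 (leqnn _); rewrite real_complex_sum -[X in modulus X]/(Complex (_ - _) (0 - 0)) subr0.
by rewrite modulus_real ltr_norml; lra.
Qed.

Lemma hnorm_trunc_le f N : hardy f -> hnorm (trunc f N) <= hnorm f.
Proof.
move=> fh; rewrite -ler_sqr ?nnegrE ?hnorm_ge0// sqr_hnorm_polyf.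
exact: hassum_real_le (fun k => sqr_ge0 _) (hassum_taylor_hnorm fh).
Qed.

(** The bound of [sqsum_abssum] is not homogeneous, so it is applied to [f] divided by its norm. *)
Lemma point_eval (z : polydisc R n) : exists2 K : R, 0 <= K &
  forall f, hardy f -> modulus (f z) <= K * hnorm f.
Proof.
have [q [q0 q1 zq]] := max_coord z.
have q01 : 0 <= q < 1 by rewrite q0.
have q201 : 0 <= q ^+ 2 < 1 by rewrite exprn_ge0// expr_lt1.
pose K := (1 + (1 - q ^+ 2)^-1 ^+ n) / 2.
have K0 : 0 <= K.
  by rewrite divr_ge0// addr_ge0// exprn_ge0// invr_ge0 subr_ge0 ltW// (andP q201).2.
exists K => // f fh.
have [f0|f0] := eqVneq (hnorm f) 0.
  by rewrite (hnorm_eq0 fh f0) modulus0 mulr_ge0 ?hnorm_ge0.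
have fp : 0 < hnorm f by rewrite lt_def f0 hnorm_ge0.
pose g := (Complex (hnorm f)^-1 0 : C) *: f.
have gh : hardy g by exact: hardyZ.
have g1 : hnorm g = 1 by rewrite hnormZ// modulus_real ger0_norm ?invr_ge0 ?hnorm_ge0// mulVf.
have gB : sqsum_le (taylor g) 1.
  by apply/(hnorm_sqsum _ gh (series_taylor gh)); rewrite ?g1 ?expr1n.
have : modulus (g z) <= K.
  apply: hassum_modulus_le (series_taylor gh z) _.
  apply: le_abssum (sqsum_abssum q01 gB) => k.
  rewrite !modulusM ler_wpM2l ?modulus_ge0// modulusX modulus_real ger0_norm//.
  exact: modulus_mon_le.
rewrite [g z]/(Complex (hnorm f)^-1 0 * f z) modulusM modulus_real ger0_norm ?invr_ge0 ?hnorm_ge0//.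
by rewrite ler_pdivrMl// mulrC.
Qed.

Definition mulf (u f : polydisc R n -> C) : polydisc R n -> C := fun z => u z * f z.

Lemma mulfD u f g : mulf u (f + g) = mulf u f + mulf u g.
Proof. by apply/funext => z; rewrite /mulf [(f + g) z]/(f z + g z) mulrDr. Qed.

Lemma mulfB u f g : mulf u (f - g) = mulf u f - mulf u g.
Proof. by apply/funext => z; rewrite /mulf [(f - g) z]/(f z - g z) mulrBr. Qed.

Lemma mulfZ u a f : mulf u (a *: f) = a *: mulf u f.
Proof. by apply/funext => z; rewrite /mulf [(a *: f) z]/(a * f z) mulrCA. Qed.

Lemma mulf0 u : mulf u 0 = 0.
Proof. by apply/funext => z; rewrite /mulf mulr0. Qed.

Lemma mulf_sum (I : Type) (r : seq I) u (F : I -> polydisc R n -> C) :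
  mulf u (\sum_(i <- r) F i) = \sum_(i <- r) mulf u (F i).
Proof.
elim: r => [|i r IH]; first by rewrite !big_nil mulf0.
by rewrite !big_cons mulfD IH.
Qed.

Lemma mulf_mulz u j f : mulf u (mulz j f) = mulz j (mulf u f).
Proof. by apply/funext => z; rewrite /mulf /mulz mulrCA. Qed.

Lemma mulf_polyf u A c : mulf u (polyf A c) = \sum_(k <- A) c k *: mulf u (monf k).
Proof. by rewrite mulf_sum; apply: eq_bigr => k _; rewrite mulfZ. Qed.

Lemma hardy_mulf_monf u k : hardy u -> hardy (mulf u (monf k)).
Proof.
move=> uh; elim/multi_index_ind: k => [|j k IH].
  by rewrite monf0; have -> : mulf u (fun=> 1) = u by apply/funext => z; rewrite /mulf mulr1.
by rewrite monf_incr mulf_mulz; exact: hardy_mulz.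
Qed.

Lemma hardy_mulf_polyf u A c : hardy u -> hardy (mulf u (polyf A c)).
Proof.
by move=> uh; rewrite mulf_polyf; apply: hardy_sum => k; apply: hardyZ; exact: hardy_mulf_monf.
Qed.

(** * Extension of multipliers from polynomials by density *)

Section Multiplier.
Variables (u : polydisc R n -> C) (M : R).
Hypotheses (uh : hardy u) (M0 : 0 <= M).
Hypothesis uM : forall A c, hnorm (mulf u (polyf A c)) <= M * hnorm (polyf A c).

Lemma trunc_diff f N m : (N <= m)%N -> exists A c, trunc f m - trunc f N = polyf A c.
Proof.
move=> Nm; exists (box m `\` box N)%fset, (taylor f).
rewrite /trunc /polyf (big_fsetD_sub _ (box_mono Nm)).
by rewrite addrAC subrr add0r.
Qed.

(** The products with the truncations of [f] form a Cauchy sequence in norm. Point evaluations are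
    bounded, so its limit is the pointwise product, which puts [mulf u f] in the Hardy space. *)
Lemma multiplier_extend f : hardy f ->
  hardy (mulf u f) /\ hnorm (mulf u f) <= M * hnorm f.
Proof.
move=> fh; pose s N := mulf u (trunc f N).
pose tl N := hnorm (f - trunc f N).
have th N : hardy (trunc f N) by exact: hardy_polyf.
have sh N : hardy (s N) by exact: hardy_mulf_polyf.
have sC N m : (N <= m)%N -> hnorm (s m - s N) <= M * (2 * tl N).
  move=> Nm; have [A [c E]] := trunc_diff f Nm.
  rewrite /s -mulfB E; apply: le_trans (uM A c) _; rewrite -E ler_wpM2l//.
  have -> : trunc f m - trunc f N = (f - trunc f N) - (f - trunc f m).
    by rewrite opprB [RHS]addrC addrA subrK.
  apply: le_trans (hnormD_le (hardyB fh (th N)) (hardyN (hardyB fh (th m)))) _.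
  rewrite opprB (hnormB (th m) fh).
  by have := tail_mono fh Nm; rewrite /tl; lra.
have elim d : 0 < d -> exists N, M * (2 * tl N) <= d.
  move=> d0; have M1 : 0 < 2 * (M + 1) by rewrite mulr_gt0// ltr_wpDl.
  have [N hN] := tail_small fh (divr_gt0 d0 M1); exists N.
  move: hN; rewrite ler_pdivlMr// -/(tl N) => hN.
  by have : 0 <= tl N by [exact: hnorm_ge0]; nra.
have [|g gh gs] := hardy_complete sh _ elim sC.
  by move=> N; rewrite !mulr_ge0// hnorm_ge0.
have gE : g = mulf u f.
  apply/funext => z; apply/eqP; rewrite -subr_eq0 -modulus_eq0; apply/eqP.
  apply/le_anti; rewrite modulus_ge0 andbT; apply/ler_addgt0Pr => e e0; rewrite add0r.
  have [K K0 hK] := point_eval z.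
  (* Collects two errors: [2 * M] from the distance between [g] and [s N], [modulus (u z)] from the
     tail of [f] at [z]. The final 1 keeps the divisor positive. *)
  pose X := K * (2 * M + modulus (u z)) + 1.
  have X0 : 0 < X by rewrite ltr_wpDl// mulr_ge0// addr_ge0 ?mulr_ge0 ?modulus_ge0.
  have [N hN] := tail_small fh (divr_gt0 e0 X0).
  have t0 : 0 <= tl N by exact: hnorm_ge0.
  have -> : g z - mulf u f z = (g - s N) z - u z * (f - trunc f N) z.
    rewrite /s [(g - _) z]/(g z - u z * trunc f N z) [(f - _) z]/(f z - trunc f N z) /mulf.
    by rewrite mulrBr opprB addrA subrK.
  apply: le_trans (modulusD _ _) _; rewrite modulusN modulusM.
  have a1 := hK _ (hardyB gh (sh N)); have a2 := hK _ (hardyB fh (th N)).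
  have a3 : K * hnorm (g - s N) <= K * (M * (2 * tl N)) by rewrite ler_wpM2l.
  have a4 : modulus (u z) * modulus ((f - trunc f N) z) <= modulus (u z) * (K * tl N).
    by rewrite ler_wpM2l ?modulus_ge0.
  have : tl N * X <= e by rewrite -ler_pdivlMr.
  rewrite /X; lra.
rewrite -gE; split => //; apply/ler_addgt0Pr => e e0.
have [N hN] := elim e e0.
have -> : g = (g - s N) + s N by rewrite subrK.
apply: le_trans (hnormD_le (hardyB gh (sh N)) (sh N)) _.
have := gs N; have := uM (box N) (taylor f); rewrite -/(trunc f N) -/(s N).
have : M * hnorm (trunc f N) <= M * hnorm f by rewrite ler_wpM2l// hnorm_trunc_le.
lra.
Qed.

End Multiplier.

(** The extension with [M = 1] gives one inequality; for the other, [f] is compared with a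
    truncation, where the norm is exact, and the tail is made small. *)
Lemma multiplier_isometry u : hardy u ->
  (forall A c, hnorm (mulf u (polyf A c)) = hnorm (polyf A c)) ->
  forall f, hardy f -> hardy (mulf u f) /\ hnorm (mulf u f) = hnorm f.
Proof.
move=> uh uI f fh.
have uM A c : hnorm (mulf u (polyf A c)) <= 1 * hnorm (polyf A c) by rewrite mul1r uI.
have ext := multiplier_extend uh ler01 uM.
have [ufh ufle] := ext f fh; split => //.
apply/le_anti; rewrite -[X in _ <= X]mul1r ufle /=.
apply/ler_addgt0Pr => e e0; have [N hN] := tail_small fh (divr_gt0 e0 (ltr0Sn R 1)).
have th : hardy (trunc f N) by exact: hardy_polyf.
have dh := hardyB fh th.
have h1 : hnorm f <= hnorm (f - trunc f N) + hnorm (trunc f N).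
  by apply: le_trans (hnormD_le dh th); rewrite subrK.
have h2 : hnorm (trunc f N) <= hnorm (mulf u f) + hnorm (f - trunc f N).
  rewrite -uI -/(trunc f N).
  have -> : mulf u (trunc f N) = mulf u f - mulf u (f - trunc f N) by rewrite mulfB opprB addrC subrK.
  have [d1 d2] := ext _ dh; apply: le_trans (hnormD_le ufh (hardyN d1)) _.
  by rewrite lerD2l -scaleN1r hnormZ// modulusN modulus1 mul1r -[X in _ <= X]mul1r.
lra.
Qed.

End Polynomials.

(** * Inner functions act isometrically *)

Section Radial.
Context {R : realType} {n : nat}.
Local Notation C := (Cplx R).
Local Notation mi := {ffun 'I_n -> nat}.
Local Notation TR := (n.-tuple (measurableTypeR R)).
Local Notation mu := (torus_measure R n).
Local Notation rad N := (1 - N.+1%:R^-1 : R).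
Implicit Types (f g : polydisc R n -> C) (c : mi -> C).

Lemma dist_cvg (x b : nat -> R) (l : R) : (forall N, `|l - x N| <= b N) ->
  b N @[N --> \oo] --> 0 -> x N @[N --> \oo] --> l.
Proof.
move=> xb b0; apply/cvgrPdist_le => e e0; move/cvgrPdist_le: b0 => /(_ _ e0)[N0 _ h].
exists N0 => // N /h /=; rewrite sub0r normrN => h1; apply: le_trans (xb N) _.
exact: le_trans (ler_norm _) h1.
Qed.

Lemma cvg_sum_seq (I : Type) (r : seq I) (F : I -> nat -> R) (l : I -> R) :
  (forall i, F i N @[N --> \oo] --> l i) ->
  \sum_(i <- r) F i N @[N --> \oo] --> \sum_(i <- r) l i.
Proof.
move=> h; elim: r => [|i r IH].
  by under eq_cvg do rewrite big_nil; rewrite big_nil; exact: cvg_cst.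
under eq_cvg do rewrite big_cons.
by rewrite big_cons; exact: cvgD.
Qed.

Lemma cvg_sqrM (x y : nat -> R) (a b : R) :
  x N @[N --> \oo] --> a -> y N @[N --> \oo] --> b ->
  x N ^+ 2 * y N ^+ 2 @[N --> \oo] --> a ^+ 2 * b ^+ 2.
Proof. by move=> xa yb; under eq_cvg do rewrite !expr2; apply: cvgM; exact: cvgM. Qed.

Lemma cvg_radius_left (f : R -> C) (l : C) :
  f r @[r --> (1 : R)^'-] --> l ->
  modulus (f (rad N)) @[N --> \oo] --> modulus l.
Proof.
move=> /cvgrPdist_lt fl; apply/cvgrPdist_lt => e e0.
have [|d /= d0 hd] := fl (Complex e 0); first by rewrite ltcR.
have := @cvg_radius R 1 => /cvgrPdist_lt/(_ _ d0)[N0 _ h].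
exists N0 => // N /h /=; rewrite expr1 => hN.
have := hd _ hN; rewrite ltrBlDr ltrDl invr_gt0 ltr0n => /(_ isT) /=.
by rewrite normr_modulus ltcR; apply: le_lt_trans; exact: modulus_dist.
Qed.

(** Each mean square is at most the squared norm; a finite set of coefficients carrying almost all
    of the norm, on which the powers of the radius tend to 1, gives the lower bound. *)
Lemma cvg_meansq f : hardy f -> meansq f (rad N) @[N --> \oo] --> hnorm f ^+ 2.
Proof.
move=> fh; have fc := series_taylor fh; set X := hnorm f ^+ 2.
have ms N := series_meansq (@radius01 R N) fc.
pose F k := modulus (taylor f k) ^+ 2.
pose G N k := F k * rad N ^+ (2 * mdeg k).
have F0 k : 0 <= F k by exact: sqr_ge0.
have le_rad N m : 0 <= rad N ^+ m <= 1.
  by have /andP[r0 r1] := @radius01 R N; rewrite exprn_ge0// exprn_ile1// ltW.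
have mX N : meansq f (rad N) <= X.
  have [_ _ hs] := ms N.
  have [s [hs1 sX _]] : exists s : R, [/\ hassum (fun k => Complex (G N k) 0) (Complex s 0),
      s <= X & forall A : {fset mi}, \sum_(i <- A) G N i <= s].
    apply: hassum_ge0 => [k|A]; first by rewrite mulr_ge0// (andP (le_rad N _)).1.
    apply: le_trans (hassum_real_le A F0 (hassum_taylor_hnorm fh)).
    by apply: ler_sum => k _; rewrite ler_piMr// (andP (le_rad N _)).2.
  by case: (hassum_unique hs hs1) => ->.
apply/cvgrPdist_le => e e0; have e2 : 0 < e / 2 by rewrite divr_gt0.
have [A hA] := hassum_taylor_hnorm fh e2.
have {hA} := hA A (fsubset_refl _); rewrite real_complex_sum -[X in modulus X]/(Complex (_ - _) (0 - 0)) subr0.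
rewrite modulus_real -/X => hA.
have cv : \sum_(k <- A) G N k @[N --> \oo] --> \sum_(k <- A) F k.
  apply: cvg_sum_seq => k; rewrite -[X in _ --> X]mulr1.
  by apply: cvgM; [exact: cvg_cst|exact: cvg_radius].
move/cvgrPdist_lt: cv => /(_ _ e2)[N0 _ h]; exists N0 => // N /h /= hN.
have [_ _ hs] := ms N.
have GA : \sum_(k <- A) G N k <= meansq f (rad N).
  by apply: (hassum_real_le (f := G N) A _ hs) => k; rewrite mulr_ge0// (andP (le_rad N _)).1.
move: (mX N) hA hN; rewrite -/(F _) => m1; rewrite !ltr_norml => /andP[a1 a2] /andP[a3 a4].
rewrite ger0_norm ?subr_ge0//; lra.
Qed.

Lemma meansq_le f c (M r : R) : 0 <= r < 1 -> series f c ->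
  (forall z, modulus (f z) <= M) -> meansq f r <= M ^+ 2.
Proof.
move=> r01 fc fM.
have b t : modulus (ext0 f (circle_pt r t)) <= M by rewrite (ext0_circle _ _ r01).
have M0 : 0 <= M by apply: le_trans (modulus_ge0 _) (b [tuple of nseq n 0]).
have b2 t : modulus (ext0 f (circle_pt r t)) ^+ 2 <= M ^+ 2.
  by rewrite lerXn2r ?nnegrE ?modulus_ge0.
have -> : M ^+ 2 = \int[mu]_t (M ^+ 2) by rewrite /Rintegral integral_torus_cst.
have [mf _ _] := series_meansq r01 fc.
have ms2 : measurable_fun [set: TR] (fun t => modulus (ext0 f (circle_pt r t)) ^+ 2).
  exact: measurable_funX.
apply: le_Rintegral => //.
  by apply: (@integrable_torus_bounded _ _ _ (M ^+ 2)) ms2 _ => t; rewrite ger0_norm ?sqr_ge0.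
apply: (@integrable_torus_bounded _ _ _ (M ^+ 2)) => [|t]; first exact: measurable_cst.
by rewrite ger0_norm ?sqr_ge0.
Qed.

Lemma bounded_hardy f (M : R) : analytic f -> (forall z, modulus (f z) <= M) -> hardy f.
Proof.
move=> /analytic_series[c fc] fM; apply/hardyP; exists c, (M ^+ 2); split=> // A.
apply: (@sum_radius_le _ _ _ _ (fun k => 2 * mdeg k)%N) => r r01.
apply: le_trans (meansq_le r01 fc fM).
have [_ _ hs] := series_meansq r01 fc.
apply: hassum_real_le hs => k; rewrite mulr_ge0 ?sqr_ge0// exprn_ge0//.
by case/andP: r01.
Qed.

Lemma ext0_polyf A c r (t : n.-tuple R) : 0 <= r < 1 ->
  ext0 (polyf A c) (circle_pt r t) =
  \sum_(k <- A) c k * (Complex r 0 ^+ mdeg k * char k t).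
Proof.
move=> r01; rewrite (ext0_circle _ _ r01) /polyf fct_sumE.
apply: eq_bigr => k _; rewrite -[LHS]/(c k * monf k _) /monf.
rewrite (@eq_mon _ _ _ (cpt r t)) => [|j]; last exact: coord_pd.
by rewrite /cpt monZ char_mon.
Qed.

Lemma ext0_mulf f g r (t : n.-tuple R) :
  ext0 (mulf f g) (circle_pt r t) = ext0 f (circle_pt r t) * ext0 g (circle_pt r t).
Proof. by rewrite /ext0; case: insub => [z|]//; rewrite mulr0. Qed.

Lemma polyf_bound A c r (t : n.-tuple R) : 0 <= r < 1 ->
  modulus (ext0 (polyf A c) (circle_pt r t)) <= \sum_(k <- A) modulus (c k).
Proof.
move=> r01; rewrite (ext0_polyf _ _ _ r01); apply: le_trans (modulus_sum _ _ _) _.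
apply: ler_sum => k _; rewrite !modulusM modulusX modulus_char mulr1 modulus_real.
by case/andP: r01 => r0 r1; rewrite ger0_norm// ler_piMr ?modulus_ge0// exprn_ile1// ltW.
Qed.

Lemma cvg_polyf_radial A c (t : n.-tuple R) :
  modulus (ext0 (polyf A c) (circle_pt (rad N) t)) @[N --> \oo] --> modulus (trig A c t).
Proof.
apply: (@dist_cvg _ (fun N => \sum_(k <- A) modulus (c k) * (1 - rad N ^+ mdeg k))) => [N|].
  apply: le_trans (modulus_dist _ _) _; rewrite (ext0_polyf _ _ _ (@radius01 R N)) /trig -sumrB.
  apply: le_trans (modulus_sum _ _ _) _; apply: ler_sum => k _.
  rewrite -mulrBr -{1}[char k t]mul1r -mulrBl !modulusM modulus_char mulr1.
  rewrite ler_wpM2l ?modulus_ge0//.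
  have -> : 1 - Complex (rad N) 0 ^+ mdeg k = Complex (1 - rad N ^+ mdeg k) 0 :> C.
    by rewrite -[RHS]/(real_complex R _) rmorphB rmorph1 rmorphXn.
  have /andP[r0 r1] := @radius01 R N.
  by rewrite modulus_real ger0_norm// subr_ge0 exprn_ile1// ltW.
rewrite -[X in _ --> X](_ : \sum_(k <- A) 0 = 0 :> R); last by rewrite big1.
apply: cvg_sum_seq => k; rewrite -[X in _ --> X](mulr0 (modulus (c k))).
apply: cvgM; first exact: cvg_cst.
rewrite -[X in _ --> X](subrr (1 : R)).
by apply: cvgB; [exact: cvg_cst|exact: cvg_radius].
Qed.

(** For a polynomial [p], the mean squares of [theta p] on the tori of radius [1 - 1 / (N + 1)] have
    two limits: the squared norm of [theta p] and, by dominated convergence, the mean square of [p],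
    since [|theta|] tends to 1 almost everywhere. *)
Lemma inner_function_isometry theta : inner_function theta ->
  forall f, hardy f -> hardy (mulf theta f) /\ hnorm (mulf theta f) = hnorm f.
Proof.
move=> [an [M tM] bv]; have th := bounded_hardy an tM.
apply: (multiplier_isometry th) => A c.
have ph := hardy_mulf_polyf A c th.
apply/eqP; rewrite -(@eqrXn2 _ 2%N) ?hnorm_ge0//; apply/eqP; rewrite sqr_hnorm_polyf.
have cv1 := cvg_meansq ph.
set B := \sum_(k <- A) modulus (c k).
have B0 : 0 <= B by apply: sumr_ge0 => k _; exact: modulus_ge0.
have b N t : modulus (ext0 theta (circle_pt (rad N) t)) <= M.
  by rewrite (ext0_circle _ _ (@radius01 R N)).
have cv2 : meansq (mulf theta (polyf A c)) (rad N) @[N --> \oo] -->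
    \int[mu]_t (modulus (trig A c t) ^+ 2).
  apply: (@torus_dominated_convergence _ _ _ _ ((M * B) ^+ 2)) => [N|||N t].
  - by have [m _ _] := series_meansq (@radius01 R N) (series_taylor ph); exact: measurable_funX.
  - by apply: measurable_funX; exact: measurable_modulus_trig.
  - apply: ae_torusS bv => t [l /cvg_radius_left tl l1].
    under eq_cvg do rewrite ext0_mulf modulusM exprMn.
    by have := cvg_sqrM tl (@cvg_polyf_radial A c t); rewrite l1 expr1n mul1r.
  - rewrite ger0_norm ?sqr_ge0// lerXn2r ?nnegrE ?modulus_ge0//.
      by rewrite mulr_ge0//; exact: le_trans (modulus_ge0 _) (b N t).
    by rewrite ext0_mulf modulusM ler_pM ?modulus_ge0// polyf_bound// radius01.
rewrite -Rintegral_trig.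
exact: (cvg_unique _ cv1 cv2).
Qed.

End Radial.

(** * The defect operators *)

Section Defects.
Context {R : realType} {n : nat}.
Local Notation C := (Cplx R).
Implicit Types (f g h u : polydisc R n -> C) (S : set (polydisc R n -> C)).

(** [inner] combines norms of the functions [f + i^k g] and multiplication by [u] is linear, so
    preservation of norms suffices. *)
Lemma inner_mulf u f g :
  (forall h, hardy h -> hnorm (mulf u h) = hnorm h) ->
  hardy f -> hardy g -> inner (mulf u f) (mulf u g) = inner f g.
Proof.
move=> uI fh gh; rewrite /inner; congr (_ * _); apply: eq_bigr => k _.
by rewrite -mulfZ -mulfD uI//; apply: hardyD => //; exact: hardyZ.
Qed.

(** In the pairing with an element of [S] the projection inside [opE] disappears, and [ev j] is
    self-adjoint. *)
Lemma Eadj_ev S j h : submodule S -> S h -> Eadj S j h = ev j h.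
Proof.
move=> hS Sh; have hh := sub_hardy hS Sh.
apply: adjointE => [//|||f fh]; [exact: hardyB|exact: hardy_ev|].
by rewrite /opE (orth_proj_inner hS) ?inner_ev//; exact: hardy_ev.
Qed.

(** On the whole space the adjoint of [mulz j] is the backward shift; restricting to [S] compresses
    it. *)
Lemma Radj_backshift S j f : submodule S -> S f ->
  Radj S j f = orth_proj S (backshift j f).
Proof.
move=> hS Sf; have fh := sub_hardy hS Sf; have bh := hardy_backshift j fh.
have [Sp _] := orth_projP hS bh.
apply: adjointE => [|||g Sg]; [exact: sub_hardy|exact: (subB hS)|exact: Sp|].
have gh := sub_hardy hS Sg; have ph := sub_hardy hS Sp.
by rewrite inner_mulz_backshift// (inner_conj ph gh) (orth_proj_inner hS)// -inner_conj.
Qed.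

Lemma ev_mulf_depends i j theta f : j <> i -> depends_only_on i theta ->
  ev j (mulf theta f) = mulf theta (ev j f).
Proof.
move=> ji th; apply/funext => z; rewrite /ev /mulf; congr (_ * _).
by apply: th; rewrite /coord /= mxE; case: eqP => // ij; case: ji.
Qed.

Lemma inner_function_defect S i theta :
  submodule S -> inner_function theta -> depends_only_on i theta ->
  S = [set (fun z => theta z * f z) | f in @hardy R n] ->
  forall j, j <> i -> forall f, S f -> defectE S j (defectR S j f) = 0.
Proof.
move=> hS ti td SE j ji f; rewrite {1}SE => -[g gh <-{f}].
have tI := inner_function_isometry ti; have uI h hh := (tI h hh).2.
have SM h : hardy h -> S (mulf theta h) by move=> hh; rewrite SE; exists h.
rewrite -/(mulf theta g); have bh := hardy_backshift j gh.
have -> : defectR S j (mulf theta g) = mulf theta (ev j g).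
  rewrite /defectR; have -> : Radj S j (mulf theta g) = mulf theta (backshift j g).
    apply: adjointE => [|||f]; [exact: sub_hardy|exact: (subB hS)|exact: SM|].
    rewrite SE => -[h hh <-]; rewrite -/(mulf theta h) -mulf_mulz.
    by rewrite !inner_mulf ?inner_mulz_backshift//; exact: hardy_mulz.
  by rewrite -mulf_mulz -mulfB; congr mulf; rewrite {1}(ev_backshift j gh) addrK.
have Sh : S (mulf theta (ev j g)) by apply: SM; exact: hardy_ev.
(* [theta * ev j g] lies in [S] and does not involve [z_j], so both [ev j] and the projection fix
   it. *)
rewrite /defectE (Eadj_ev j hS Sh) /opE !(ev_mulf_depends _ ji td) !ev_idem.
by rewrite (orth_proj_id hS) ?subrr.
Qed.

(* The hypothesis makes [h = f - z_j (Radj S j f)] the projection on [S] of [ev j h],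
   so that [ev j h] is at least as long as [h], hence equal to it. *)
Lemma defect_reducing S j : submodule S ->
  (forall f, S f -> defectE S j (defectR S j f) = 0) ->
  forall f, S f -> S (ev j f) /\ S (backshift j f).
Proof.
move=> hS D f Sf; have fh := sub_hardy hS Sf; have bh := hardy_backshift j fh.
have := D f Sf; rewrite /defectR (Radj_backshift j hS Sf).
have [Sp _] := orth_projP hS bh; have ph := sub_hardy hS Sp.
set g := orth_proj S _ in Sp ph *; set h := f - mulz j g.
have Sh : S h by apply: (subB hS) => //; exact: (submodule_mulz hS).
have hh := sub_hardy hS Sh; have eh := hardy_ev j hh.
rewrite /defectE (Eadj_ev j hS Sh) /opE ev_idem => /eqP; rewrite subr_eq0 => /eqP hE.
have h1 : inner h h = inner (ev j h) h by rewrite {1}hE (orth_proj_inner hS).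
have h2 : h = ev j h.
  have h3 : hnorm h ^+ 2 = hnorm (ev j h) ^+ 2.
    move: h1; rewrite inner_self//.
    have -> : inner (ev j h) h = inner (ev j h) (ev j h).
      by rewrite -{1}(ev_idem j h) inner_ev.
    by rewrite inner_self// => -[].
  apply/eqP; rewrite -subr_eq0; apply/eqP; apply: hnorm_eq0; first exact: hardyB.
  by apply/eqP; rewrite -sqrf_eq0 sqr_hnorm_ev// h3 subrr.
have fE : f = h + mulz j g by rewrite /h subrK.
split; first by rewrite fE evD ev_mulz addr0 -h2.
have -> // : backshift j f = g.
rewrite fE backshiftD ?backshift_mulz//; last exact: hardy_mulz.
by rewrite h2 backshift_ev// add0r.
Qed.

End Defects.

(** * The generator of a reducing submodule *)

Section Wandering.
Context {R : realType} {n : nat}.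
Local Notation C := (Cplx R).
Local Notation mi := {ffun 'I_n -> nat}.
Implicit Types (f g h u : polydisc R n -> C) (k l a b : mi) (j : 'I_n).

(** Bernoulli's inequality and the Archimedean property. *)
Lemma powers_bounded (x K : R) : (forall m, x ^+ m <= K) -> x <= 1.
Proof.
move=> xK; rewrite leNgt; apply/negP => x1; set y := x - 1.
have y0 : 0 < y by rewrite subr_gt0.
have B m : 1 + m%:R * y <= x ^+ m.
  elim: m => [|m IH]; first by rewrite mul0r addr0 expr0.
  have xE : x = 1 + y by rewrite addrC subrK.
  rewrite exprS {1}xE -natr1; have : 0 <= m%:R * y ^+ 2 by rewrite mulr_ge0 ?sqr_ge0.
  have : (1 + y) * (1 + m%:R * y) <= (1 + y) * x ^+ m by rewrite ler_wpM2l// -xE; lra.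
  rewrite expr2; nra.
have K0 : 0 <= K by apply: le_trans (xK 0%N); rewrite expr0.
have := archi_boundP (divr_ge0 K0 (ltW y0)); set N := Num.bound _ => hN.
have := le_trans (B N) (xK N); move: hN; rewrite ltr_pdivrMr//; lra.
Qed.

(* All the powers of [u] have norm 1, and point evaluations are bounded. *)
Lemma isometry_bounded u : hardy u ->
  (forall f, hardy f -> hardy (mulf u f) /\ hnorm (mulf u f) = hnorm f) ->
  forall z, modulus (u z) <= 1.
Proof.
move=> uh uI z; have [K K0 hK] := point_eval z.
pose p m : polydisc R n -> C := fun z => u z ^+ m.
have ph m : hardy (p m) /\ hnorm (p m) = hnorm (p 0%N).
  elim: m => [|m [h1 h2]]; last first.
    have -> : p m.+1 = mulf u (p m) by apply/funext => w; rewrite /p exprS.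
    by have [h3 ->] := uI _ h1.
  split=> //; have -> : p 0%N = monf [ffun=> 0%N] by rewrite monf0; apply/funext => w; rewrite /p expr0.
  exact: hardy_monf.
apply: (@powers_bounded _ (K * hnorm (p 0%N))) => m.
by rewrite -modulusX -(ph m).2; exact: hK (ph m).1.
Qed.

Lemma inner_sum_r (I : Type) (r : seq I) (G : I -> polydisc R n -> C) f :
  hardy f -> (forall x, hardy (G x)) ->
  inner f (\sum_(x <- r) G x) = \sum_(x <- r) inner f (G x).
Proof.
move=> fh Gh; elim: r => [|x r IH].
  by rewrite !big_nil inner_conj ?inner0l ?conjc0//; exact: hardy0.
by rewrite !big_cons innerDr ?IH//; exact: hardy_sum.
Qed.

Definition axis (i : 'I_n) (p : nat) : mi := [ffun j => if j == i then p else 0%N].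

Definition madd k l : mi := [ffun j => (k j + l j)%N].

Lemma axis_split i k : k = madd [ffun j => if j == i then 0%N else k j] (axis i (k i)).
Proof. by apply/ffunP => j; rewrite !ffunE; case: eqP => [->|_]; rewrite ?addn0. Qed.

Lemma axisS i p : axis i p.+1 = incr i (axis i p).
Proof. by apply/ffunP => j; rewrite !ffunE; case: eqP; rewrite ?addn1. Qed.

Lemma madd_incr j k l : madd (incr j k) l = incr j (madd k l).
Proof. by apply/ffunP => i; rewrite !ffunE addnAC. Qed.

Lemma madd0 l : madd [ffun=> 0%N] l = l.
Proof. by apply/ffunP => i; rewrite !ffunE. Qed.

Section Fixed.
Variables (i : 'I_n).

(** Stated for a general [T] because it is applied both to [S] and to the part of [S] orthogonal to
    all the [z^a theta]. *)
Lemma iterated_backshift (T : set (polydisc R n -> C)) : T `<=` @hardy R n ->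
  (forall j f, j <> i -> T f -> T (backshift j f)) ->
  forall k, k i = 0%N -> forall f, T f ->
  exists2 g, T g & forall l, taylor g l = taylor f (madd k l).
Proof.
move=> Th Tb; elim/(@multi_index_ind n) => [_|j k IH] => [f Tf|].
  by exists f => // l; rewrite madd0.
move=> ki f Tf; have ji : j <> i by move=> ji; move: ki; rewrite -ji => /eqP; rewrite (negbTE (incr_neq0 _ _)).
have [|g Tg gE] := IH _ f Tf; first by move: ki; rewrite ffunE => /eqP; rewrite addn_eq0 => /andP[/eqP].
exists (backshift j g); first exact: Tb.
by move=> l; rewrite taylor_backshift ?gE; [congr taylor; apply/ffunP => q; rewrite !ffunE addnAC addnA|exact: Th].
Qed.

Lemma taylor_axis_only f k : hardy f -> (forall j, j <> i -> ev j f = f) ->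
  k <> axis i (k i) -> taylor f k = 0.
Proof.
move=> fh ef kE; have [j [ji kj]] : exists j, j <> i /\ k j != 0%N.
  apply: contrapT => kn; apply: kE; apply/ffunP => j; rewrite ffunE; case: eqP => [->//|ji].
  by apply/eqP; apply: contrapT => /negP kj; apply: kn; exists j.
by rewrite -(ef j ji) taylor_ev// /ev_coef (negbTE kj).
Qed.

Lemma depends_only_onP f : hardy f -> (forall j, j <> i -> ev j f = f) -> depends_only_on i f.
Proof.
move=> fh ef z w zw; have fz := series_taylor fh z.
apply: hassum_unique fz _; apply: eq_hassum (series_taylor fh w) => k.
have [[j [ji kj]]|kn] := pselect (exists j, j <> i /\ k j <> 0%N).
  suff -> : taylor f k = 0 by rewrite !mul0r.
  by rewrite -(ef _ ji) taylor_ev// /ev_coef; case: eqP.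
congr (_ * _); apply: eq_bigr => j _; have [->|ji] := eqVneq j i; first by rewrite zw.
have -> : k j = 0%N by apply: contrapT => kj; apply: kn; exists j; split => //; exact/eqP.
by rewrite !expr0.
Qed.

Variable S : set (polydisc R n -> C).
Hypothesis hS : submodule S.
Hypothesis red : forall j f, j <> i -> S f -> S (ev j f) /\ S (backshift j f).

Let Sh := sub_hardy hS.

Lemma sub_mulf_monf u k : S u -> S (mulf u (monf k)).
Proof.
move=> Su; elim/(@multi_index_ind n): k => [|j k IH].
  by rewrite monf0; have -> : mulf u (fun=> 1) = u by apply/funext => z; rewrite /mulf mulr1.
by rewrite monf_incr mulf_mulz; exact: (submodule_mulz hS).
Qed.

Lemma sub_mulf_polyf u A c : S u -> S (mulf u (polyf A c)).
Proof.
move=> Su; rewrite mulf_polyf; elim: (X in \sum_(_ <- X) _) => [|k r IH].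
  by rewrite big_nil; exact: (submodule0 hS).
by rewrite big_cons; apply: (subD hS) => //; apply: (subZ hS); exact: sub_mulf_monf.
Qed.

(** A nonzero coefficient at [k] is moved to [axis i (k i)] by backward shifts in the other
    variables, which preserve [S]; minimality among the pure powers of [z_i] thus controls all the
    coefficients. *)
Lemma first_index : (exists2 f, S f & f <> 0) ->
  exists m, (exists2 f, S f & taylor f (axis i m) != 0) /\
    forall f k, S f -> (k i < m)%N -> taylor f k = 0.
Proof.
move=> [f Sf f0]; pose P p := `[< exists2 f, S f & taylor f (axis i p) != 0 >].
have Pk g k : S g -> taylor g k != 0 -> P (k i).
  move=> Sg gk; apply/asboolP.
  have [|h Sh' hE] := iterated_backshift Sh (fun j f ji Sf => (red ji Sf).2) (k := [ffun j => if j == i then 0%N else k j]) _ Sg.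
    by rewrite ffunE eqxx.
  by exists h => //; rewrite hE -axis_split.
have exP : exists p, P p.
  apply: contrapT => nP; apply: f0; apply: hardy_taylor_eq => [||k]; [exact: Sh|exact: hardy0|].
  rewrite taylor0; apply/eqP; apply: contrapT => /negP fk; apply: nP.
  by exists (k i); exact: Pk Sf fk.
exists (ex_minn exP); case: ex_minnP => m /asboolP Pm mmin; split=> // g k Sg km.
apply/eqP; apply: contrapT => /negP gk.
by have := mmin _ (Pk _ _ Sg gk); rewrite leqNgt km.
Qed.

(** * The orthonormal family of the [z^a theta] *)

Section Generator.
Variables (m : nat) (theta : polydisc R n -> C) (K : C).
Hypotheses (St : S theta) (etheta : forall j, j <> i -> ev j theta = theta).
Hypothesis innert : forall f, S f -> inner f theta = K * taylor f (axis i m).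
Hypothesis theta1 : inner theta theta = 1.
Hypothesis mmin : forall f k, S f -> (k i < m)%N -> taylor f k = 0.

Let th := Sh St.

(** Neither [theta] nor the monomial involves [z_j]. *)
Lemma backshift_theta j a : j <> i -> a j = 0%N -> backshift j (mulf theta (monf a)) = 0.
Proof.
move=> ji aj; have -> : mulf theta (monf a) = ev j (mulf theta (monf a)).
  apply: hardy_taylor_eq; [exact: hardy_mulf_monf|by apply: hardy_ev; exact: hardy_mulf_monf|].
  move=> k; congr taylor; apply/funext => z; rewrite /ev /mulf; congr (_ * _).
    by rewrite -[in LHS](etheta ji).
  apply: eq_bigr => q _; have [->|qj] := eqVneq q j; first by rewrite aj !expr0.
  by rewrite /coord /= mxE (negbTE qj).
by rewrite backshift_ev//; exact: hardy_mulf_monf.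
Qed.

(** The factors of [z^a], none of them [z_i], move one by one to the other side as backward shifts,
    under which [S] is stable, until [innert] applies. *)
Lemma inner_theta_monf a : a i = 0%N -> forall f, S f ->
  inner f (mulf theta (monf a)) = K * taylor f (madd a (axis i m)).
Proof.
elim/(@multi_index_ind n): a => [_ f Sf|j a IH ai f Sf].
  rewrite monf0 madd0; have -> : mulf theta (fun=> 1) = theta by apply/funext => z; rewrite /mulf mulr1.
  exact: innert.
have ji : j <> i by move=> ji; move: ai; rewrite -ji => /eqP; rewrite (negbTE (incr_neq0 _ _)).
have {}ai : a i = 0%N by move: ai; rewrite ffunE => /eqP; rewrite addn_eq0 => /andP[/eqP].
have tah := hardy_mulf_monf a th; have fh := Sh Sf.
rewrite monf_incr mulf_mulz (inner_conj (hardy_mulz j tah) fh) inner_mulz_backshift//.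
rewrite -(inner_conj tah (hardy_backshift j fh)) IH ?taylor_backshift ?madd_incr//.
exact: (red ji Sf).2.
Qed.

(** For [j <> i] the backward shift kills [z^a theta]. For [j = i] the inner product is [K] times a
    coefficient of [z_i f] with exponent [m] in [z_i]: it is 0 if [m = 0], and otherwise a
    coefficient of [f] with exponent [m - 1], zero by minimality of [m]. *)
Lemma inner_mulz_theta j a f : S f -> a j = 0%N ->
  inner (mulz j f) (mulf theta (monf a)) = 0.
Proof.
move=> Sf aj; have fh := Sh Sf; have tah := hardy_mulf_monf a th.
have [ji|ji] := eqVneq j i; last first.
  rewrite inner_mulz_backshift// backshift_theta//; last exact/eqP.
  by rewrite inner_conj ?inner0l ?conjc0//; exact: hardy0.
subst j; rewrite inner_theta_monf//; last exact: (submodule_mulz hS).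
rewrite taylor_mulz// /shift_coef; case: eqP => [_|k0]; first by rewrite mulr0.
rewrite mmin ?mulr0//; move/eqP: k0; rewrite !ffunE eqxx aj add0n -lt0n.
by case: m => // q _; rewrite subn1.
Qed.

(** Common factors [z_j] cancel because [mulz j] is isometric; once some [z_j] divides one monomial
    and not the other, [inner_mulz_theta] gives orthogonality. *)
Lemma inner_theta_delta a b : inner (mulf theta (monf a)) (mulf theta (monf b)) = (a == b)%:R.
Proof.
have mh k := hardy_mulf_monf k th.
have Z j a' b' : b' j = 0%N -> inner (mulf theta (monf (incr j a'))) (mulf theta (monf b')) = 0.
  by move=> bj; rewrite monf_incr mulf_mulz inner_mulz_theta//; exact: sub_mulf_monf.
have neq j a' b' : b' j = 0%N -> (incr j a' == b') = false.
  by move=> bj; apply/eqP => E; have := incr_neq0 j a'; rewrite E bj.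
elim/(@multi_index_ind n): b a => [|j b IH] a; last first.
  have [aj|aj] := eqVneq (a j) 0%N.
    by rewrite inner_conj// Z// conjc0 eq_sym neq.
  rewrite -{1}(decrK aj) !monf_incr !mulf_mulz inner_mulz// IH; congr (_ %:R).
  by congr nat_of_bool; apply/eqP/eqP => [<-|->]; rewrite ?decrK ?incrK.
have [[j aj]|/forallNP an] := pselect (exists j, a j != 0%N).
  by rewrite -(decrK aj) Z ?ffunE// neq// ffunE.
have -> : a = [ffun=> 0%N] by apply/ffunP => j; rewrite ffunE; have := an j; case: eqP.
rewrite eqxx monf0; have -> // : mulf theta (fun=> 1) = theta by apply/funext => z; rewrite /mulf mulr1.
Qed.

Lemma inner_mulf_polyf A c f : hardy f -> inner f (mulf theta (polyf A c)) =
  \sum_(k <- A) conjc (c k) * inner f (mulf theta (monf k)).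
Proof.
move=> fh; rewrite mulf_polyf inner_sum_r//; last first.
  by move=> k; apply: hardyZ; exact: hardy_mulf_monf.
by apply: eq_bigr => k _; rewrite innerZr//; exact: hardy_mulf_monf.
Qed.

Lemma theta_isometry f : hardy f -> hardy (mulf theta f) /\ hnorm (mulf theta f) = hnorm f.
Proof.
apply: multiplier_isometry => // A c; have ph := hardy_mulf_polyf A c th.
apply/eqP; rewrite -(@eqrXn2 _ 2%N) ?hnorm_ge0//; apply/eqP; rewrite sqr_hnorm_polyf.
suff : inner (mulf theta (polyf A c)) (mulf theta (polyf A c)) =
  Complex (\sum_(k <- A) modulus (c k) ^+ 2) 0 by rewrite inner_self// => -[].
rewrite inner_mulf_polyf// -real_complex_sum !big_seq; apply: eq_bigr => k kA.
have mh l := hardy_mulf_monf l th.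
rewrite inner_conj// inner_mulf_polyf// (big_fsetD1 k)//= inner_theta_delta eqxx mulr1.
rewrite big_seq big1 ?addr0 => [|l].
  by rewrite conjcK mulrC mulr_conj.
by rewrite in_fsetD1 inner_theta_delta eq_sym => /andP[/negbTE -> _]; rewrite mulr0.
Qed.

Definition theta_coef f k : C := inner f (mulf theta (monf k)).

(** Bessel's identity for the orthonormal family [z^a theta]. *)
Lemma theta_bessel f A : hardy f ->
  hnorm (f - mulf theta (polyf A (theta_coef f))) ^+ 2 =
  hnorm f ^+ 2 - \sum_(k <- A) modulus (theta_coef f k) ^+ 2.
Proof.
move=> fh; have [ph pn] := theta_isometry (hardy_polyf A (theta_coef f)).
rewrite sqr_hnormB// pn sqr_hnorm_polyf inner_mulf_polyf//.
have -> : \sum_(k <- A) conjc (theta_coef f k) * inner f (mulf theta (monf k)) =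
    Complex (\sum_(k <- A) modulus (theta_coef f k) ^+ 2) 0.
  by rewrite -real_complex_sum; apply: eq_bigr => k _; rewrite mulrC mulr_conj.
rewrite /=; ring.
Qed.

(** If [a j = 0] this is [inner_mulz_theta]; otherwise a factor [z_j] cancels on both sides. *)
Lemma theta_perp_mulz f : S f -> (forall a, theta_coef f a = 0) ->
  forall j a, theta_coef (mulz j f) a = 0.
Proof.
move=> Sf f0 j a; have [aj|aj] := eqVneq (a j) 0%N; first exact: inner_mulz_theta.
rewrite /theta_coef -(decrK aj) monf_incr mulf_mulz inner_mulz; [exact: f0|exact: Sh|exact: hardy_mulf_monf].
Qed.

Lemma theta_perp_backshift f : S f -> (forall a, theta_coef f a = 0) ->
  forall j a, theta_coef (backshift j f) a = 0.
Proof.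
move=> Sf f0 j a; have fh := Sh Sf; have tah := hardy_mulf_monf a th.
rewrite /theta_coef (inner_conj tah (hardy_backshift j fh)) -inner_mulz_backshift//.
have mh := hardy_mulf_monf (incr j a) th.
by rewrite -mulf_mulz -monf_incr -inner_conj//; exact: f0.
Qed.

Lemma taylor_mulf_axis q r :
  taylor (mulf theta (monf (axis i q))) (axis i (r + q)) = taylor theta (axis i r).
Proof.
elim: q => [|q IH].
  rewrite addn0 (_ : axis i 0 = [ffun=> 0%N]); last by apply/ffunP => j; rewrite !ffunE; case: eqP.
  by rewrite monf0; congr taylor; apply/funext => z; rewrite /mulf mulr1.
rewrite addnS !axisS monf_incr mulf_mulz taylor_mulz; last exact: hardy_mulf_monf.
by rewrite /shift_coef (negbTE (incr_neq0 _ _)) incrK.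
Qed.

Lemma hnorm_monf k : hnorm (monf k : polydisc R n -> C) = 1.
Proof.
have kh := @hardy_monf R n k; have := inner_self kh.
rewrite inner_monf// taylor_monf /delta_coef eqxx => -[/eqP]; rewrite eq_sym sqrf_eq1.
by case/orP => /eqP // k1; have := hnorm_ge0 (monf k : polydisc R n -> C); rewrite k1; lra.
Qed.

(* With [g] the iterated backshift of [f], the Taylor coefficient of [f] at [k]
   is the inner product of [z_i ^ s g] with [z_i ^ (s + k i)]; the first factor is
   again orthogonal to every [z ^ a theta], while the distance of the second one to
   their span tends to [0], because [theta] has norm 1 and depends on [z_i] only. *)
Lemma theta_complete f : S f -> (forall a, theta_coef f a = 0) -> f = 0.
Proof.
move=> Sf f0; apply: hardy_taylor_eq; [exact: Sh|exact: hardy0|move=> k; rewrite taylor0].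
(* The part of [S] orthogonal to the family is stable under backward shifts in the variables other
   than [z_i], so the coefficient at [k] can be brought to the axis inside it. *)
pose T := [set f | S f /\ forall a, theta_coef f a = 0].
have Tb j g : j <> i -> T g -> T (backshift j g).
  by move=> ji [Sg g0]; split; [exact: (red ji Sg).2|exact: theta_perp_backshift].
have TS : T `<=` @hardy R n by move=> g [/Sh].
have [|g [Sg g0] gE] := iterated_backshift TS Tb (k := [ffun j => if j == i then 0%N else k j]) _ (conj Sf f0).
  by rewrite ffunE eqxx.
have {}gE : taylor f k = taylor g (axis i (k i)) by rewrite gE -axis_split.
rewrite gE; set p := k i.
(* [gs s] is [z_i^s g]: its norm is that of [g], while the coefficient under study moves to exponent
   [s + p]. *)
have [gs Ts] : exists gs : nat -> polydisc R n -> C, forall s,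
    [/\ T (gs s), hnorm (gs s) = hnorm g & taylor (gs s) (axis i (s + p)) = taylor g (axis i p)].
  exists (fun s => iter s (mulz i) g) => s; elim: s => [|s [[Sgs gs0] IH1 IH2]] //=.
  have gh := Sh Sgs; split; first by split; [exact: (submodule_mulz hS)|exact: theta_perp_mulz].
    apply/eqP; rewrite -IH1 -(@eqrXn2 _ 2%N) ?hnorm_ge0//; apply/eqP.
    by have := inner_mulz i gh gh; rewrite !inner_self//; [case|exact: hardy_mulz].
  by rewrite taylor_mulz// /shift_coef addSn axisS incrK (negbTE (incr_neq0 _ _)).
apply/eqP; rewrite -modulus_eq0; apply/eqP/le_anti; rewrite modulus_ge0 andbT.
apply/ler_addgt0Pr => e e0; rewrite add0r.
have X0 : 0 < hnorm g + 1 by rewrite ltr_wpDl// hnorm_ge0.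
have d0 : 0 < (e / (hnorm g + 1)) ^+ 2 by rewrite exprn_gt0// divr_gt0.
(* [theta] has norm 1 and its coefficients live on the axis, so almost all of its mass sits below
   some [N]. The divisor [hnorm g + 1] anticipates the Cauchy-Schwarz estimate. *)
have [N hN] : exists N, 1 - \sum_(q < N) modulus (taylor theta (axis i q)) ^+ 2 <= (e / (hnorm g + 1)) ^+ 2.
  have [N hN] := tail_small th (divr_gt0 e0 X0); exists N.
  rewrite -ler_sqr ?nnegrE ?hnorm_ge0 ?divr_ge0 ?(ltW e0) ?(ltW X0)// sqr_hnorm_tail// in hN.
  have t1 : hnorm theta ^+ 2 = 1 by move: theta1; rewrite inner_self// => -[].
  rewrite t1 in hN; apply: le_trans hN; rewrite lerD2l lerN2.
  pose B := [fset axis i (val q) | q in 'I_N]%fset.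
  have -> : \sum_(q < N) modulus (taylor theta (axis i q)) ^+ 2 = \sum_(a <- B) modulus (taylor theta a) ^+ 2.
    rewrite /B big_imfset /=; last first.
      by move=> q r _ _ /ffunP/(_ i); rewrite !ffunE eqxx => /val_inj.
    by rewrite big_enum.
  pose F a := modulus (taylor theta a) ^+ 2.
  have -> : \sum_(a <- box N) F a = \sum_(a <- (box N `&` B)%fset) F a.
    symmetry; apply: big_fset_incl => [|l lN]; first exact: fsubsetIl.
    rewrite in_fsetI lN /= => kB; rewrite /F taylor_axis_only ?modulus0 ?expr0n//.
    move=> lE; move/negP: kB; apply; rewrite lE; move: lN; rewrite in_box => /forallP/(_ i) lN.
    by apply/imfsetP; exists (Ordinal lN).
  by apply: ler_sum_fset; [move=> l; exact: sqr_ge0|exact: fsubsetIr].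
have {Ts} [[Sgs gs0] gn gt] := Ts N; have gh := Sh Sgs.
set M := (N + p)%N in gt; set f1 : polydisc R n -> C := monf (axis i M).
have f1h : hardy f1 by exact: hardy_monf.
(* Exponents up to [M] suffice: [z_i^q theta] has no term in [z_i^M] when [q > M]. *)
pose A := [fset axis i (val q) | q in 'I_M.+1]%fset.
pose P := mulf theta (polyf A (theta_coef f1)).
have Ph : hardy P by exact: hardy_mulf_polyf.
have gE' : taylor g (axis i p) = inner (gs N) (f1 - P).
  rewrite innerBr// inner_monf// gt /P inner_mulf_polyf// big1 ?subr0// => l _.
  by rewrite [inner _ _]gs0 mulr0.
rewrite gE'; apply: le_trans (cauchy_schwarz gh (hardyB f1h Ph)) _; rewrite gn.
have : hnorm (f1 - P) <= e / (hnorm g + 1).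
  rewrite -ler_sqr ?nnegrE ?hnorm_ge0 ?divr_ge0 ?(ltW e0) ?(ltW X0)//.
  apply: le_trans hN; rewrite theta_bessel// hnorm_monf expr1n lerD2l lerN2 /A big_imfset /=; last first.
    by move=> q r _ _ /ffunP/(_ i); rewrite !ffunE eqxx => /val_inj.
  (* [theta_coef] of [z_i^M] at exponent [q] is the conjugate of the coefficient of [theta] at
     [M - q], so the sum is reversed before the comparison. *)
  rewrite big_enum /= [X in _ <= X](reindex_inj rev_ord_inj) /=.
  have E (q : 'I_M.+1) : modulus (theta_coef f1 (axis i (M.+1 - q.+1))) ^+ 2 =
      modulus (taylor theta (axis i q)) ^+ 2.
    rewrite /theta_coef inner_conj//; last exact: hardy_mulf_monf.
    rewrite modulus_conj inner_monf; last exact: hardy_mulf_monf.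
    have qM : (q + (M - q))%N = M by rewrite subnKC// -ltnS.
    by have := taylor_mulf_axis (M - q) q; rewrite qM subSS => ->.
  apply: (@le_trans _ _ (\sum_(q < M.+1) modulus (taylor theta (axis i q)) ^+ 2)); last first.
    by rewrite le_eqVlt; apply/orP; left; apply/eqP; apply: eq_bigr => q _; symmetry; exact: E.
  apply: (@ler_sum_ord _ (fun q => modulus (taylor theta (axis i q)) ^+ 2)) => [|q].
    by rewrite /M -addSn ltnW// ltn_addr.
  exact: sqr_ge0.
rewrite ler_pdivlMr// => h1; apply: le_trans h1.
by rewrite mulrC ler_wpM2l ?hnorm_ge0// lerDl.
Qed.

Lemma sub_mulf_theta g : hardy g -> S (mulf theta g).
Proof.
move=> gh; apply: (submodule_closed hS) => [|e e0]; first exact: (theta_isometry gh).1.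
have e2 : 0 < e / 2 by rewrite divr_gt0.
have [N hN] := tail_small gh e2; exists (mulf theta (trunc g N)); first exact: sub_mulf_polyf.
have [_] := theta_isometry (hardyB gh (hardy_polyf (box N) (taylor g))).
by rewrite mulfB => ->; apply: le_lt_trans hN _; lra.
Qed.

(** By Bessel the [theta_coef f] are square summable, hence the Taylor coefficients of some [g];
    then [f - theta g] is in [S] and orthogonal to the whole family. *)
Lemma theta_range : S = [set (fun z => theta z * f z) | f in @hardy R n].
Proof.
apply/seteqP; split=> [f Sf|_ [g gh <-]]; last exact: sub_mulf_theta.
have fh := Sh Sf.
have bes : sqsum_le (theta_coef f) (hnorm f ^+ 2).
  by move=> A; rewrite -subr_ge0 -theta_bessel// sqr_ge0.
have [g gh gc] := sqsum_series bes; exists g => //; rewrite -/(mulf theta g).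
have [tgh _] := theta_isometry gh.
apply/esym/eqP; rewrite -subr_eq0; apply/eqP.
apply: theta_complete; first by apply: (subB hS) => //; exact: sub_mulf_theta.
move=> a; have tah := hardy_mulf_monf a th.
rewrite /theta_coef innerBl// inner_mulf ?inner_monf//; last 2 first.
- by move=> h /theta_isometry[].
- exact: hardy_monf.
by rewrite (taylor_series gc) subrr.
Qed.

End Generator.
(** Pairing an element of [S] with [t0], the projection of [z_i^m], reads off its coefficient at
    [z_i^m]. Setting [z_j = 0] keeps that coefficient and [ev j] is self-adjoint, so [ev j t0] and
    [t0] have the same pairings with [S], hence coincide. An element with nonzero coefficient shows
    [t0 <> 0]. *)
Lemma generator_exists : (exists2 f, S f & f <> 0) -> exists theta,
  [/\ analytic theta, (forall z, modulus (theta z) <= 1), hnorm theta = 1,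
      depends_only_on i theta & S = [set (fun z => theta z * f z) | f in @hardy R n]].
Proof.
move=> /first_index[m [[f1 Sf1 f1m] mmin]].
have mh := hardy_monf (axis i m) : hardy (monf (axis i m) : polydisc R n -> C).
pose t0 := orth_proj S (monf (axis i m)).
have St0 : S t0 := (orth_projP hS mh).1; have t0h := Sh St0.
have it0 f : S f -> inner f t0 = taylor f (axis i m).
  move=> Sf; have fh := Sh Sf.
  by rewrite inner_conj// (orth_proj_inner hS)// -inner_conj// inner_monf.
have et0 j : j <> i -> ev j t0 = t0.
  move=> ji; apply: (inner_sub_eq hS) => [||s Ss]; [exact: (red ji St0).1|by []|].
  have sh := Sh Ss; rewrite -inner_ev// !it0//; last exact: (red ji Ss).1.
  by rewrite taylor_ev// /ev_coef ffunE; case: (eqVneq j i).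
have n0 : hnorm t0 != 0.
  apply/eqP => n0; move: f1m; rewrite -it0// (hnorm_eq0 t0h n0).
  have f1h := Sh Sf1; have z0 := @hardy0 R n.
  by rewrite inner_conj// inner0l// conjc0 eqxx.
pose a : C := Complex (hnorm t0)^-1 0; pose t := a *: t0.
have St : S t by exact: (subZ hS).
have et j : j <> i -> ev j t = t by move=> ji; rewrite /t -{2}(et0 j ji).
(* The normalising factor of [t] is where the constant [K] of the section on the orthonormal family
   comes from. *)
have it f : S f -> inner f t = conjc a * taylor f (axis i m).
  by move=> Sf; rewrite /t innerZr ?it0//; exact: Sh.
have hn1 : hnorm t = 1.
  by rewrite /t hnormZ// /a modulus_real ger0_norm ?invr_ge0 ?hnorm_ge0// mulVf.
have t1 : inner t t = 1 by rewrite inner_self ?hn1 ?expr1n//; exact: Sh.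
have th := Sh St.
have iso := theta_isometry St et it t1 mmin.
exists t; split=> //; first exact: th.1.
- exact: isometry_bounded.
- exact: depends_only_onP.
- exact: theta_range et it t1 mmin.
Qed.

End Fixed.
End Wandering.

(** * Radial limits *)

Section Poisson.
Context {R : realType} {n : nat}.
Local Notation C := (Cplx R).
Local Notation mi := {ffun 'I_n -> nat}.
Local Notation P := (uniform_prob (@twopi_gt0 R)).
Local Notation TR := (n.-tuple (measurableTypeR R)).
Local Notation mu := (torus_measure R n).

(** Coordinates are peeled off one at a time; those on which the function does not depend integrate
    to 1. *)
Lemma torus_marginal m (i : 'I_m) (f : measurableTypeR R -> \bar R) :
  measurable_fun [set: measurableTypeR R] f -> (forall x, (0 <= f x)%E) ->
  (\int[torus_measure R m]_t f (tnth t i) = \int[P]_x f x)%E.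
Proof.
move=> mf f0; elim: m i => [[]//|m IH] i.
rewrite /torus_measure ge0_integral_power_prob; last 2 first.
- by apply: (measurableT_comp mf); exact: measurable_tnth.
- by move=> t; exact: f0.
case: (unliftP ord0 i) => [k|] ->.
  rewrite -(IH k); apply: eq_integral => y _.
  under eq_integral => x _ do rewrite /tcons /= tnthS.
  rewrite integral_cst//; set X := f _.
  by rewrite -[RHS]mule1; congr (_ * _)%E; exact: uniform_setT.
under eq_integral => y _ do under eq_integral => x _ do rewrite /tcons /= tnth0.
rewrite integral_cst//; set X := (\int[_]_x _)%E.
by rewrite -[RHS]mule1; congr (_ * _)%E; exact: torus_setT.
Qed.

Lemma uniform_negligible (E : set R) :
  (@lebesgue_measure R).-negligible E -> P.-negligible E.
Proof.
move=> [A [mA A0 EA]]; exists A; split=> //.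
by move/null_content_dominatesP: (dominates_uniform_prob (@twopi_gt0 R)); exact.
Qed.

Lemma torus_negligible m (i : 'I_m) (E : set R) : P.-negligible E ->
  (torus_measure R m).-negligible [set t | E (tnth t i)].
Proof.
move=> [A [mA P0 EA]].
exists [set t | A (tnth t i)]; split; last by move=> t /EA.
  by rewrite -[X in measurable X]setTI; exact: (@measurable_tnth _ _ m i measurableT).
rewrite -P0 -[in RHS](setIT A) -integral_indic// -(torus_marginal i); last 2 first.
- by apply/measurable_EFinP; exact: measurable_indic.
- by move=> x; rewrite lee_fin.
have mB : measurable ([set t | A (tnth t i)] : set (m.-tuple (measurableTypeR R))).
  by rewrite -[X in measurable X]setTI; exact: (@measurable_tnth _ _ m i measurableT).
transitivity (\int[torus_measure R m]_t (\1_[set t | A (tnth t i)] t)%:E)%E => //.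
by rewrite integral_indic// setIT.
Qed.

(* The Poisson kernel truncated at order [L]: it reproduces polynomials of degree at
   most [L] exactly. *)
Definition poisson_trunc (r : R) (L : nat) (v : R) : R :=
  1 + 2 * \sum_(l < L) r ^+ l.+1 * cos (l.+1%:R * v).

Variable i : 'I_n.

Lemma char_axis p t : char (axis i p) t = cis (tnth t i) ^+ p :> C.
Proof.
rewrite /char (bigD1 i)//= ffunE eqxx big1 ?mulr1// => j /negbTE ji.
by rewrite ffunE ji expr0.
Qed.

Lemma axis_eq p q : (axis i p == axis i q) = (p == q).
Proof.
apply/eqP/eqP => [/ffunP/(_ i)|->//]; by rewrite !ffunE eqxx.
Qed.

(** In terms of characters the product has frequency [p] from the constant 1 of the kernel, and
    [p + l + 1] and [p - l - 1] from its cosines. Only frequency 0 survives, and it occurs among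
    these because [p <= L]. The integral is over the n-torus, where orthogonality is already
    known. *)
Lemma poisson_trunc_integral (b : C) p L (r t0 : R) : (p <= L)%N ->
  mu.-integrable setT (EFin \o (fun t : TR =>
    complex.Re (b * cis (tnth t i) ^+ p) * poisson_trunc r L (t0 - tnth t i))) /\
  \int[mu]_t (complex.Re (b * cis (tnth t i) ^+ p) * poisson_trunc r L (t0 - tnth t i)) =
  complex.Re (b * (Complex r 0 * cis t0) ^+ p).
Proof.
move=> pL.
pose A l : C := b * Complex (r ^+ l.+1) 0 * cis (- (l.+1%:R * t0)).
pose B l : C := b * Complex (r ^+ l.+1) 0 * cis (l.+1%:R * t0).
pose F (l : 'I_L) (t : TR) := complex.Re (A l * (char (axis i (p + l.+1)%N) t * conjc (char (axis i 0) t))) +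
  complex.Re (B l * (char (axis i p) t * conjc (char (axis i l.+1) t))).
pose F0 (t : TR) := complex.Re (b * (char (axis i p) t * conjc (char (axis i 0) t))).
have E t : complex.Re (b * cis (tnth t i) ^+ p) * poisson_trunc r L (t0 - tnth t i) =
    F0 t + \sum_(l < L) F l t.
  rewrite /poisson_trunc mulrDr mulr1 /F0 !char_axis expr0 conjc1 mulr1; congr (_ + _).
  rewrite mulrA mulr_sumr; apply: eq_bigr => l _.
  rewrite /F !char_axis expr0 conjc1 mulr1 !cisX cis_conj /A /B.
  set u := tnth t i; set x := l.+1%:R.
  have -> : b * Complex (r ^+ l.+1) 0 * cis (- (x * t0)) * cis ((p + l.+1)%:R * u) =
     (b * cis (p%:R * u)) * Complex (r ^+ l.+1) 0 * cis (- (x * (t0 - u))).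
    have -> : (p + l.+1)%:R * u = p%:R * u + x * u by rewrite natrD mulrDl.
    have -> : - (x * (t0 - u)) = - (x * t0) + x * u by ring.
    rewrite !cisD; ring.
  have -> : b * Complex (r ^+ l.+1) 0 * cis (x * t0) * (cis (p%:R * u) * cis (- (x * u))) =
     (b * cis (p%:R * u)) * Complex (r ^+ l.+1) 0 * cis (x * (t0 - u)).
    have -> : x * (t0 - u) = x * t0 + - (x * u) by ring.
    rewrite !cisD; ring.
  rewrite -ReD -mulrDr; set X := b * cis _; set v := x * (t0 - u).
  have -> : cis (- v) + cis v = Complex (2 * cos v) 0 :> C.
    by rewrite /cis cosN sinN; apply: complex_eq; rewrite ?ReD ?ImD /=; ring.
  by rewrite -mulrA !ReM /= !mulr0 !subr0; ring.
have iF0 : mu.-integrable setT (EFin \o F0) /\ \int[mu]_t F0 t = (p == 0%N)%:R * complex.Re b.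
  by have := @Rintegral_Re_char R n b (axis i p) (axis i 0); rewrite axis_eq.
have iF l : mu.-integrable setT (EFin \o F l) /\ \int[mu]_t F l t = (p == l.+1)%:R * complex.Re (B l).
  have [i1 e1] := @Rintegral_Re_char R n (A l) (axis i (p + l.+1)%N) (axis i 0).
  have [i2 e2] := @Rintegral_Re_char R n (B l) (axis i p) (axis i l.+1).
  split; first exact: (integrableD measurableT i1 i2).
  rewrite /F RintegralD// e1 e2 !axis_eq addnS /= mul0r add0r.
  by [].
have [iS eS] := @Rintegral_sum R n _ (index_enum 'I_L) F (fun l => (iF l).1).
have -> : (fun t : TR => complex.Re (b * cis (tnth t i) ^+ p) * poisson_trunc r L (t0 - tnth t i)) =
   (fun t => F0 t + \sum_(l < L) F l t) by apply/funext.
split; first exact: (integrableD measurableT iF0.1 iS).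
rewrite RintegralD//; last exact: iF0.1.
rewrite eS iF0.2 (eq_bigr _ (fun l _ => (iF l).2)).
case: p pL {E F0 F iF0 iF iS eS} => [_|p pL].
  by rewrite mul1r big1 ?addr0 ?expr0 ?mulr1// => l _; rewrite mul0r.
rewrite mul0r add0r (bigD1 (Ordinal pL))//= eqxx mul1r big1 ?addr0; last first.
  by move=> l lp; rewrite eqSS; case: eqP => [pl|_]; [case/eqP: lp; exact/val_inj|rewrite mul0r].
rewrite /B exprMn cisX; congr complex.Re; rewrite -mulrA; congr (_ * (_ * _)).
by rewrite -[LHS]/(real_complex R _) rmorphXn.
Qed.

Lemma continuous_measurableR (f : R -> R) : continuous f ->
  measurable_fun [set: measurableTypeR R] f.
Proof. by move=> cf; exact: continuous_measurable_fun. Qed.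

Lemma continuous_sum (I : Type) (s : seq I) (F : I -> R -> R) :
  (forall x, continuous (F x)) -> continuous (fun u => \sum_(x <- s) F x u).
Proof.
move=> cF; elim: s => [|x s IH] u.
  have -> : (fun u => \sum_(x <- [::]) F x u) = (fun=> 0) by apply/funext => v; rewrite big_nil.
  exact: cvg_cst.
have -> : (fun u => \sum_(y <- x :: s) F y u) = F x \+ (fun u => \sum_(y <- s) F y u).
  by apply/funext => v; rewrite big_cons.
by apply: cvgD; [exact: cF|exact: IH].
Qed.

Lemma continuous_cos_affine (a b : R) : continuous (fun u : R => cos (a * u + b)).
Proof.
move=> x; have cl : continuous (fun x : R => a * x + b).
  by move=> y; apply: cvgD; [apply: cvgM; [exact: cvg_cst|exact: cvg_id]|exact: cvg_cst].
exact: (continuous_comp (cl x) (@continuous_cos _ _)).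
Qed.

Lemma continuous_dirichlet (r : R) L t0 : continuous (fun u => poisson_trunc r L (t0 - u)).
Proof.
move=> u; rewrite /poisson_trunc; apply: cvgD; first exact: cvg_cst.
apply: cvgM; first exact: cvg_cst.
apply: (@continuous_sum _ _ (fun (l : 'I_L) u => r ^+ l.+1 * cos (l.+1%:R * (t0 - u)))) => l x.
apply: cvgM; first exact: cvg_cst.
suff : continuous (fun u : R => cos (l.+1%:R * (t0 - u))) by exact.
have -> : (fun u => cos (l.+1%:R * (t0 - u))) = (fun u => cos (- l.+1%:R * u + l.+1%:R * t0)).
  by apply/funext => y; congr cos; ring.
exact: continuous_cos_affine.
Qed.

Lemma measurable_dirichlet (r : R) L t0 :
  measurable_fun [set: measurableTypeR R] (fun u => `|poisson_trunc r L (t0 - u)|).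
Proof.
apply: measurableT_comp => //.
exact: (continuous_measurableR (@continuous_dirichlet r L t0)).
Qed.

Lemma measurable_modulus_poly N (c : nat -> C) :
  measurable_fun [set: measurableTypeR R] (fun u => modulus (\sum_(p < N) c p * cis u ^+ p)).
Proof.
have cE u p : cis u ^+ p = cis (p%:R * u + 0) :> C by rewrite cisX addr0.
have cC (a : C) p : continuous (fun u => complex.Re (a * cis u ^+ p)).
  have -> : (fun u => complex.Re (a * cis u ^+ p)) = (fun u => complex.Re a * cos (p%:R * u + 0) +
     complex.Im a * cos (p%:R * u + (0 + pi / 2))).
    by apply/funext => u; rewrite cE Re_mul_cis addrA.
  move=> x; apply: cvgD; apply: cvgM; try exact: cvg_cst; exact: continuous_cos_affine.
have mRe (a : C) : measurable_fun [set: measurableTypeR R]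
    (fun u => complex.Re (a * \sum_(p < N) c p * cis u ^+ p)).
  apply: continuous_measurableR.
  have -> : (fun u => complex.Re (a * \sum_(p < N) c p * cis u ^+ p)) =
      (fun u => \sum_(p < N) complex.Re (a * c p * cis u ^+ p)).
    by apply/funext => u; rewrite mulr_sumr Re_sum; apply: eq_bigr => p _; rewrite mulrA.
  apply: (@continuous_sum _ _ (fun (p : 'I_N) u => complex.Re (a * c p * cis u ^+ p))) => p.
  exact: cC.
have -> : (fun u => modulus (\sum_(p < N) c p * cis u ^+ p)) =
  (fun u => Num.sqrt (complex.Re (1 * \sum_(p < N) c p * cis u ^+ p) ^+ 2 +
     complex.Re (- Complex 0 1 * \sum_(p < N) c p * cis u ^+ p) ^+ 2)).
  apply/funext => u; rewrite -[LHS]ger0_norm ?modulus_ge0// -sqrtr_sqr sqr_modulus mul1r.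
  by congr (Num.sqrt (_ + _ ^+ 2)); rewrite ReM /=; ring.
apply: measurableT_comp.
  by apply: continuous_measurable_fun; exact: sqrt_continuous.
by apply: measurable_funD; apply: measurable_funX; exact: mRe.
Qed.

Lemma le_integral_marginal (f : TR -> R) (g : R -> R) :
  mu.-integrable setT (EFin \o f) -> measurable_fun [set: measurableTypeR R] g ->
  (forall t, `|f t| <= g (tnth t i)) ->
  ((\int[mu]_t f t)%:E <= \int[P]_u (g u)%:E)%E.
Proof.
move=> fi mg fg; have g0 u : 0 <= g u.
  by have := fg [tuple of nseq n u]; rewrite tnth_nseq; apply: le_trans.
have mEg : measurable_fun [set: measurableTypeR R] (EFin \o g) by exact/measurable_EFinP.
rewrite -(torus_marginal i mEg) => [|u]; last by rewrite lee_fin.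
rewrite /Rintegral fineK; last exact: integrable_fin_num.
apply: le_trans (lee_abs _) _; apply: le_trans (le_abse_integral _ _ _) _ => //.
  by case/integrableP: fi.
apply: ge0_le_integral => //.
- by apply: measurableT_comp => //; case/integrableP: fi.
- by apply: (measurableT_comp mEg); exact: measurable_tnth.
- by move=> t _; rewrite /= lee_fin.
Qed.

(** Reproduction is about real parts, so the value [w] is first rotated to its modulus by a
    unimodular factor [a]. The condition [N <= L.+1] makes the kernel exact on degrees below [N]. *)
Lemma poisson_le N (c : nat -> C) L (r t0 : R) : (N <= L.+1)%N ->
  ((modulus (\sum_(p < N) c p * (Complex r 0 * cis t0) ^+ p))%:E <=
  \int[P]_u (modulus (\sum_(p < N) c p * cis u ^+ p) * `|poisson_trunc r L (t0 - u)|)%:E)%E.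
Proof.
move=> NL; set w := \sum_(p < N) _.
pose S u := \sum_(p < N) c p * cis u ^+ p.
pose a : C := conjc w / Complex (modulus w) 0.
have [w0|w0] := eqVneq w 0.
  rewrite w0 modulus0; apply: integral_ge0 => u _.
  by rewrite lee_fin mulr_ge0// modulus_ge0.
have mw : 0 < modulus w by rewrite modulus_gt0.
have cw : Complex (modulus w) 0 != 0 :> C by rewrite -modulus_eq0 modulus_real normr_eq0 gt_eqF.
have a1 : modulus a = 1.
  by rewrite /a modulusM modulusV modulus_conj modulus_real gtr0_norm// mulfV// gt_eqF.
have aw : complex.Re (a * w) = modulus w.
  suff -> : a * w = Complex (modulus w) 0 by [].
  rewrite /a mulrAC [conjc w * w]mulrC mulr_conj; apply: (mulIf cw); rewrite mulfVK//.
  by apply: complex_eq; rewrite ?ReM ?ImM /= ?mulr0 ?mul0r ?subr0 ?addr0// expr2.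
pose G (p : 'I_N) (t : TR) := complex.Re (a * c p * cis (tnth t i) ^+ p) * poisson_trunc r L (t0 - tnth t i).
have iG p : mu.-integrable setT (EFin \o G p) /\
    \int[mu]_t G p t = complex.Re (a * c p * (Complex r 0 * cis t0) ^+ p).
  by apply: poisson_trunc_integral; rewrite -ltnS; apply: leq_trans NL.
have [iS eS] := @Rintegral_sum R n _ (index_enum 'I_N) G (fun l => (iG l).1).
have wE : modulus w = \int[mu]_t \sum_(p < N) G p t.
  rewrite eS -aw /w mulr_sumr Re_sum; apply: eq_bigr => p _.
  by rewrite (iG p).2 mulrA.
have GE t : \sum_(p < N) G p t = complex.Re (a * S (tnth t i)) * poisson_trunc r L (t0 - tnth t i).
  by rewrite /S mulr_sumr Re_sum mulr_suml; apply: eq_bigr => p _; rewrite mulrA.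
have mS := measurable_modulus_poly N c.
have mD := measurable_dirichlet r L t0.
have mSD : measurable_fun [set: measurableTypeR R]
    (fun u => modulus (S u) * `|poisson_trunc r L (t0 - u)|).
  exact: measurable_funM.
rewrite wE; apply: (le_integral_marginal iS mSD) => t.
rewrite GE normrM; apply: ler_wpM2r; first exact: normr_ge0.
by apply: le_trans (Re_le_modulus _) _; rewrite modulusM a1 mul1r.
Qed.

End Poisson.

(** * Kernel estimates and the maximal function on the line *)

Section Maximal.
Context {R : realType}.
Local Notation C := (Cplx R).
Local Notation leb := (@lebesgue_measure R).

(** On [[0, 1]] the mean value theorem gives the slope [cos 1]; on [[1, b]] the sine has a positive
    minimum, divided by [pi] to become a slope. *)
Lemma sin_ge_linear (b : R) : 0 < b < pi ->
  exists2 c : R, 0 < c & forall y, 0 <= y <= b -> c * y <= sin y.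
Proof.
move=> /andP[b0 bpi].
have pi2 := pi_ge2 R.
have small (y : R) : 0 <= y <= 1 -> cos 1 * y <= sin y.
  move=> /andP[y0 y1]; have [->|yn] := eqVneq y 0; first by rewrite mulr0 sin0.
  have yp : 0 < y by rewrite lt_def yn.
  have [|x /[!in_itv]/= /andP[x0 xy]] := MVT yp (fun x _ => is_derive_sin x).
    by apply: continuous_subspaceT => x; exact: continuous_sin.
  rewrite sin0 !subr0 => ->; rewrite ler_wpM2r// ltW// ltr_cos ?in_itv/=; lra.
have [b1|b1] := leP b 1.
  by exists (cos 1); [exact: cos1_gt0|move=> y /andP[y0 yb]; apply: small; lra].
have [m /[!in_itv]/= /andP[m1 mb] hm] : exists2 m : R, m \in `[1, b] &
    forall t : R, t \in `[1, b] -> sin m <= sin t.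
  apply: EVT_min; first exact: ltW.
  by apply: continuous_subspaceT => x; exact: continuous_sin.
have sm : 0 < sin m by apply: sin_gt0_pi; lra.
exists (Num.min (cos 1) (sin m / pi)).
  by rewrite lt_min cos1_gt0 divr_gt0// pi_gt0.
move=> y /andP[y0 yb]; have [y1|y1] := leP y 1.
  apply: le_trans (small y _); last by rewrite y0.
  by rewrite ler_wpM2r// ge_min lexx.
apply: le_trans (hm y _); last by rewrite in_itv /= yb ltW.
apply: (@le_trans _ _ (sin m / pi * y)); first by rewrite ler_wpM2r// ge_min lexx orbT.
by rewrite mulrAC ler_pdivrMr ?pi_gt0// ler_wpM2l ?(ltW sm)//; lra.
Qed.

(** From [1 - cos v = 2 sin^2 (v / 2)]. The cosine returns to 1 at [2 pi], whence the margin [eta];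
    the cap [c <= 1] serves in [poisson_trunc_le]. *)
Lemma one_sub_cos_ge (eta : R) : 0 < eta < 2 * pi ->
  exists2 c : R, 0 < c <= 1 & forall v, `|v| <= 2 * pi - eta -> c * v ^+ 2 <= 1 - cos v.
Proof.
move=> /andP[e0 epi]; have [|c c0 hc] := @sin_ge_linear (pi - eta / 2); first lra.
exists (Num.min 1 (c ^+ 2 / 2)); first by rewrite lt_min ltr01 divr_gt0 ?exprn_gt0//= ge_min lexx.
move=> v hv; apply: (@le_trans _ _ (c ^+ 2 / 2 * v ^+ 2)).
  by rewrite ler_wpM2r ?sqr_ge0// ge_min lexx orbT.
have cosv : cos v = cos (`|v|) by case: (ger0P v) => // _; rewrite cosN.
pose y := `|v| / 2; have vE : `|v| = y + y by rewrite /y; lra.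
have y0 : 0 <= y by rewrite divr_ge0.
have := hc y; rewrite y0 /= /y => /(_ _) h.
have {}h : c * y <= sin y by apply: h; lra.
have cy0 : 0 <= c * y by rewrite mulr_ge0// ltW.
have h2 : (c * y) ^+ 2 <= sin y ^+ 2 by rewrite lerXn2r ?nnegrE// (le_trans cy0).
rewrite cosv vE cosD -!expr2 -(real_normK (num_real v)) vE cos2sin2.
move: h2; rewrite !expr2; set s := sin y; nra.
Qed.

Lemma Re_mul2 (z : C) : complex.Re (2 * z) = 2 * complex.Re z.
Proof. have -> : 2 * z = z + z by ring. by rewrite ReD; ring. Qed.

(** Geometric summation of [1 + 2 (x + ... + x^L)]. Without the remainder in [x ^+ L.+1] this is the
    closed form [(1 - r^2) / |1 - x|^2] of the full Poisson kernel. *)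
Lemma poisson_trunc_identity (r : R) L v : let x : C := Complex r 0 * cis v in
  poisson_trunc r L v * modulus (1 - x) ^+ 2 =
  (1 - r ^+ 2) - 2 * complex.Re (x ^+ L.+1 * conjc (1 - x)).
Proof.
move=> x.
have xE l : x ^+ l = Complex (r ^+ l) 0 * cis (l%:R * v).
  by rewrite exprMn cisX; congr (_ * _); rewrite -[RHS]/(real_complex R _) rmorphXn.
have DE : poisson_trunc r L v = complex.Re (1 + 2 * \sum_(l < L) x ^+ l.+1).
  rewrite /poisson_trunc ReD; congr (_ + _).
  by rewrite Re_mul2 Re_sum; congr (_ * _); apply: eq_bigr => l _; rewrite xE ReM /= mul0r subr0.
have KE : (1 + 2 * \sum_(l < L) x ^+ l.+1) * (1 - x) = 1 + x - 2 * x ^+ L.+1.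
  elim: L {DE} => [|L IH]; first by rewrite big_ord0; ring.
  rewrite big_ord_recr /=; set Y := \sum_(l < L) _ in IH *.
  have -> : (1 + 2 * (Y + x ^+ L.+1)) * (1 - x) = (1 + 2 * Y) * (1 - x) + 2 * x ^+ L.+1 * (1 - x) by ring.
  by rewrite IH [x ^+ L.+2]exprS; ring.
have q : (1 - x) * conjc (1 - x) = Complex (modulus (1 - x) ^+ 2) 0 := mulr_conj _.
have -> : poisson_trunc r L v * modulus (1 - x) ^+ 2 =
    complex.Re ((1 + x - 2 * x ^+ L.+1) * conjc (1 - x)).
  by rewrite -KE -mulrA q DE ReM /= mulr0 subr0.
have rE : r ^+ 2 = complex.Re x ^+ 2 + complex.Im x ^+ 2.
  rewrite /x ReM ImM /= !mul0r subr0 addr0 !exprMn -mulrDr addrC.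
  by rewrite [X in _ * X](_ : _ = 1) ?mulr1// addrC cos2Dsin2.
rewrite rE; set X := x ^+ L.+1.
have -> : (1 + x - 2 * X) * conjc (1 - x) = (1 + x) * conjc (1 - x) - 2 * (X * conjc (1 - x)) by ring.
rewrite ReB; congr (_ - _).
  by rewrite !(ReM, Re_conj, Im_conj, ReD, ImD, ReB, ImB) /=; ring.
by rewrite Re_mul2.
Qed.

(** The numerator is at most [3 (1 - r)]: two for [1 - r^2] and one for the truncation remainder, by
    the condition on [L]. The condition [2^-1 <= r] keeps the factor [2 r] of [1 - cos v] at least
    1. *)
Lemma poisson_trunc_le (c r : R) L v : 0 < c <= 1 -> 2^-1 <= r < 1 -> 4 * r ^+ L.+1 <= 1 - r ->
  c * v ^+ 2 <= 1 - cos v ->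
  `|poisson_trunc r L v| <= 3 / c * ((1 - r) / ((1 - r) ^+ 2 + v ^+ 2)).
Proof.
move=> /andP[c0 c1] /andP[r2 r1] hL hc; set dl := 1 - r; pose x : C := Complex r 0 * cis v.
have dl0 : 0 < dl by rewrite subr_gt0.
have r0 : 0 <= r by apply: le_trans r2; rewrite invr_ge0.
have qE : modulus (1 - x) ^+ 2 = dl ^+ 2 + 2 * r * (1 - cos v).
  have e : cos v ^+ 2 + sin v ^+ 2 = 1 by exact: cos2Dsin2.
  have -> : modulus (1 - x) ^+ 2 = (1 - r * cos v) ^+ 2 + (r * sin v) ^+ 2.
    by rewrite sqr_modulus ReB ImB /x ReM ImM /= !mul0r subr0 addr0 sub0r sqrrN.
  have -> : (1 - r * cos v) ^+ 2 + (r * sin v) ^+ 2 = 1 - 2 * r * cos v + r ^+ 2 * (cos v ^+ 2 + sin v ^+ 2) by ring.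
  by rewrite e /dl; ring.
have v0 : 0 <= v ^+ 2 by exact: sqr_ge0.
have q1 : c * (dl ^+ 2 + v ^+ 2) <= modulus (1 - x) ^+ 2.
  rewrite qE; have : 0 <= dl ^+ 2 by exact: sqr_ge0.
  have : 0 <= (2 * r - 1) * (1 - cos v).
    by rewrite mulr_ge0//; rewrite ?subr_ge0 ?cos_le1//; lra.
  move: hc; set D2 := dl ^+ 2; nra.
have d20 : 0 < dl ^+ 2 + v ^+ 2 by rewrite ltr_pwDl// exprn_gt0.
have q0 : 0 < modulus (1 - x) ^+ 2 by apply: lt_le_trans q1; rewrite mulr_gt0.
have mx : modulus x = r by rewrite /x modulusM modulus_cis mulr1 modulus_real ger0_norm.
have Dq : `|poisson_trunc r L v| * modulus (1 - x) ^+ 2 <= 3 * dl.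
  rewrite -[X in _ * X]ger0_norm ?sqr_ge0// -normrM poisson_trunc_identity -/x.
  have h1 : `|complex.Re (x ^+ L.+1 * conjc (1 - x))| <= r ^+ L.+1 * 2.
    apply: le_trans (Re_le_modulus _) _; rewrite modulusM modulus_conj modulusX mx.
    rewrite ler_wpM2l ?exprn_ge0//; apply: le_trans (modulusD _ _) _.
    by rewrite modulusN modulus1 mx; lra.
  apply: le_trans (ler_normB _ _) _; rewrite normrM (ger0_norm (_ : 0 <= 2))//.
  have r21 : r ^+ 2 <= 1 by rewrite exprn_ile1// ltW.
  rewrite (ger0_norm (_ : 0 <= 1 - r ^+ 2)) ?subr_ge0//.
  have : 1 - r ^+ 2 <= 2 * dl by rewrite /dl; nra.
  rewrite /dl in hL *; lra.
have := ler_wpM2l (normr_ge0 (poisson_trunc r L v)) q1 => h.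
have {h Dq} h := le_trans h Dq.
rewrite mulrA ler_pdivlMr// mulrAC ler_pdivlMr//.
by move: h; rewrite mulrCA mulrC.
Qed.

(** For the least [j] with [|v| < 2^j dl], one has [v^2 >= 4^(j - 1) dl^2] unless [j = 0], and the
    term of index [j] alone dominates; the factor 4 pays for the exponent [j - 1]. *)
Lemma dyadic_le (dl v : R) J : 0 < dl -> `|v| < 2 ^+ J * dl ->
  dl / (dl ^+ 2 + v ^+ 2) <=
  \sum_(j < J.+1) 4 / (4 ^+ j * dl) * (`|v| < 2 ^+ j * dl)%R%:R.
Proof.
move=> dl0 vJ; have ex : exists j, `|v| < 2 ^+ j * dl by exists J.
have v2 : 0 <= v ^+ 2 by exact: sqr_ge0.
have d2 : 0 < dl ^+ 2 by rewrite exprn_gt0.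
have t0 j : 0 <= 4 / (4 ^+ j * dl) * (`|v| < 2 ^+ j * dl)%R%:R.
  by rewrite mulr_ge0// divr_ge0// mulr_ge0 ?exprn_ge0// ltW.
have [j vj jmin] := ex_minnP ex.
have jJ : (j < J.+1)%N by rewrite ltnS; exact: jmin.
rewrite (bigD1 (Ordinal jJ))//= vj mulr1; apply: (@le_trans _ _ (4 / (4 ^+ j * dl))); last first.
  by rewrite lerDl sumr_ge0.
rewrite ler_pdivrMr ?ltr_pwDl// mulrAC ler_pdivlMr ?mulr_gt0 ?exprn_gt0//.
case: j {jJ vj} jmin => [jmin|j jmin]; first by rewrite expr0 mul1r -expr2; lra.
have : 2 ^+ j * dl <= `|v| by rewrite leNgt; apply/negP => /jmin; rewrite ltnn.
move=> h; have : (2 ^+ j * dl) ^+ 2 <= v ^+ 2.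
  by rewrite -[v ^+ 2]real_normK ?num_real// lerXn2r ?nnegrE ?mulr_ge0 ?exprn_ge0 ?(ltW dl0).
rewrite exprMn exprAC (_ : 2 ^+ 2 = 4 :> R); last by rewrite expr2; lra.
have -> : dl * (4 ^+ j.+1 * dl) = 4 * (4 ^+ j * dl ^+ 2) by rewrite exprS; ring.
by move=> h2; rewrite ler_pM2l//; apply: le_trans h2 _; rewrite lerDr ltW.
Qed.

(** [2 * a] is the length of the ball, the denominator in the average. *)
Lemma ball_le_maximal (f : R -> R) (t a : R) : (forall u, 0 <= f u) -> 0 < a ->
  (\int[leb]_(u in ball t a) (f u)%:E <= (2 * a)%:E * HL_maximal f t)%E.
Proof.
move=> f0 a0.
have : (iavg f (ball t a) <= HL_maximal f t)%E.
  by apply: ereal_sup_ubound; exists a => //=; rewrite in_itv/= a0.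
rewrite /iavg lebesgue_measure_ball ?(ltW a0)//.
have -> : (\int[leb]_(y in ball t a) `|(f y)%:E| = \int[leb]_(y in ball t a) (f y)%:E)%E.
  by apply: eq_integral => y _; rewrite abse_EFin ger0_norm.
have a20 : 0 < a *+ 2 by rewrite mulrn_wgt0.
rewrite inver gt_eqF// => h.
have := lee_wpmul2l (_ : (0 <= (2 * a)%:E)%E) h; rewrite lee_fin mulr_ge0 ?(ltW a0)// => /(_ isT).
by rewrite muleA -EFinM mulr_natl mulfV ?gt_eqF// mul1e.
Qed.

End Maximal.

Section MaximalBound.
Context {R : realType} {n : nat} (i : 'I_n).
Local Notation C := (Cplx R).
Local Notation leb := (@lebesgue_measure R).
Local Notation P := (uniform_prob (@twopi_gt0 R)).

Definition poly_circle N (c : nat -> C) (u : R) : R := modulus (\sum_(p < N) c p * cis u ^+ p).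

Lemma measurable_poly_circle N c : measurable_fun [set: measurableTypeR R] (poly_circle N c).
Proof. exact: measurable_modulus_poly. Qed.

Lemma poly_circle_le N c u : poly_circle N c u <= \sum_(p < N) modulus (c p).
Proof.
apply: le_trans (modulus_sum _ _ _) _; apply: ler_sum => p _.
by rewrite modulusM modulusX modulus_cis expr1n mulr1.
Qed.

(** The circle is cut open into an interval of the line; functions are extended by 0 outside it
    before the maximal function is taken. *)
Definition period : set R := `[0, 2 * pi]%classic.

Lemma measurable_period : measurable period.
Proof. exact: measurable_itv. Qed.

Lemma lebesgue_measure_period : leb period = (2 * pi)%:E.
Proof.
by rewrite /period (lebesgue_measure_itv `[0, 2 * pi]) /= lte_fin twopi_gt0 oppr0 addr0.
Qed.

Lemma integrable_poly_circle N c : leb.-integrable period (EFin \o poly_circle N c).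
Proof.
apply: measurable_bounded_integrable.
- exact: measurable_period.
- by rewrite [X in (X < _)%E]lebesgue_measure_period ltry.
- exact: measurable_funTS (measurable_poly_circle N c).
exists (\sum_(p < N) modulus (c p)); split; first exact: num_real.
move=> x Bx t _ /=; rewrite ger0_norm ?modulus_ge0//.
exact: le_trans (poly_circle_le N c t) (ltW Bx).
Qed.

Lemma locally_integrable_poly N c : locally_integrable setT (poly_circle N c \_ period).
Proof.
exact: (integrable_locally_restrict measurable_period (integrable_poly_circle N c)).
Qed.

(** The truncated kernel is dominated by weighted indicators of dyadic balls around [t], and the
    average over each ball by the maximal function at [t]; the weights add up to a constant
    independent of [r] and [N]. *)
Lemma maximal_bound (eta : R) : 0 < eta < 2 * pi -> exists2 K : R, 0 < K &
  forall N (c : nat -> C) t r, eta <= t <= 2 * pi - eta -> 2^-1 <= r < 1 ->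
  ((modulus (\sum_(p < N) c p * (Complex r 0 * cis t) ^+ p))%:E <=
   K%:E * HL_maximal (poly_circle N c \_ period) t)%E.
Proof.
move=> e01; have [k0 /andP[k00 k01] hk] := one_sub_cos_ge e01.
(* The ball of index [j] contributes [3 / k0] times [4 / (4^j dl)] times its length [2 * 2^j dl],
   that is [24 / k0 * 2^-j]; the geometric series doubles this. *)
exists (48 / k0) => [|N c t r /andP[t1 t2] r12]; first by rewrite divr_gt0.
have /andP[r2 r1] := r12; set dl := 1 - r; have dl0 : 0 < dl by rewrite subr_gt0.
have r0 : 0 <= r by apply: le_trans r2; rewrite invr_ge0.
have K0 : 0 < 48 / k0 by rewrite divr_gt0.
set f := poly_circle N c \_ period; set H := HL_maximal f t.
have f0 u : 0 <= f u by rewrite /f patchE; case: ifP => // _; exact: modulus_ge0.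
have mf : measurable_fun setT f by case: (locally_integrable_poly N c).
have H0 : (0 <= H)%E by apply: HL_maximalT_ge0; exact: locally_integrable_poly.
have [->|Hfin] := eqVneq H +oo%E; first by rewrite gt0_muley ?lte_fin// leey.
have {Hfin} [h HE] : exists h, H = h%:E.
  by exists (fine H); rewrite fineK// ge0_fin_numE// lt_neqAle Hfin leey.
(* [L] depends on [r] and [N], but the final bound does not involve it. *)
have [L [NL hL]] : exists L, (N <= L.+1)%N /\ 4 * r ^+ L.+1 <= dl.
  have : `|r| < 1 by rewrite ger0_norm.
  move=> /cvg_expr/cvgrPdist_le/(_ _ (divr_gt0 dl0 (_ : 0 < 4)))[//|M _ hM].
  exists (maxn N M); split; first by rewrite leqW// leq_maxl.
  have := hM (maxn N M).+1; rewrite /= leqW ?leq_maxr// => /(_ isT).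
  by rewrite sub0r normrN ger0_norm ?exprn_ge0// ler_pdivlMr// mulrC.
apply: le_trans (poisson_le i c r t NL) _.
have mD := measurable_dirichlet r L t; have mS := measurable_poly_circle N c.
rewrite integral_uniform; last 2 first.
- by apply/measurable_EFinP; exact: measurable_funM.
- by move=> u; rewrite lee_fin mulr_ge0// modulus_ge0.
(* Large enough for the last dyadic ball around [t] to contain the whole period. *)
have [J hJ] : exists J, 2 * pi < 2 ^+ J * dl.
  exists (Num.bound (2 * pi / dl)); rewrite -ltr_pdivrMr//.
  apply: lt_trans (archi_boundP _) _; first by rewrite divr_ge0 ?(ltW dl0)// ltW// twopi_gt0.
  by rewrite -natrX ltr_nat ltn_expl.
pose w j := 3 / k0 * (4 / (4 ^+ j * dl)).
have w0 j : 0 <= w j by rewrite mulr_ge0// divr_ge0 ?mulr_ge0 ?exprn_ge0 ?(ltW k00) ?(ltW dl0).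
pose F j : R -> \bar R := (EFin \o f) \_ (ball t (2 ^+ j * dl)).
have F0 j u : (0 <= F j u)%E by rewrite /F patchE; case: ifP => // _; rewrite /= lee_fin.
have mF j : measurable_fun setT (F j).
  apply/(measurable_restrictT _ _).1; first exact: measurable_ball.
  by apply: measurable_funTS; exact/measurable_EFinP.
have FEg j (u : R) : period u ->
    F j u = (poly_circle N c u * (`|t - u| < 2 ^+ j * dl)%R%:R)%:E.
  move=> up; rewrite /F patchE /=; have [hb|hb] := boolP (`|t - u| < 2 ^+ j * dl).
    by rewrite mem_set// mulr1 /f patchE mem_set.
  by rewrite memNset ?mulr0//; exact/negP.
have mwF j : measurable_fun setT (fun u => (w j)%:E * F j u)%E by exact: measurable_funeM.
have mWF : measurable_fun setT (fun u => \sum_(j < J.+1) (w j)%:E * F j u)%E.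
  by apply: emeasurable_sum => j; exact: mwF.
apply: (@le_trans _ _ (\int[leb]_(u in period) \sum_(j < J.+1) (w j)%:E * F j u)%E).
  (* The density [(2 pi)^-1] of the uniform law is simply bounded by 1. *)
  apply: (@le_trans _ _ (1 * \int[leb]_(u in period) (poly_circle N c u * `|poisson_trunc r L (t - u)|)%:E)%E).
    apply: lee_wpmul2r; first by apply: integral_ge0 => u _; rewrite lee_fin mulr_ge0// modulus_ge0.
    by rewrite lee_fin subr0 invf_le1 ?twopi_gt0//; have := pi_ge2 R; lra.
  rewrite mul1e; apply: ge0_le_integral; first exact: measurable_period.
  - by move=> u _; rewrite lee_fin mulr_ge0// modulus_ge0.
  - by apply: measurable_funTS; apply/measurable_EFinP; exact: measurable_funM.
  - by apply: measurable_funTS; exact: mWF.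
  move=> u up; have := up; rewrite /period /= in_itv /= => /andP[u0 u2].
  have v1 : `|t - u| <= 2 * pi - eta by rewrite ler_norml; lra.
  have v2 : `|t - u| < 2 ^+ J * dl by case/andP: e01 => e0 _; lra.
  have FE j := FEg j u up.
  under eq_bigr do rewrite FE -EFinM.
  rewrite sumEFin lee_fin; under eq_bigr do rewrite mulrCA.
  rewrite -mulr_sumr ler_wpM2l ?modulus_ge0//.
  have b1 : `|poisson_trunc r L (t - u)| <= 3 / k0 * (dl / (dl ^+ 2 + (t - u) ^+ 2)).
    by apply: poisson_trunc_le => //; [rewrite k00|exact: hk].
  apply: le_trans b1 _.
  apply: (@le_trans _ _ (3 / k0 * \sum_(j < J.+1) 4 / (4 ^+ j * dl) * (`|t - u| < 2 ^+ j * dl)%R%:R)).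
    by rewrite ler_wpM2l ?divr_ge0 ?(ltW k00)//; exact: dyadic_le.
  by rewrite mulr_sumr; apply: ler_sum => j _; rewrite /w mulrA.
apply: (@le_trans _ _ (\int[leb]_u \sum_(j < J.+1) (w j)%:E * F j u)%E).
  apply: ge0_subset_integral => //; first exact: measurable_period.
  by move=> u _; apply: sume_ge0 => j _; rewrite mule_ge0// lee_fin.
rewrite ge0_integral_sum//; last 2 first.
- exact: mwF.
- by move=> j u _; rewrite mule_ge0// lee_fin.
apply: (@le_trans _ _ (\sum_(j < J.+1) (w j * (2 * (2 ^+ j * dl)) * h)%:E)%E).
  apply: lee_sum => j _; rewrite ge0_integralZl ?lee_fin//; last exact: mF.
  rewrite -(mulrA (w j) _ h) [X in (_ <= X)%E]EFinM.
  apply: lee_wpmul2l; first by rewrite lee_fin.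
  rewrite EFinM -HE /H /F -integral_mkcond.
  by apply: ball_le_maximal => //; rewrite mulr_gt0// exprn_gt0.
rewrite sumEFin HE -EFinM lee_fin -mulr_suml ler_wpM2r//; first by rewrite -lee_fin -HE.
have wE j : w j * (2 * (2 ^+ j * dl)) = 24 / k0 * 2^-1 ^+ j.
  rewrite /w; have -> : 4 ^+ j = 2 ^+ j * 2 ^+ j :> R by rewrite -exprMn; congr (_ ^+ _); lra.
  have : 2 ^+ j != 0 :> R by rewrite expf_neq0// pnatr_eq0.
  by rewrite exprVn; move: (2 ^+ j) => X X0; field; rewrite X0 !gt_eqF.
rewrite (eq_bigr (fun j : 'I_J.+1 => 24 / k0 * 2^-1 ^+ j)); last by move=> j _; exact: wE.
rewrite -mulr_sumr.
have g := @geometric_le R 2^-1 J.+1 _.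
apply: (@le_trans _ _ (24 / k0 * (1 - 2^-1)^-1)).
  by rewrite ler_wpM2l ?divr_ge0 ?(ltW k00)//; apply: g; lra.
have -> : (1 - 2^-1)^-1 = 2 :> R by field.
by rewrite mulrAC; lra.
Qed.

End MaximalBound.

(** * Weak-type estimate in terms of the coefficients *)

Section WeakType.
Context {R : realType} {n : nat} (i : 'I_n).
Local Notation C := (Cplx R).
Local Notation leb := (@lebesgue_measure R).
Local Notation P := (uniform_prob (@twopi_gt0 R)).
Local Notation mu := (torus_measure R n).

(** Read off from the n-torus by placing the exponents on the axis [i] and taking the marginal. *)
Lemma parseval_circle N (c : nat -> C) :
  (\int[P]_u (poly_circle N c u ^+ 2)%:E = (\sum_(p < N) modulus (c p) ^+ 2)%:E)%E.
Proof.
have mS := measurable_poly_circle N c.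
pose A := [fset axis i (val p) | p in 'I_N]%fset.
have sumA (V : zmodType) (G : {ffun 'I_n -> nat} -> V) : \sum_(k <- A) G k = \sum_(p < N) G (axis i p).
  rewrite /A big_imfset /=; first by rewrite big_enum.
  by move=> p q _ _ /eqP; rewrite axis_eq => /eqP/val_inj.
pose a (k : {ffun 'I_n -> nat}) := c (k i).
have aE p : a (axis i p) = c p by rewrite /a ffunE eqxx.
have tE t : modulus (trig A a t) = poly_circle N c (tnth t i).
  by rewrite /trig sumA /poly_circle; congr modulus; apply: eq_bigr => p _; rewrite aE char_axis.
rewrite -(torus_marginal i); last 2 first.
- by apply/measurable_EFinP; exact: measurable_funX.
- by move=> u; rewrite lee_fin sqr_ge0.
have -> : \sum_(p < N) modulus (c p) ^+ 2 = \int[mu]_t (modulus (trig A a t) ^+ 2).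
  by rewrite Rintegral_trig sumA; apply: eq_bigr => p _; rewrite aE.
rewrite /Rintegral fineK.
  by apply: eq_integral => t _; rewrite tE.
apply: integrable_fin_num => //.
apply: (@integrable_torus_bounded _ _ _ ((\sum_(p < N) modulus (c p)) ^+ 2)).
  by apply: measurable_funX; exact: measurable_modulus_trig.
move=> t; rewrite ger0_norm ?sqr_ge0// tE lerXn2r ?nnegrE ?modulus_ge0 ?sumr_ge0//.
  by move=> p _; exact: modulus_ge0.
exact: poly_circle_le.
Qed.

(** An L^1 bound obtained from the L^2 bound by [x <= e / 2 + x^2 / (2 e)], integrated against the
    uniform law. *)
Lemma integral_poly_circle_le N (c : nat -> C) e : 0 < e ->
  \sum_(p < N) modulus (c p) ^+ 2 <= e ^+ 2 ->
  (\int[leb]_(u in period) (poly_circle N c u)%:E <= (2 * pi * e)%:E)%E.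
Proof.
move=> e0 he; have mS := measurable_poly_circle N c.
have S0 u : 0 <= poly_circle N c u by exact: modulus_ge0.
have pi0 : 0 < 2 * pi :> R := @twopi_gt0 R.
have mES : measurable_fun setT (EFin \o poly_circle N c) by exact/measurable_EFinP.
have PE : (\int[P]_u (poly_circle N c u)%:E = ((2 * pi)^-1)%:E *
    \int[leb]_(u in period) (poly_circle N c u)%:E)%E.
  by rewrite integral_uniform// ?subr0// => u; rewrite lee_fin.
suff h : (\int[P]_u (poly_circle N c u)%:E <= e%:E)%E.
  have := lee_wpmul2l (_ : (0 <= (2 * pi)%:E)%E) h; rewrite lee_fin (ltW pi0) => /(_ isT).
  by rewrite PE muleA -EFinM mulfV ?gt_eqF// mul1e EFinM.
have m2 : measurable_fun setT (fun u : measurableTypeR R => (poly_circle N c u ^+ 2)%:E).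
  by apply/measurable_EFinP; exact: measurable_funX.
apply: (@le_trans _ _ (\int[P]_u ((e / 2)%:E + (2 * e)^-1%:E * (poly_circle N c u ^+ 2)%:E))%E).
  apply: ge0_le_integral => //.
  - by move=> u _; rewrite lee_fin.
  - by apply: emeasurable_funD => //; exact: measurable_funeM.
  move=> u _; rewrite -EFinM -EFinD lee_fin; set x := poly_circle N c u.
  have : 0 <= (2 * e)^-1 * (x - e) ^+ 2 by rewrite mulr_ge0 ?sqr_ge0// invr_ge0; lra.
  have -> : (2 * e)^-1 * (x - e) ^+ 2 = e / 2 + (2 * e)^-1 * x ^+ 2 - x.
    by field; rewrite gt_eqF.
  by rewrite subr_ge0.
have e20 : 0 <= (2 * e)^-1 by rewrite invr_ge0; lra.
rewrite ge0_integralD//; last 3 first.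
- by move=> u _; rewrite lee_fin; lra.
- by move=> u _; rewrite -EFinM lee_fin mulr_ge0// sqr_ge0.
- exact: measurable_funeM.
rewrite ge0_integralZl//; last by move=> u _; rewrite lee_fin sqr_ge0.
rewrite parseval_circle integral_uniform_cst -EFinM -EFinD lee_fin.
have : (2 * e)^-1 * \sum_(p < N) modulus (c p) ^+ 2 <= (2 * e)^-1 * e ^+ 2 by rewrite ler_wpM2l.
have -> : (2 * e)^-1 * e ^+ 2 = e / 2 by field; rewrite gt_eqF.
lra.
Qed.

(** [3 / a] comes from the Hardy-Littlewood inequality on the line, [2 * pi * e] from the L^1 norm
    over the period. *)
Lemma weak_type N (c : nat -> C) e a : 0 < e -> 0 < a ->
  \sum_(p < N) modulus (c p) ^+ 2 <= e ^+ 2 ->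
  (leb [set t | HL_maximal (poly_circle N c \_ period) t > a%:E] <= (3 / a * (2 * pi * e))%:E)%E.
Proof.
move=> e0 a0 he; apply: le_trans (maximal_inequality (locally_integrable_poly N c) a0) _.
rewrite [X in (_ <= X)%E]EFinM; apply: lee_wpmul2l; first by rewrite lee_fin divr_ge0// ltW.
apply: le_trans (integral_poly_circle_le e0 he).
rewrite [X in (_ <= X)%E]integral_mkcond; apply: ge0_le_integral => //.
- have [mf _ _] := locally_integrable_poly N c.
  by apply: measurableT_comp => //; exact/measurable_EFinP.
- apply/(measurable_restrictT _ _).1; first exact: measurable_period.
  by apply: measurable_funTS; apply/measurable_EFinP; exact: measurable_poly_circle.
move=> u _; rewrite !patchE; case: ifP => _; last by rewrite [X in (X <= _)%E](_ : _ = 0%E)// -[LHS]/(`|0%:E|%E) abse0.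
by rewrite abse_EFin ger0_norm ?lexx//; exact: modulus_ge0.
Qed.

End WeakType.

(** * Almost everywhere control of the radial oscillation *)

Section RadialLimits.
Context {R : realType} {n : nat} (i : 'I_n).
Local Notation C := (Cplx R).
Local Notation leb := (@lebesgue_measure R).
Local Notation P := (uniform_prob (@twopi_gt0 R)).

Lemma hassum_nat (G : nat -> C) s e : hassum G s -> 0 < e ->
  exists M, forall N, (M <= N)%N -> modulus (\sum_(p < N) G p - s) < e.
Proof.
move=> Gs e0; have [A0 hA0] := Gs e e0.
exists (\max_(p <- A0) p.+1)%N => N MN.
pose A := [fset val p | p in 'I_N]%fset.
have -> : \sum_(p < N) G p = \sum_(p <- A) G p.
  by rewrite /A big_imfset /= ?big_enum// => p q _ _ /val_inj.
apply: hA0; apply/fsubsetP => p pA.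
have pN : (p < N)%N by apply: leq_trans MN; exact: (@leq_bigmax_seq _ (enum_fset A0) xpredT (fun p => p.+1) p pA isT).
by apply/imfsetP; exists (Ordinal pN).
Qed.

Lemma dist_expr (r r' : R) p : 0 <= r <= 1 -> 0 <= r' <= 1 -> `|r ^+ p - r' ^+ p| <= p%:R * `|r - r'|.
Proof.
move=> r01 r01'; elim: p => [|p IH]; first by rewrite !expr0 subrr normr0 mul0r.
have -> : r ^+ p.+1 - r' ^+ p.+1 = r * (r ^+ p - r' ^+ p) + (r - r') * r' ^+ p by rewrite !exprS; ring.
apply: le_trans (ler_normD _ _) _; rewrite !normrM -natr1 mulrDl mul1r.
case/andP: r01 => r0 r1; case/andP: r01' => r0' r1'.
apply: lerD.
  apply: le_trans IH; rewrite (ger0_norm r0) -[X in _ <= X]mul1r ler_wpM2r//.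
by rewrite [X in _ * X <= _]ger0_norm ?exprn_ge0// ler_piMr// exprn_ile1.
Qed.

(** Keeping the indices and zeroing the first [N] coefficients makes a difference of partial sums a
    polynomial to which [maximal_bound] and [weak_type] apply. *)
Definition tail_coef N (c : nat -> C) (p : nat) : C := if (N <= p)%N then c p else 0.

Lemma sum_tail (V : zmodType) N N' (G : nat -> V) : (N <= N')%N ->
  \sum_(p < N') (if (N <= p)%N then G p else 0) = \sum_(p < N') G p - \sum_(p < N) G p.
Proof.
move=> NN'; pose H p := if (p < N)%N then G p else 0.
have -> : \sum_(p < N) G p = \sum_(p < N') H p.
  rewrite (sum_ord_widen NN'); last by move=> l Nl; rewrite /H ltnNge Nl.
  by apply: eq_bigr => p _; rewrite /H ltn_ord.
rewrite -sumrB; apply: eq_bigr => p _; rewrite /H ltnNge.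
by case: ifP => _ /=; rewrite ?subr0 ?subrr.
Qed.

Lemma tail_coef_small (c : nat -> C) B e : (forall N, \sum_(p < N) modulus (c p) ^+ 2 <= B) -> 0 < e ->
  exists N, forall N', \sum_(p < N') modulus (tail_coef N c p) ^+ 2 <= e.
Proof.
move=> cB e0; pose T m := \sum_(p < m) modulus (c p) ^+ 2.
have Tmono : nondecreasing_seq T.
  by move=> m m' mm; apply: (ler_sum_ord (F := fun p => modulus (c p) ^+ 2)) => // l; exact: sqr_ge0.
have Tc : cvgn T by apply: nondecreasing_is_cvgn => //; exists B => _ [m _ <-]; exact: cB.
have Tle m : T m <= limn T by exact: nondecreasing_cvgn_le.
move/cvgrPdist_le: Tc => /(_ _ e0)[N _ hN]; exists N => N'.
have -> : \sum_(p < N') modulus (tail_coef N c p) ^+ 2 =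
    \sum_(p < N') (if (N <= p)%N then modulus (c p) ^+ 2 else 0).
  by apply: eq_bigr => p _; rewrite /tail_coef; case: ifP => // _; rewrite modulus0 expr0n.
have [NN'|N'N] := leqP N N'; last first.
  by rewrite big1 ?(ltW e0)// => p _; rewrite leqNgt (ltn_trans (ltn_ord p) N'N).
rewrite (sum_tail (fun p => modulus (c p) ^+ 2) NN') -/(T N') -/(T N).
have := hN N (leqnn N) => /=; rewrite ger0_norm ?subr_ge0//; have := Tle N'; lra.
Qed.

Variables (c : nat -> C) (B : R) (F : R -> R -> C).
Hypothesis cB : forall N, \sum_(p < N) modulus (c p) ^+ 2 <= B.
Hypothesis cF : forall r t, 0 <= r < 1 -> hassum (fun p => c p * (Complex r 0 * cis t) ^+ p) (F r t).

(** The Cauchy condition at the end of the radius, cut into one statement for each [lam]: for fixed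
    [lam] the exceptional set can be estimated. *)
Definition radial_cauchy (lam t : R) := exists2 r0, 0 <= r0 < 1 &
  forall r r', r0 <= r < 1 -> r0 <= r' < 1 -> modulus (F r t - F r' t) <= lam.

Lemma modulus_dist4 (x y a b : C) :
  modulus (x - y) <= modulus (x - a) + modulus (a - b) + modulus (y - b).
Proof.
have -> : x - y = (x - a) + (a - b) - (y - b) by ring.
by apply: le_trans (modulusD _ _) _; rewrite modulusN lerD2r modulusD.
Qed.

(** A polynomial is Lipschitz along the radius, with constant at most [X]; radii below 1/2 are
    excluded to match the range of [maximal_bound]. *)
Lemma poly_radial_cauchy N t lam : 0 < lam -> exists2 r0, 2^-1 <= r0 < 1 &
  forall r r', r0 <= r < 1 -> r0 <= r' < 1 ->
  modulus (\sum_(p < N) c p * (Complex r 0 * cis t) ^+ p -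
           \sum_(p < N) c p * (Complex r' 0 * cis t) ^+ p) <= lam.
Proof.
move=> l0; pose X := \sum_(p < N) modulus (c p) * p%:R + 1.
have X0 : 0 < X by rewrite ltr_wpDl// sumr_ge0// => p _; rewrite mulr_ge0// modulus_ge0.
have d0 : 0 < lam / X by rewrite divr_gt0.
exists (Num.max 2^-1 (1 - lam / X)); first by rewrite le_max lexx gt_max ltrBlDr ltrDl d0 andbT; lra.
move=> r r' /andP[+ r1] /andP[+ r1']; rewrite !ge_max => /andP[r2 rX] /andP[r2' rX'].
rewrite -sumrB; apply: le_trans (modulus_sum _ _ _) _.
apply: (@le_trans _ _ (\sum_(p < N) modulus (c p) * p%:R * (lam / X))); last first.
  rewrite -mulr_suml mulrA ler_pdivrMr// mulrC ler_wpM2l ?(ltW l0)//.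
  by rewrite /X lerDl.
apply: ler_sum => p _; rewrite -mulrBr modulusM -mulrA ler_wpM2l ?modulus_ge0//.
have -> : (Complex r 0 * cis t) ^+ p - (Complex r' 0 * cis t) ^+ p =
    Complex (r ^+ p - r' ^+ p) 0 * cis t ^+ p.
  rewrite !exprMn -mulrBl; congr (_ * _).
  by rewrite -[RHS]/(real_complex R _) rmorphB !rmorphXn.
rewrite modulusM modulusX modulus_cis expr1n mulr1 modulus_real.
apply: le_trans (dist_expr _ _ _) _; [lra|lra|].
by rewrite ler_wpM2l// ler_norml; lra.
Qed.

(* Outside [U N], the maximal function of the polynomial [s_N' - s_N] is small for
   infinitely many [N'], so that [F] is uniformly close to [s_N] along the radius. *)
Lemma radial_cauchy_ae eta lam : 0 < eta < 2 * pi -> 0 < lam ->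
  leb.-negligible [set t | eta <= t <= 2 * pi - eta /\ ~ radial_cauchy (3 * lam) t].
Proof.
move=> e01 l0; have [K K0 hK] := maximal_bound i e01.
(* Chosen so that [K * a = lam]. *)
pose a := lam / K; have a0 : 0 < a by rewrite divr_gt0.
pose A N N' := [set t | HL_maximal (poly_circle N' (tail_coef N c) \_ period) t > a%:E]%E.
have mA N N' : measurable (A N N').
  have mH := measurable_HL_maximal (locally_integrable_poly N' (tail_coef N c)).
  have := emeasurable_fun_o_infty measurableT mH a%:E; rewrite setTI; exact.
(* [I N M] asks the maximal function to exceed [a] for all [N' >= M]. It increases with [M] and lies
   in [A N M], so continuity from below gives [U N] the bound common to the [A N N']. *)
pose I N M := \bigcap_(N' in [set N' | (M <= N')%N]) A N N'.
have mI N M : measurable (I N M) by apply: bigcap_measurable => //; exists M => /=.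
pose U N := \bigcup_M I N M.
have mU N : measurable (U N) by exact: bigcup_measurable.
have leU N e : (forall N', leb (A N N') <= e%:E)%E -> (leb (U N) <= e%:E)%E.
  move=> h; have cv : leb (I N M) @[M --> \oo] --> leb (U N).
    apply: nondecreasing_cvg_mu => [||M M' MM]; [exact: mI|exact: (mU N)|].
    apply/subsetPset => t It N' /= M'N; by apply: It => /=; exact: leq_trans M'N.
  rewrite -(cvg_lim _ cv)//; apply: lime_le; first by apply/cvg_ex; eexists; exact: cv.
  apply: nearW => M; apply: le_trans (h M); apply: le_measure; rewrite ?inE; [exact: mI|exact: mA|].
  by move=> t It; exact: (It M (leqnn M)).
have mZ : measurable (\bigcap_N U N) by apply: bigcap_measurable => [|N _]; [exists 0%N|exact: mU].
exists (\bigcap_N U N); split; first exact: mZ.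
  apply/eqP; rewrite eq_le measure_ge0 andbT; apply/lee_addgt0Pr => e e0; rewrite add0e.
  have pi0 : 0 < 2 * pi :> R := @twopi_gt0 R.
  (* Makes the weak-type bound [3 / a * (2 * pi * d)] equal to [e]. *)
  pose d := e / (3 / a * (2 * pi)).
  have x0 : 0 < 3 / a * (2 * pi) by rewrite mulr_gt0// divr_gt0.
  have d0 : 0 < d by rewrite divr_gt0.
  have [N hN] := tail_coef_small cB (exprn_gt0 2 d0).
  apply: (@le_trans _ _ (leb (U N))).
    apply: le_measure; rewrite ?inE; [exact: mZ|exact: mU|by move=> t; exact].
  apply: leU => N'; apply: le_trans (weak_type i d0 a0 (hN N')) _.
  by rewrite lee_fin mulrA /d mulrCA mulfV ?mulr1// gt_eqF.
move=> t [te nc]; apply: contrapT => nU; apply: nc.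
have [N nUN] : exists N, ~ U N t.
  by apply: contrapT => h; apply: nU => N _; apply: contrapT => h2; apply: h; exists N.
pose s r := \sum_(p < N) c p * (Complex r 0 * cis t) ^+ p.
have near r : 2^-1 <= r < 1 -> modulus (F r t - s r) <= lam.
  move=> r12; have r01 : 0 <= r < 1 by lra.
  apply/ler_addgt0Pr => e e0; have [M hM] := hassum_nat (cF t r01) e0.
  have [N' /= NN' nA] : exists2 N', (maxn M N <= N')%N & ~ A N N' t.
    apply: contrapT => h; apply: nUN; exists (maxn M N) => // N' /= NN'.
    by apply: contrapT => h2; apply: h; exists N'.
  have /(_ N') := hM; rewrite (leq_trans (leq_maxl _ _) NN') => /(_ isT) h1.
  have NN : (N <= N')%N := leq_trans (leq_maxr _ _) NN'.
  have := hK N' (tail_coef N c) t r te r12.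
  have -> : \sum_(p < N') tail_coef N c p * (Complex r 0 * cis t) ^+ p =
      \sum_(p < N') c p * (Complex r 0 * cis t) ^+ p - s r.
    rewrite -(sum_tail (fun p => c p * (Complex r 0 * cis t) ^+ p) NN); apply: eq_bigr => p _.
    by rewrite /tail_coef; case: ifP => // _; rewrite mul0r.
  set X := \sum_(p < N') _ in h1 *.
  have HL : (HL_maximal (poly_circle N' (tail_coef N c) \_ period) t <= a%:E)%E.
    by rewrite leNgt; apply/negP => h; apply: nA.
  move=> h2; have := lee_wpmul2l (_ : (0 <= K%:E)%E) HL; rewrite lee_fin (ltW K0) => /(_ isT) h3.
  have := le_trans h2 h3; rewrite -EFinM lee_fin /a mulrCA mulfV ?gt_eqF// mulr1 => h4.
  have -> : F r t - s r = (X - s r) - (X - F r t) by ring.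
  by apply: le_trans (modulusD _ _) _; rewrite modulusN; lra.
have [r0 /andP[r02 r01] hr] := poly_radial_cauchy N t l0.
exists r0 => [|r r' /andP[h1 h2] /andP[h3 h4]]; first by rewrite r01 andbT; lra.
have a1 : modulus (F r t - s r) <= lam by apply: near; rewrite h2 andbT; lra.
have a2 : modulus (F r' t - s r') <= lam by apply: near; rewrite h4 andbT; lra.
have a3 : modulus (s r - s r') <= lam by apply: hr; rewrite ?h1 ?h2 ?h3 ?h4.
(* Two distances from [F] to the polynomial, and the oscillation of the polynomial itself. *)
have -> : 3 * lam = lam + lam + lam by ring.
exact: le_trans (modulus_dist4 _ _ _ _) (lerD (lerD a1 a3) a2).
Qed.

End RadialLimits.

(** * Boundary values of a function of one variable *)

Section Fatou.
Context {R : realType} {n : nat} (i : 'I_n).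
Local Notation C := (Cplx R).
Local Notation mi := {ffun 'I_n -> nat}.
Local Notation leb := (@lebesgue_measure R).
Local Notation P := (uniform_prob (@twopi_gt0 R)).
Local Notation TR := (n.-tuple (measurableTypeR R)).
Local Notation mu := (torus_measure R n).
Local Notation rad N := (1 - N.+1%:R^-1 : R).
Variable theta : polydisc R n -> C.
Hypotheses (th : hardy theta) (td : depends_only_on i theta).

Lemma ev_depends j : j <> i -> ev j theta = theta.
Proof.
move=> ji; apply/funext => z; apply: td.
by rewrite /coord /= mxE; case: eqP => // ij; case: ji.
Qed.

Definition axis_coef p : C := taylor theta (axis i p).

Lemma axis_coef_bound N : \sum_(p < N) modulus (axis_coef p) ^+ 2 <= hnorm theta ^+ 2.
Proof.
pose A := [fset axis i (val p) | p in 'I_N]%fset.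
have <- : \sum_(k <- A) modulus (taylor theta k) ^+ 2 = \sum_(p < N) modulus (axis_coef p) ^+ 2.
  rewrite /A big_imfset /= ?big_enum// => p q _ _ /eqP.
  by rewrite axis_eq => /eqP/val_inj.
exact: hassum_real_le (fun k => sqr_ge0 _) (hassum_taylor_hnorm th).
Qed.

(** Any point of the torus with angle [s] in position [i] gives the same value; the constant tuple
    is one. *)
Definition radial (r s : R) : C := ext0 theta (circle_pt r [tuple of nseq n s]).

Lemma radialE r (t : n.-tuple R) : 0 <= r < 1 -> ext0 theta (circle_pt r t) = radial r (tnth t i).
Proof.
move=> r01; rewrite /radial !(ext0_circle _ _ r01); apply: td.
by rewrite !coord_pd /cpt tnth_nseq.
Qed.

Lemma hassum_radial r s : 0 <= r < 1 ->
  hassum (fun p => axis_coef p * (Complex r 0 * cis s) ^+ p) (radial r s).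
Proof.
move=> r01; rewrite /radial (ext0_circle _ _ r01).
have h := series_pd (cpt_lt1 [tuple of nseq n s] r01) (series_taylor th).
pose G (k : mi) := taylor theta k * mon (cpt r [tuple of nseq n s]) k.
have K : cancel (axis i) (fun k : mi => k i) by move=> p; rewrite ffunE eqxx.
have G0 (k : mi) : axis i (k i) <> k -> G k = 0.
  by move=> kE; rewrite /G (@taylor_axis_only _ _ i) ?mul0r//; [exact: ev_depends|move=> kE'; apply: kE].
apply: eq_hassum (hassum_preimage K G0 h) => p; rewrite /G /=; congr (_ * _).
rewrite /mon (bigD1 i)//= ffunE eqxx big1 ?mulr1 => [|j /negbTE ji]; last by rewrite ffunE ji expr0.
by rewrite /cpt tnth_nseq.
Qed.

Lemma radial_cauchy_le (F : R -> R -> C) lam lam' s : lam <= lam' ->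
  radial_cauchy F lam s -> radial_cauchy F lam' s.
Proof.
by move=> ll [r0 r01 h]; exists r0 => // r r' hr hr'; apply: le_trans ll; exact: h.
Qed.

Lemma uniform_outside : P.-negligible (~` `]0, 2 * pi[%classic).
Proof.
have : P.-negligible (~` period `|` ([set 0] `|` [set 2 * pi])).
  have N1 (x : R) : P.-negligible [set x].
    by apply: uniform_negligible; exists [set x]; split => //; exact: lebesgue_measure_set1.
  apply: negligibleU; last by apply: negligibleU; exact: N1.
  have mp := measurableC (@measurable_period R).
  exists (~` period); split => //.
  have PE : (P (~` period) = \int[P]_x (\1_(~` period) x)%:E)%E by rewrite integral_indic// setIT.
  transitivity (\int[P]_x (\1_(~` period) x)%:E)%E; first exact: PE.
  rewrite integral_uniform; last 2 first.
  - by apply/measurable_EFinP; exact: measurable_indic.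
  - by move=> x; rewrite lee_fin.
  rewrite -(mule0 ((2 * pi - 0)^-1)%:E); congr (_ * _)%E.
  by apply: integral0_eq => x xp; rewrite indicE memNset.
apply: negligibleS => x /=; rewrite in_itv /= => /negP x0.
have [xp|xp] := pselect (period x); last by left.
right; move: xp; rewrite /period /= in_itv /= => /andP[x1 x2].
move: x0; rewrite negb_and -!leNgt => /orP[x3|x3]; [left|right]; apply/eqP; rewrite eq_le.
  by rewrite x3 x1.
by rewrite x2 x3.
Qed.

(** Monotonicity in the margin and in [lam] reduces the exceptional set to a countable union, over
    margins [1 / (m + 1)] and oscillations [3 / (k + 1)]; angles outside the open period are
    negligible. *)
Lemma radial_cauchy_all_ae :
  {ae mu, forall t, forall lam, 0 < lam -> radial_cauchy radial lam (tnth t i)}.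
Proof.
pose E s := forall lam, 0 < lam -> radial_cauchy radial lam s.
suff : P.-negligible [set s | ~ E s] by move/(torus_negligible i); exact.
pose eta m : R := m.+1%:R^-1.
have pi2 := pi_ge2 R.
have e0 m : 0 < eta m by rewrite invr_gt0.
have e1 m : eta m <= 1 by rewrite invf_le1 ?ler1n ?ltr0n.
have small (x : R) : 0 < x -> exists m, eta m <= x.
  move=> x0; exists (Num.bound x^-1); rewrite /eta invf_ple ?posrE//.
  have := archi_boundP (ltW (_ : 0 < x^-1)); rewrite invr_gt0 => /(_ x0) h.
  by apply: le_trans (ltW h) _; rewrite ler_nat.
pose Bad m k := [set s | eta m <= s <= 2 * pi - eta m /\ ~ radial_cauchy radial (3 * eta k) s].
have : P.-negligible ((~` `]0, 2 * pi[%classic) `|` \bigcup_m \bigcup_k Bad m k).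
  apply: negligibleU; first exact: uniform_outside.
  apply: negligible_bigcup => m; apply: negligible_bigcup => k; apply: uniform_negligible.
  apply: (radial_cauchy_ae i axis_coef_bound) => //; first exact: hassum_radial.
  by rewrite e0 /=; have := e1 m; lra.
apply: negligibleS => s nE; have [s0|s0] := pselect (`]0, 2 * pi[%classic s); last by left.
right; move: s0; rewrite /= in_itv /= => /andP[s0 s1].
have [lam [l0 nc]] : exists lam, 0 < lam /\ ~ radial_cauchy radial lam s.
  apply: contrapT => h; apply: nE => lam l0; apply: contrapT => h2; apply: h.
  by exists lam.
have [m hm] : exists m, eta m <= Num.min s (2 * pi - s).
  by apply: small; rewrite lt_min s0 subr_gt0.
have [k hk] : exists k, eta k <= lam / 3 by apply: small; rewrite divr_gt0.
move: hm; rewrite le_min => /andP[m1 m2].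
exists m => //; exists k => //; split; first by rewrite m1 /=; lra.
by move=> h; apply: nc; apply: radial_cauchy_le h; lra.
Qed.

Lemma radial_limit (t : n.-tuple R) :
  (forall lam, 0 < lam -> radial_cauchy radial lam (tnth t i)) ->
  exists l : C, ext0 theta (circle_pt r t) @[r --> (1 : R)^'-] --> l.
Proof.
move=> h; pose u N := radial (rad N) (tnth t i).
have radle r0 : r0 < 1 -> exists N0, forall N, (N0 <= N)%N -> r0 <= rad N.
  move=> r01; have := @cvg_radius R 1 => /cvgrPdist_lt/(_ (1 - r0)); rewrite subr_gt0 => /(_ r01)[N0 _ hN].
  exists N0 => N /hN /=; rewrite expr1 => /(le_lt_trans (ler_norm _)); set x := N.+1%:R^-1; lra.
have [|l hl] := @complex_cauchy R u.
  move=> e e0; have [r0 /andP[r00 r01] hr] := h e e0; have [N0 hN] := radle _ r01.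
  by exists N0 => m Nm; apply: hr; rewrite hN ?(andP (radius01 _)).2.
exists l; apply/cvgrPdist_lt => e /complex_gt0[d d0 ->].
have d3 : 0 < d / 3 by rewrite divr_gt0.
have [r0 /andP[r00 r01] hr] := h _ d3; have [N0 hN] := radle _ r01.
have [N1 hN1] := hl _ d3; pose N := maxn N0 N1.
exists (1 - r0) => /=; first by rewrite subr_gt0.
move=> r hr1 r1; have rr0 : r0 <= r by have := ler_norm (1 - r); move: hr1; rewrite /ball_ /=; lra.
rewrite normr_modulus ltcR (radialE _ (_ : 0 <= r < 1)); last by rewrite r1 (le_trans r00).
have a1 : modulus (u N - l) <= d / 3 by apply: hN1; exact: leq_maxr.
have a2 : modulus (u N - radial r (tnth t i)) <= d / 3.
  by apply: hr; rewrite ?rr0 ?r1 ?hN ?leq_maxl ?(andP (radius01 _)).2.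
have := modulusD (l - u N) (u N - radial r (tnth t i)); rewrite subrKA [modulus (l - _)]modulusB.
lra.
Qed.

Lemma ae_torusI (A A' : n.-tuple R -> Prop) :
  {ae mu, forall t, A t} -> {ae mu, forall t, A' t} -> {ae mu, forall t, A t /\ A' t}.
Proof.
move=> hA hA'; have := negligibleU hA hA'; apply: negligibleS => t.
by move=> /not_andP.
Qed.

Lemma limr_le_cst (x : nat -> R) (l b : R) : x N @[N --> \oo] --> l -> (forall N, x N <= b) -> l <= b.
Proof.
move=> xl xb; rewrite -(cvg_lim _ xl)//; apply: limr_le; first by apply/cvg_ex; exists l.
exact: nearW.
Qed.

(** The squared modulus of the limit is at most 1 and, by dominated convergence, its integral is the
    squared norm of [theta], which is 1; so it equals 1 almost everywhere. *)
Lemma radial_modulus_ae : (forall z, modulus (theta z) <= 1) -> hnorm theta = 1 ->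
  {ae mu, forall t, exists2 l : C,
     ext0 theta (circle_pt r t) @[r --> (1 : R)^'-] --> l & modulus l = 1}.
Proof.
move=> t1 h1; pose g N (t : TR) := modulus (ext0 theta (circle_pt (rad N) t)) ^+ 2.
have mg N : measurable_fun [set: TR] (g N).
  by have [m _ _] := series_meansq (@radius01 R N) (series_taylor th); exact: measurable_funX.
have g1 N t : 0 <= g N t <= 1.
  rewrite sqr_ge0 /= -(expr1n R 2) lerXn2r ?nnegrE ?modulus_ge0//.
  by rewrite (ext0_circle _ _ (@radius01 R N)).
(* The limit exists only almost everywhere; the limsup clipped to [[0, 1]] is measurable, defined
   everywhere, and equals the squared modulus of the limit where there is one. *)
pose f (t : TR) := Num.max 0 (Num.min 1 (fine (limn_esup (fun N => (g N t)%:E)))).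
have mf : measurable_fun [set: TR] f.
  apply: measurable_maxr => //; apply: measurable_minr => //.
  apply: measurableT_comp => //; apply: measurable_fun_limn_esup => N.
  exact/measurable_EFinP.
have f01 t : 0 <= f t <= 1 by rewrite /f le_max lexx ge_max ler01 ge_min lexx.
have lim t : (forall lam, 0 < lam -> radial_cauchy radial lam (tnth t i)) ->
    exists l : C, [/\ ext0 theta (circle_pt r t) @[r --> (1 : R)^'-] --> l,
      g N t @[N --> \oo] --> modulus l ^+ 2 & f t = modulus l ^+ 2].
  move=> /radial_limit[l tl]; exists l.
  have gl : g N t @[N --> \oo] --> modulus l ^+ 2.
    have ml := cvg_radius_left tl.
    by under eq_cvg do rewrite /g expr2; rewrite expr2; exact: cvgM.
  split => //; have l01 : 0 <= modulus l ^+ 2 <= 1.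
    rewrite sqr_ge0 /=; apply: limr_le_cst gl _.
    by move=> N; case/andP: (g1 N t).
  have gE : (g N t)%:E @[N --> \oo] --> (modulus l ^+ 2)%:E.
    by apply/fine_cvgP; split; [exact: nearW|exact: gl].
  rewrite /f (cvg_limn_einf_sup gE).2 /=.
  by rewrite min_r ?max_r //; case/andP: l01.
have rc := radial_cauchy_all_ae.
have gf : {ae mu, forall t, g N t @[N --> \oo] --> f t}.
  by apply: ae_torusS rc => t /lim[l [_ gl ->]].
have cv1 := cvg_meansq th; rewrite h1 expr1n in cv1.
have cv2 : \int[mu]_t g N t @[N --> \oo] --> \int[mu]_t f t.
  apply: (torus_dominated_convergence mg mf gf (B := 1)) => N t.
  by rewrite ger0_norm; case/andP: (g1 N t).
have f1 : \int[mu]_t f t = 1 by exact: (cvg_unique _ cv2 cv1).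
have fi : mu.-integrable setT (EFin \o f).
  by apply: (integrable_torus_bounded mf (B := 1)) => t; rewrite ger0_norm; case/andP: (f01 t).
have ci : mu.-integrable setT (EFin \o (fun _ : TR => 1 : R)).
  by apply: (@integrable_torus_bounded _ _ _ 1) => // t; rewrite normr1.
have hi : mu.-integrable setT (EFin \o (fun t => 1 - f t)).
  exact: (integrableB measurableT ci fi).
have h0 : (\int[mu]_t `|(1 - f t)%:E| = 0)%E.
  have -> : (\int[mu]_t `|(1 - f t)%:E| = \int[mu]_t (1 - f t)%:E)%E.
    by apply: eq_integral => t _; rewrite abse_EFin ger0_norm// subr_ge0; case/andP: (f01 t).
  rewrite -(fineK (integrable_fin_num measurableT hi)) -[fine _]/(\int[mu]_t (1 - f t)).
  rewrite RintegralB// f1 [X in X - 1](_ : _ = 1) ?subrr//.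
  by rewrite /Rintegral integral_torus_cst.
have mh : measurable_fun setT (EFin \o (fun t => 1 - f t)) by case/integrableP: hi.
have fe := (ae_eq_integral_abs mu measurableT mh).1 h0.
apply: ae_torusS (ae_torusI rc fe) => t [/lim[l [tl _ fl]] f1t].
exists l => //; have := f1t I; rewrite /= => -[/eqP]; rewrite subr_eq0 fl eq_sym sqrf_eq1.
by case/orP => /eqP // l1; have := modulus_ge0 l; rewrite l1; lra.
Qed.

End Fatou.

(** [hS0] excludes the zero submodule: there the defect condition holds trivially, whereas [theta]
    itself is a nonzero element of [theta H^2]. *)
Theorem theorem1p3 (R : realType) (n : nat) (hn : (2 <= n)%N)
    (S : set (polydisc R n -> Cplx R)) (hS : submodule S)
    (hS0 : exists2 f, S f & f <> 0) (i : 'I_n) :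
  (exists theta : polydisc R n -> Cplx R,
     [/\ inner_function theta, depends_only_on i theta &
         S = [set (fun z => theta z * f z) | f in @hardy R n]])
  <->
  (forall j : 'I_n, j <> i ->
     forall f, S f -> defectE S j (defectR S j f) = 0).
Proof.
split=> [[theta [ti td SE]]|D].
  exact: inner_function_defect hS ti td SE.
have red j f : j <> i -> S f -> S (ev j f) /\ S (backshift j f).
  by move=> ji; exact: defect_reducing hS (D j ji) f.
have [theta [an t1 h1 td SE]] := generator_exists hS red hS0.
exists theta; split=> //; split=> //; first by exists 1.
exact: radial_modulus_ae (bounded_hardy an t1) td t1 h1.
Qed.
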